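(* Let $n\geq 1$ be an integer and let $p>n$ be real. For every nonempty open set $\Omega\subsetneq\mathbb{R}^n$, $$C_{n,p}^{-p}=\lambda_p(\mathbb{R}^n\setminus\{0\})\leq \lambda_p(\Omega)\leq \lambda_p(\mathbb{R}^n_+)=2^{n-1}C_{n,p}^{-p},$$ where $\mathbb{R}^n_+=\{x\in\mathbb{R}^n: x_n>0\}$ and $C_{n,p}$ is the sharp constant in Morrey's inequality.
   Context: $\mathcal{D}^{1,p}(\mathbb{R}^n)=\{u\in L^1_{\rm loc}(\mathbb{R}^n): \text{all weak partial derivatives } u_{x_i}\in L^p(\mathbb{R}^n)\}$; since $p>n$, each $u$ is identified with its Hölder continuous representative. $C_{n,p}$ is the smallest $C>0$ such that $\sup_{x\ne y}\frac{|u(x)-u(y)|}{|x-y|^{1-n/p}}\le C\bigl(\int_{\mathbb{R}^n}|Du|^p\,dz\bigr)^{1/p}$ for all $u\in\mathcal{D}^{1,p}(\mathbb{R}^n)$. For a nonempty open $\Omega\subsetneq\mathbb{R}^n$, $\mathcal{D}^{1,p}_0(\Omega)=\{u\in\mathcal{D}^{1,p}(\mathbb{R}^n): u(x)=0 \text{ for all } x\notin\Omega\}$, with norm $\|Du\|_p$ ($\|\cdot\|_p$ is the $L^p(\Omega)$ norm), and $d_\Omega(x)=\inf_{y\in\Omega^c}|x-y|$. For $u\in\mathcal{D}^{1,p}_0(\Omega)\setminus\{0\}$, $\mathcal{R}_p(\Omega,u)=\bigl\|u/d_\Omega^{1-n/p}\bigr\|_\infty^{-p}\,\|Du\|_p^p$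 (the supremum norm is taken over $\Omega$), and $\lambda_p(\Omega)=\inf_{u\in\mathcal{D}^{1,p}_0(\Omega)\setminus\{0\}}\mathcal{R}_p(\Omega,u)$. *)

(* Defs.v *)
From HB Require Import structures.
From mathcomp Require Import all_boot all_order all_algebra.
From mathcomp Require Import all_classical all_reals all_analysis.

Set Implicit Arguments.
Unset Strict Implicit.
Unset Printing Implicit Defensive.

Import Order.TTheory GRing.Theory Num.Theory.
Import numFieldNormedType.Exports.

Local Open Scope classical_set_scope.
Local Open Scope ring_scope.

(* The sigma-algebra on ['rV[T]_n] generated by the coordinates, as the library
   does for [n.-tuple T]. *)
Definition measure_rV_display : measure_display -> measure_display.
Proof. exact. Qed.

Section measurable_rV.
Context {d} {T : measurableType d} (n : nat).

Let coord (i : 'I_n) (x : 'rV[T]_n) : T := x ord0 i.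

Let rV_set0 : g_sigma_preimage coord set0.
Proof. exact: sigma_algebra0. Qed.

Let rV_setC A : g_sigma_preimage coord A -> g_sigma_preimage coord (~` A).
Proof. exact: sigma_algebraC. Qed.

Let rV_bigcup (F : (set 'rV[T]_n)^nat) :
  (forall i, g_sigma_preimage coord (F i)) ->
  g_sigma_preimage coord (\bigcup_i (F i)).
Proof. exact: sigma_algebra_bigcup. Qed.

HB.instance Definition _ := @isMeasurable.Build
  (measure_rV_display d) 'rV[T]_n
  (g_sigma_preimage coord) rV_set0 rV_setC rV_bigcup.

End measurable_rV.

Lemma measurable_rV_coord d (T : measurableType d) n (i : 'I_n) :
  measurable_fun [set: 'rV[T]_n] (fun x => x ord0 i).
Proof.
move=> _ Y mY; rewrite setTI; apply: sub_sigma_algebra => /=.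
rewrite -bigcup_seq/=; exists i => /=; first by rewrite mem_index_enum.
by exists Y => //; rewrite setTI.
Qed.

Lemma measurable_fun_rVP d1 d2 (T1 : measurableType d1)
    (T2 : measurableType d2) n (f : T1 -> 'rV[T2]_n) :
  (forall i, measurable_fun [set: T1] (fun x => f x ord0 i)) ->
  measurable_fun [set: T1] f.
Proof.
move=> mf; have H : g_sigma_preimage (fun i x => f x ord0 i) `<=` measurable.
  apply: smallest_sub; first exact: sigma_algebra_measurable.
  case: n => [|n] in f mf *; first by rewrite big_ord0.
  rewrite -bigcup_mkord_ord; apply: bigcup_sub => i Ii.
  by move=> A [B mB <-]; exact: mf.
move=> _ A mA; apply: H.
by rewrite (g_sigma_preimage_comp (fun i (x : 'rV[T2]_n) => x ord0 i) f); exists A.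
Qed.

Section lebesgue_measure_rV_cons.
Context {R : realType} (n : nat).
Variable mu : {sigma_finite_measure set 'rV[R]_n -> \bar R}.
Local Open Scope ereal_scope.

Definition rV_cons (z : R * 'rV[R]_n) : 'rV[R]_n.+1 :=
  \row_i oapp (z.2 ord0) z.1 (unlift ord0 i).

Lemma rV_consE0 z : rV_cons z ord0 ord0 = z.1.
Proof. by rewrite mxE unlift_none. Qed.

Lemma rV_consES z i : rV_cons z ord0 (lift ord0 i) = z.2 ord0 i.
Proof. by rewrite mxE liftK. Qed.

Lemma measurable_rV_cons : measurable_fun setT rV_cons.
Proof.
apply: measurable_fun_rVP => i; case: (unliftP ord0 i) => [j|] ->.
  under eq_fun do rewrite rV_consES.
  apply: (measurableT_comp (f := fun x : 'rV[R]_n => x ord0 j)) => //.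
  exact: measurable_rV_coord.
under eq_fun do rewrite rV_consE0.
exact: measurable_fst.
Qed.

Lemma measurable_rV_consV (A : set (R * 'rV[R]_n)) :
  measurable A -> measurable (rV_cons @` A).
Proof.
pose g (x : 'rV[R]_n.+1) := (x ord0 ord0, \row_i x ord0 (lift ord0 i)).
have mg : measurable_fun setT g.
  apply/measurable_fun_pair; first exact: measurable_rV_coord.
  apply: measurable_fun_rVP => i; under eq_fun do rewrite mxE.
  exact: measurable_rV_coord.
have gK : cancel g rV_cons.
  move=> x; apply/rowP => i; case: (unliftP ord0 i) => [j|] ->.
    by rewrite rV_consES mxE.
  by rewrite rV_consE0.
have Kg : cancel rV_cons g.
  move=> [x y]; rewrite /g rV_consE0; congr pair.
  by apply/rowP => i; rewrite mxE rV_consES.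
move=> mA; rewrite (_ : _ @` _ = g @^-1` A).
  by rewrite -[X in measurable X]setTI; exact: mg.
apply/seteqP; split => [_ [z Az <-]|x Agx] /=; first by rewrite Kg.
by exists (g x).
Qed.

Definition rV_lebesgueS : set 'rV[R]_n.+1 -> \bar R :=
  pushforward (@lebesgue_measure R \x mu) rV_cons.

Let rV_lebesgueS0 : rV_lebesgueS set0 = 0.
Proof. by rewrite /rV_lebesgueS /pushforward preimage_set0 measure0. Qed.

Let rV_lebesgueS_ge0 A : 0 <= rV_lebesgueS A.
Proof. exact: (measure_ge0 (@lebesgue_measure R \x mu)). Qed.

Let rV_lebesgueS_sigma_additive : semi_sigma_additive rV_lebesgueS.
Proof.
have mp B : measurable B -> measurable (rV_cons @^-1` B).
  by move=> mB; rewrite -[X in measurable X]setTI; exact: measurable_rV_cons.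
move=> F mF tF mUF; rewrite /rV_lebesgueS /pushforward preimage_bigcup.
apply: measure_semi_sigma_additive.
- by move=> i; exact: mp.
- apply/trivIsetP => /= i j _ _ ij; rewrite -preimage_setI.
  by move/trivIsetP : tF => /(_ _ _ _ _ ij) ->//; rewrite preimage_set0.
- by rewrite -preimage_bigcup; exact: mp.
Qed.

HB.instance Definition _ := isMeasure.Build _ _ _ rV_lebesgueS
  rV_lebesgueS0 rV_lebesgueS_ge0 rV_lebesgueS_sigma_additive.

Let rV_cons_inj : injective rV_cons.
Proof.
move=> [x y] [x' y'] e; congr pair.
  by move/rowP/(_ ord0) : e; rewrite !rV_consE0.
by apply/rowP => i; move/rowP/(_ (lift ord0 i)) : e; rewrite !rV_consES.
Qed.

Let rV_lebesgueS_sigma_finite : sigma_finite setT rV_lebesgueS.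
Proof.
have [F UF mF] : sigma_finite setT (@lebesgue_measure R \x mu).
  have /sigma_finiteP[F [TF ndF Foo]] := sigma_finiteT (@lebesgue_measure R).
  have /sigma_finiteP[G [TG ndG Goo]] := sigma_finiteT mu.
  exists (fun k => F k `*` G k).
    rewrite -setXTT TF TG predeqE => -[x y]; split.
      move=> [/= [i _ Fx] [k _ Gy]]; exists (maxn i k) => //; split.
      - by move: x Fx; exact/subsetPset/ndF/leq_maxl.
      - by move: y Gy; exact/subsetPset/ndG/leq_maxr.
    by move=> [k _ []/= ? ?]; split; exists k.
  move=> k; have [? ?] := Foo k; have [? ?] := Goo k.
  split; first exact: measurableX.
  by rewrite product_measure1E// lte_mul_pinfty// ge0_fin_numE.
exists (fun i => rV_cons @` F i).
  rewrite -image_bigcup -UF; apply/seteqP; split => // x _.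
  exists (x ord0 ord0, \row_i x ord0 (lift ord0 i)) => //.
  apply/rowP => i; case: (unliftP ord0 i) => [j|] ->.
    by rewrite rV_consES mxE.
  by rewrite rV_consE0.
move=> i; have [mFi Foo] := mF i; split; first exact: measurable_rV_consV.
rewrite /rV_lebesgueS /pushforward (_ : _ @^-1` _ = F i)//.
apply/seteqP; split => [z [z' Fz' /rV_cons_inj <-]//|z Fz]; by exists z.
Qed.

HB.instance Definition _ := Measure_isSigmaFinite.Build _ _ _ rV_lebesgueS
  rV_lebesgueS_sigma_finite.

End lebesgue_measure_rV_cons.

(* n-dimensional Lebesgue measure; [rV_lebesgue_box] below evaluates it on
   boxes. *)
Fixpoint rV_lebesgue (R : realType) (n : nat) :
    {sigma_finite_measure set 'rV[R]_n -> \bar R} :=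
  match n with
  | 0%N => dirac (0 : 'rV[R]_0)
  | n'.+1 => rV_lebesgueS (rV_lebesgue R n')
  end.

Lemma rV_lebesgue_box (R : realType) n (A : 'I_n -> set R) :
  (forall i, measurable (A i)) ->
  rV_lebesgue R n [set x | forall i, A i (x ord0 i)] =
  (\prod_(i < n) lebesgue_measure (A i))%E.
Proof.
elim: n A => [|n IH] A mA.
  rewrite big_ord0 /= diracE mem_set//; case; by case.
rewrite big_ord_recl -IH//= /rV_lebesgueS /pushforward.
rewrite -(@product_measure1E _ _ _ _ _ _ (rV_lebesgue R n))//.
  congr (_ _); apply/seteqP; split => [z /= Az|z [/= A0 AS] i].
    by split=> /= [|i]; [rewrite -(rV_consE0 z)|rewrite -rV_consES].
  by case: (unliftP ord0 i) => [j|] ->; rewrite ?rV_consES ?rV_consE0.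
  exact: mA.
rewrite (_ : (fun _ => _) = \bigcap_(i in [set: 'I_n])
    ((fun x : 'rV[R]_n => x ord0 i) @^-1` A (lift ord0 i))).
  apply: fin_bigcap_measurable => [|i _]; first exact: finite_finset.
  by rewrite -[X in measurable X]setTI; exact: measurable_rV_coord.
by apply/seteqP; split => [x /= Ax i _|x Ax i]; exact: Ax.
Qed.

Section sobolev.
Context {R : realType} {n : nat}.
Local Notation E := 'rV[R]_n.
Local Notation mu := (rV_lebesgue R n).
Implicit Types (u f g phi : E -> R) (p : R) (Omega : set E).

(* The library's norm on ['rV_n] is the sup norm (with the same topology). *)
Definition enorm (x : E) : R := Num.sqrt (\sum_i x ord0 i ^+ 2).

Definition partial (i : 'I_n) f : E -> R := 'D_(delta_mx ord0 i) f.

Definition smooth f := forall s : seq 'I_n,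
  continuous (foldr partial f s) /\
  forall i x, derivable (foldr partial f s) x (delta_mx ord0 i).

Definition test_function phi :=
  smooth phi /\ compact (closure [set x | phi x != 0]).

Definition rV_locally_integrable f :=
  measurable_fun setT f /\
  forall K, compact K -> mu.-integrable K (EFin \o f).

Definition is_weak_partial (i : 'I_n) u g :=
  rV_locally_integrable g /\
  forall phi, test_function phi ->
    \int[mu]_x (u x * partial i phi x) = - \int[mu]_x (g x * phi x).

(* Weak partial derivatives are unique only up to a null set; one of them is
   chosen, and 0 is the junk value when there is none. *)
Definition weak_grad u (x : E) : E :=
  \row_i xget (cst 0) [set g | is_weak_partial i u g] x.

(* As p > n, each class of functions is represented by its unique continuous
   member. *)
Definition D1p p : set (E -> R) :=
  [set u | [/\ rV_locally_integrable u,
             forall i, exists2 g, is_weak_partial i u g & g \in Lfun mu p%:E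
           & continuous u]].

Definition grad_Lnorm p Omega u : \bar R :=
  (\int[mu]_(x in Omega) (enorm (weak_grad u x) `^ p)%:E) `^ p^-1.

Definition holder_seminorm p u : \bar R :=
  ereal_sup [set (`|u z.1 - u z.2| / enorm (z.1 - z.2) `^ (1 - n%:R / p))%:E
            | z in [set z : E * E | z.1 != z.2]].

Definition dist_compl Omega (x : E) : R :=
  inf [set enorm (x - y) | y in ~` Omega].

Definition D1p0 p Omega : set (E -> R) :=
  [set u | D1p p u /\ forall x, ~ Omega x -> u x = 0].

Definition hardy_supnorm p Omega u : \bar R :=
  ereal_sup [set (`|u x| / dist_compl Omega x `^ (1 - n%:R / p))%:E
            | x in Omega].

(* [poweR +oo (- p)] is +oo in the library, hence the inverse. *)
Definition hardy_quotient p Omega u : \bar R :=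
  (hardy_supnorm p Omega u `^ p)^-1 * grad_Lnorm p Omega u `^ p.

Definition hardy_lambda p Omega : \bar R :=
  ereal_inf [set hardy_quotient p Omega u | u in D1p0 p Omega `\ cst 0].

(* x_n > 0; with indices starting at 0 the last coordinate is the one whose
   index i satisfies i + 1 = n. *)
Definition half_space : set E :=
  [set x | forall i : 'I_n, i.+1 = n -> 0 < x ord0 i].

End sobolev.

Definition morrey_const {R : realType} (n : nat) (p : R) : R :=
  inf [set C | 0 < C /\ forall u : 'rV[R]_n -> R, D1p p u ->
                (holder_seminorm p u <= C%:E * grad_Lnorm p setT u)%E].

(* Main.v *)
(** For a set [Omega] let K be Hardy-admissible if
    |u(x)|^p <= K d(x)^(p-n) \int |Du|^p for all u vanishing off [Omega], and
    Morrey-admissible if |u(x) - u(y)|^p <= K |x-y|^(p-n) \int |Du|^p for all u.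
    The best constants are the reciprocals of the numbers [hardy_lambda] and
    [morrey_const `^ (- p)], so it suffices to compare admissible K.

    Subtracting u(y) and translating, Morrey-admissibility is the same as
    Hardy-admissibility for the punctured space; choosing y a nearest point of the
    complement it implies Hardy-admissibility for every [Omega].
    Conversely, a function on the half-space can be truncated to have compact
    support there, hence support in a large ball tangent to the boundary at a
    prescribed point; a similarity maps this ball to a ball of [Omega] that touches
    the complement, so Hardy-admissibility for [Omega] passes to the half-space.
    For the half-space, the odd reflection of u has twice the energy of u, since Du
    vanishes almost everywhere on {u = 0}; and the odd part v of an arbitrary u with
    respect to the bisecting hyperplane of x and y has at most half of the energy of
    u on either side.  Both computations lose exactly the factor 2^(n-1).

    The truncations rest on the chain rule for weak derivatives of a continuous u,
    proved by difference quotients from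
    u(x) - u(x - h e_i) = \int_0^h D_i u (x - t e_i) dt almost everywhere. *)

Require Import Defs.
From HB Require Import structures.
From mathcomp Require Import all_boot all_order all_algebra.
From mathcomp Require Import all_classical all_reals all_analysis.
From mathcomp Require Import measurable_realfun.
From mathcomp Require Import ring lra.

Set Implicit Arguments.
Unset Strict Implicit.
Unset Printing Implicit Defensive.

Import Order.TTheory GRing.Theory Num.Theory.
Import numFieldNormedType.Exports.

Local Open Scope classical_set_scope.
Local Open Scope ring_scope.

(** * Boxes and the measurable structure *)

(** The constants are sharp, so cutting a function off, along a hyperplane or at infinity, may cost
    only a factor that tends to 1. Along a hyperplane, a continuous function that vanishes there is
    first lowered by a small d. On bounded sets the result vanishes near the hyperplane, and the
    smooth cutoffs [eta (k x_j)] leave no trace in the limit. At infinity, a cutoff dilated by k has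
    energy of order k^(n - p), which tends to 0 because p > n. Its product with a function is
    controlled only if that function is bounded, hence a second truncation, from above. The mixed
    term in the gradient is absorbed by convexity with weights 1 - l and l, where l tends to 0.

    A priori [hardy_lambda] may be 0 or infinite. Testing it against positive reals r, which
    correspond to the constants K = 1 / r, treats all cases alike. *)

Section boxes.
Context {R : realType} {n : nat}.
Local Notation E := 'rV[R]_n.
Local Notation mu := (rV_lebesgue R n).
Implicit Types a b x : E.

Lemma coord_le_norm x i : `|x ord0 i| <= `|x|.
Proof.
rewrite [leRHS]/Num.Def.normr /= mx_normrE.
exact: (le_bigmax (0 : R) (fun ij : 'I_1 * 'I_n => `|x ij.1 ij.2|) (ord0, i)).
Qed.

Lemma rV_norm_le x (M : R) : 0 <= M -> (forall i, `|x ord0 i| <= M) -> `|x| <= M.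
Proof.
move=> M0 h; rewrite [leLHS]/Num.Def.normr /= mx_normrE; apply/bigmax_leP; split => //.
by move=> [i j] _ /=; rewrite (ord1 i).
Qed.

Lemma rV_nat_bound x : exists k : nat, forall i, `|x ord0 i| < k%:R.
Proof.
exists (Num.bound `|x|) => i; apply: le_lt_trans (coord_le_norm x i) _.
exact: archi_boundP.
Qed.

Definition open_box a b : set E :=
  [set x | forall i, a ord0 i < x ord0 i < b ord0 i].

Lemma measurable_coord_box (A : 'I_n -> set R) :
  (forall i, measurable (A i)) ->
  measurable [set x : E | forall i, A i (x ord0 i)].
Proof.
move=> mA; rewrite (_ : mkset _ = \bigcap_(i in [set: 'I_n])
    ((fun x : E => x ord0 i) @^-1` A i)).
  apply: fin_bigcap_measurable => [|i _]; first exact: finite_finset.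
  by rewrite -[X in measurable X]setTI; exact: measurable_rV_coord.
by apply/seteqP; split => [x /= Ax i _|x Ax i]; exact: Ax.
Qed.

Lemma open_boxE a b :
  open_box a b = [set x : E | forall i, `]a ord0 i, b ord0 i[%classic (x ord0 i)].
Proof.
by apply/seteqP; split => x /= h i; have := h i; rewrite /= in_itv.
Qed.

Lemma measurable_open_box a b : measurable (open_box a b).
Proof.
by rewrite open_boxE; apply: (measurable_coord_box
  (A := fun i => `]a ord0 i, b ord0 i[%classic)) => i.
Qed.

Lemma open_box_setI a b a' b' : open_box a b `&` open_box a' b' =
  open_box (\row_i Num.max (a ord0 i) (a' ord0 i))
           (\row_i Num.min (b ord0 i) (b' ord0 i)).
Proof.
apply/seteqP; split => [x [h h'] i|x h].
  by rewrite !mxE gt_max lt_min; case/andP: (h i) => -> ->;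
     case/andP: (h' i) => -> ->.
by split => i; have := h i; rewrite !mxE gt_max lt_min =>
  /andP[/andP[? ?] /andP[? ?]]; apply/andP.
Qed.

Lemma mu_open_box a b : mu (open_box a b) =
  (\prod_(i < n) (Num.max 0 (b ord0 i - a ord0 i))%:E)%E.
Proof.
rewrite open_boxE (rV_lebesgue_box
  (A := fun i => `]a ord0 i, b ord0 i[%classic))//; apply: eq_bigr => i _.
rewrite lebesgue_measure_itv/= lte_fin; case: ltP => h.
  by rewrite max_r ?EFinB// subr_ge0 ltW.
by rewrite max_l// subr_le0.
Qed.

Lemma mu_open_box_fin a b : (mu (open_box a b) < +oo)%E.
Proof. by rewrite mu_open_box prodEFin ltry. Qed.

Lemma open_rV_box (U : set E) x : open U -> U x ->
  exists e : R, 0 < e /\ forall y : E, (forall i, `|x ord0 i - y ord0 i| < e) -> U y.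
Proof.
move=> oU Ux; have /nbhs_ballP[e /= e0 eU] := open_nbhs_nbhs (conj oU Ux).
exists e; split => // y h; apply: eU; split => // i j.
by rewrite (ord1 i); exact: h.
Qed.

(** An open set is the union of the boxes with rational corners that it contains, and these are
    countably many. [F q] is empty for a box that sticks out of U. *)
Lemma open_measurable_rV (U : set E) : open U -> measurable U.
Proof.
move=> oU.
pose B (q : 'rV[rat]_n * 'rV[rat]_n) : set E :=
  open_box (map_mx ratr q.1) (map_mx ratr q.2).
pose F q := [set x | B q `<=` U /\ B q x].
have -> : U = \bigcup_q F q.
  apply/seteqP; split => [x Ux|x [q _ [sB Bx]]]; last exact: sB.
  have [e [e0 eU]] := open_rV_box oU Ux.
  have /choice[a ha] (i : 'I_n) : exists q : rat,
      ratr q \in `](x ord0 i - e), (x ord0 i)[.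
    by apply: rat_in_itvoo; rewrite gtrBl.
  have /choice[b hb] (i : 'I_n) : exists q : rat,
      ratr q \in `](x ord0 i), (x ord0 i + e)[.
    by apply: rat_in_itvoo; rewrite ltrDl.
  exists (\row_i a i, \row_i b i) => //; split.
    move=> y hy; apply: eU => i; have := hy i; rewrite !mxE.
    have := ha i; have := hb i; rewrite !in_itv/= ltr_norml.
    by move=> /andP[? ?] /andP[? ?] /andP[? ?]; apply/andP; split; lra.
  move=> i; rewrite !mxE; have := ha i; have := hb i; rewrite !in_itv/=.
  by move=> /andP[-> _] /andP[_ ->].
apply: countable_bigcupT_measurable; first exact: countableP.
move=> q; have [h|h] := pselect (B q `<=` U).
  rewrite (_ : F q = B q); first exact: measurable_open_box.
  by apply/seteqP; split => [x []//|x Bx]; split.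
rewrite (_ : F q = set0)//.
by apply/seteqP; split => [x []//|//].
Qed.

Lemma closed_measurable_rV (U : set E) : closed U -> measurable U.
Proof.
move=> cU; rewrite -[U]setCK; apply: measurableC; apply: open_measurable_rV.
exact: closed_openC.
Qed.

Lemma compact_measurable_rV (U : set E) : compact U -> measurable U.
Proof.
move=> cU; apply: closed_measurable_rV; apply: compact_closed => //.
Qed.

Lemma continuous_measurable_rV (f : E -> R) :
  continuous f -> measurable_fun setT f.
Proof.
move=> cf; apply: (measurability _ (RGenOInfty.measurableE R)) => _ [_ [x ->] <-].
rewrite setTI; apply: open_measurable_rV.
by move/continuousP: cf; apply; exact: interval_open.
Qed.

Let boxes : set (set E) := [set A | exists a b, A = open_box a b].

(** It suffices to exhaust the set x_i > c by bounded boxes: side i starts at c, the other sides at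
    -k, and all of them end at k. *)
Lemma measurable_rV_boxes (A : set E) : measurable A -> <<s boxes >> A.
Proof.
have mc (i : 'I_n) : measurable_fun
    [set: g_sigma_algebraType boxes] (fun x : E => x ord0 i).
  apply: (measurability _ (RGenOInfty.measurableE R)) => _ [_ [c ->] <-].
  rewrite setTI (_ : _ @^-1` _ = \bigcup_k open_box
     (\row_j if j == i then c else - k%:R) (const_mx k%:R)).
    by apply: bigcupT_measurable => k; apply: sub_sigma_algebra; do 2 eexists.
  apply/seteqP; split => [x /=|x [k _ /(_ i)]]; last first.
    by rewrite !mxE eqxx /= in_itv/= andbT => /andP[].
  rewrite in_itv/= andbT => cx; have [k hk] := rV_nat_bound x.
  exists k => // j; rewrite !mxE; have := hk j.
  rewrite ltr_norml => /andP[h ->]; rewrite andbT.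
  by case: eqP => // ->.
apply: smallest_sub; first exact: smallest_sigma_algebra.
move=> B; rewrite -bigcup_seq/= => -[i _ [Y mY <-]].
exact: (mc i _ Y mY).
Qed.

(** Boxes are stable under intersection and generate the sigma-algebra, and the cubes of half-side k
    exhaust the space with finite measure. *)
Lemma measure_eq_box (m1 m2 : {measure set E -> \bar R}) :
  (forall a b, m1 (open_box a b) = m2 (open_box a b)) ->
  (forall a b, m1 (open_box a b) < +oo)%E ->
  forall A, measurable A -> m1 A = m2 A.
Proof.
move=> m12 moo A mA.
apply: (@measure_unique _ _ _ boxes
  (fun k => open_box (const_mx (- k%:R)) (const_mx k%:R))) => //.
- apply/seteqP; split => [B|]; first exact: measurable_rV_boxes.
  apply: smallest_sub; first exact: sigma_algebra_measurable.
  by move=> _ [a [b ->]]; exact: measurable_open_box.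
- move=> _ _ [a [b ->]] [a' [b' ->]]; rewrite open_box_setI.
  by do 2 eexists.
- by move=> i; do 2 eexists.
- apply/seteqP; split => // x _; have [k hk] := rV_nat_bound x.
  by exists k => // j; rewrite !mxE; have := hk j; rewrite ltr_norml.
- by move=> _ [a [b ->]].
Qed.

End boxes.

(** * Behaviour of Lebesgue measure under similarities *)

Lemma continuous_sumr (K : numFieldType) (T : topologicalType) I (r : seq I)
    (P : pred I) (F : I -> T -> K) : (forall i, P i -> continuous (F i)) ->
  continuous (fun x => \sum_(i <- r | P i) F i x).
Proof.
move=> cF; elim: r => [|i r IH] x.
  by under eq_fun do rewrite big_nil; exact: cst_continuous.
under eq_fun do rewrite big_cons; case: ifPn => [Pi|_]; last exact: IH.
by apply: continuousD; [exact: cF|exact: IH].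
Qed.

Lemma pmule_inj (R : realType) (k : R) (x y : \bar R) :
  0 < k -> (k%:E * x = k%:E * y)%E -> x = y.
Proof.
move=> k0 /(congr1 (fun z => (k^-1)%:E * z)%E).
by rewrite !muleA -!EFinM mulVf ?gt_eqF// !mul1e.
Qed.

Section invariance.
Context {R : realType} {n : nat}.
Local Notation E := 'rV[R]_n.
Local Notation mu := (rV_lebesgue R n).
Implicit Types a b x y : E.

Lemma measurable_rVD d (T : measurableType d) (f g : T -> E) :
  measurable_fun setT f -> measurable_fun setT g ->
  measurable_fun setT (fun t => f t + g t).
Proof.
move=> mf mg; apply: measurable_fun_rVP => i; under eq_fun do rewrite mxE.
apply: measurable_funD.
  by apply: (measurableT_comp (f := fun x => x ord0 i)) => //; exact: measurable_rV_coord.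
by apply: (measurableT_comp (f := fun x => x ord0 i)) => //; exact: measurable_rV_coord.
Qed.

Lemma measurable_rV_mulmx d (T : measurableType d) (f : T -> E) (L : 'M[R]_n) :
  measurable_fun setT f -> measurable_fun setT (fun t => f t *m L).
Proof.
move=> mf; apply: measurable_fun_rVP => i; under eq_fun do rewrite mxE.
apply: measurable_sum => j; apply: measurable_funM => //.
by apply: (measurableT_comp (f := fun x => x ord0 j)) => //; exact: measurable_rV_coord.
Qed.

Lemma measurable_rVN d (T : measurableType d) (f : T -> E) :
  measurable_fun setT f -> measurable_fun setT (fun t => - f t).
Proof.
move=> mf; apply: measurable_fun_rVP => i; under eq_fun do rewrite mxE.
apply: measurableT_comp => //.
by apply: (measurableT_comp (f := fun x => x ord0 i)) => //; exact: measurable_rV_coord.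
Qed.

Lemma measurable_translate b : measurable_fun [set: E] (fun x => x + b).
Proof. by apply: measurable_rVD. Qed.

Lemma mu_translate b (A : set E) : measurable A ->
  mu ((fun x => x + b) @^-1` A) = mu A.
Proof.
move=> mA; rewrite -/(pushforward mu (fun x => x + b) A).
have mt := measurable_translate b.
have := @measure_eq_box R n (measure_function_pushforward__canonical__measure_function_Measure mu mt) mu.
have box a c : (fun x => x + b) @^-1` open_box a c = open_box (a - b) (c - b).
  by apply/seteqP; split => x /= h i; have := h i; rewrite !mxE ltrBlDr ltrBrDr.
apply => // a c; rewrite /= /pushforward box; last exact: mu_open_box_fin.
rewrite !mu_open_box; apply: eq_bigr => i _; rewrite !mxE; congr (_%:E).
by congr Num.max; ring.
Qed.

Local Open Scope ereal_scope.
(* Tonelli's theorem for {(x, y) | A x, B (y L + x)}. With A the unit ball it gives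
   the invariance under orthogonal maps without determinants. *)
Lemma mu_mulmx (L : 'M[R]_n) (A B : set E) : L \in unitmx ->
  measurable A -> measurable B -> (forall x, A x -> A (- x)%R) ->
  mu A * mu ((mulmx^~ L) @^-1` B) = mu B * mu ((mulmx^~ L) @^-1` A).
Proof.
move=> uL mA mB sA.
have mL : measurable_fun [set: E] (mulmx^~ L) by exact: measurable_rV_mulmx.
have mpre (C : set E) (f : E -> E) : measurable_fun setT f -> measurable C -> measurable (f @^-1` C).
  by move=> mf mC; rewrite -[X in measurable X]setTI; exact: mf.
have secE (C : set E) (Z : set (E * E)) (c : \bar R) : 0 <= c -> measurable C -> measurable Z ->
    (forall x, mu (xsection Z x) = c * (\1_C x)%:E) ->
    (mu \x mu) Z = c * mu C.
  move=> c0 mC mZ h; rewrite /product_measure1.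
  under eq_integral do rewrite /= h.
  rewrite ge0_integralZl//; last first.
    - by apply/measurable_EFinP/measurable_indic.
  by rewrite integral_indic// setIT.
have sub (C : set E) (Z : set (E * E)) (c : \bar R) : measurable Z ->
    (forall x, C x -> mu (xsection Z x) = c) ->
    (forall x, ~ C x -> xsection Z x = set0) ->
    forall x, mu (xsection Z x) = c * (\1_C x)%:E.
  move=> mZ h1 h2 x; rewrite indicE; have [Cx|Cx] := pselect (C x).
    by rewrite mem_set// mule1 h1.
  by rewrite memNset// mule0 h2// measure0.
pose Z1 := [set z : E * E | A z.1 /\ B (z.2 *m L + z.1)%R].
pose Z2 := [set z : E * E | B z.1 /\ A (z.1 - z.2 *m L)%R].
have mZ1 : measurable Z1.
  rewrite (_ : Z1 = (fst @^-1` A) `&` ((fun z : E * E => z.2 *m L + z.1)%R @^-1` B)).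
    apply: measurableI.
      by rewrite -[X in measurable X]setTI; exact: measurable_fst.
    rewrite -[X in measurable X]setTI; apply: measurable_rVD => //.
    exact: measurable_rV_mulmx.
  by apply/seteqP; split => -[? ?] [].
have mZ2 : measurable Z2.
  rewrite (_ : Z2 = (fst @^-1` B) `&` ((fun z : E * E => z.1 - z.2 *m L)%R @^-1` A)).
    apply: measurableI.
      by rewrite -[X in measurable X]setTI; exact: measurable_fst.
    rewrite -[X in measurable X]setTI; apply: measurable_rVD => //.
    by apply: measurable_rVN; exact: measurable_rV_mulmx.
  by apply/seteqP; split => -[? ?] [].
have e1 : (mu \x mu) Z1 = mu ((mulmx^~ L) @^-1` B) * mu A.
  apply: secE => //; apply: sub => // x Ax.
    rewrite -[RHS](mu_translate (x *m invmx L)); last exact: mpre.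
    congr (mu _); apply/seteqP; split => y.
      by move=> /xsectionP[_ /=]; rewrite mulmxDl mulmxKV.
    by move=> /= h; apply/xsectionP; split => //=; move: h; rewrite mulmxDl mulmxKV.
  by rewrite -subset0 => y /xsectionP[].
have e2 : (mu \x mu) Z2 = mu ((mulmx^~ L) @^-1` A) * mu B.
  apply: secE => //; apply: sub => // x Bx.
    rewrite -[RHS](mu_translate (- (x *m invmx L))%R); last exact: mpre.
    congr (mu _); apply/seteqP; split => y.
      move=> /xsectionP[_ /= /sA].
      by rewrite opprB mulmxBl mulmxKV.
    move=> /= h; apply/xsectionP; split => //=; move: h => /sA.
    by rewrite mulmxBl mulmxKV// opprB.
  by rewrite -subset0 => y /xsectionP[].
rewrite [LHS]muleC [RHS]muleC -e1 -e2.
have p12 Z : measurable Z -> (mu \x mu) Z = (mu \x^ mu) Z.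
  by apply: product_measure_unique => //= ? ? ? ?; rewrite product_measure2E.
rewrite !p12// /product_measure2; apply: eq_integral => y _ /=.
rewrite -[RHS](mu_translate (y *m L)); last exact: measurable_ysection.
congr (mu _); apply/seteqP; split => x.
  by move=> /ysectionP[/= Ax Bx]; apply/ysectionP; split => /=; rewrite ?addrK// addrC.
by move=> /ysectionP[/= Bx]; rewrite addrK => Ax; apply/ysectionP; split => //=; rewrite addrC.
Qed.
Local Close Scope ereal_scope.

Lemma enorm_ge0 x : 0 <= enorm x. Proof. exact: sqrtr_ge0. Qed.

Lemma enorm_sqr x : enorm x ^+ 2 = \sum_i x ord0 i ^+ 2.
Proof. by rewrite sqr_sqrtr// sumr_ge0// => i _; exact: sqr_ge0. Qed.

Lemma enorm_sqr_mx x : enorm x ^+ 2 = (x *m x^T) ord0 ord0.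
Proof. by rewrite enorm_sqr mxE; apply: eq_bigr => i _; rewrite mxE expr2. Qed.

Lemma enorm_eq x y : (x *m x^T) ord0 ord0 = (y *m y^T) ord0 ord0 ->
  enorm x = enorm y.
Proof.
by rewrite -!enorm_sqr_mx => /eqP; rewrite eqrXn2// ?enorm_ge0// => /eqP.
Qed.

Lemma enorm_mulmx (Q : 'M[R]_n) x : Q *m Q^T = 1%:M -> enorm (x *m Q) = enorm x.
Proof.
by move=> QQ; apply: enorm_eq; rewrite trmx_mul mulmxA -(mulmxA x) QQ mulmx1.
Qed.

Lemma enormN x : enorm (- x) = enorm x.
Proof. by rewrite /enorm; under eq_bigr do rewrite mxE sqrrN. Qed.

Lemma enormB x y : enorm (x - y) = enorm (y - x).
Proof. by rewrite -enormN opprB. Qed.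

Lemma enorm0 : enorm (0 : E) = 0.
Proof.
by rewrite /enorm big1 ?sqrtr0// => i _; rewrite mxE expr0n.
Qed.

Lemma enormZ (r : R) x : enorm (r *: x) = `|r| * enorm x.
Proof.
rewrite /enorm; under eq_bigr do rewrite mxE exprMn.
by rewrite -mulr_sumr sqrtrM ?sqr_ge0// sqrtr_sqr.
Qed.

Lemma coord_le_enorm x i : `|x ord0 i| <= enorm x.
Proof.
rewrite -sqrtr_sqr ler_sqrt ?sqr_ge0// ?sumr_ge0// => [|j _]; last exact: sqr_ge0.
by rewrite (bigD1 i)//= lerDl sumr_ge0// => j _; exact: sqr_ge0.
Qed.

Lemma enorm_eq0 x : enorm x = 0 -> x = 0.
Proof.
move=> x0; apply/rowP => i; rewrite mxE; apply/eqP; rewrite -normr_le0 -x0.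
exact: coord_le_enorm.
Qed.

Lemma enorm_gt0 x : (0 < enorm x) = (x != 0).
Proof.
rewrite lt_neqAle enorm_ge0 andbT eq_sym; congr (~~ _).
by apply/eqP/eqP => [/enorm_eq0//|->]; exact: enorm0.
Qed.

Lemma enorm_le_sum x : enorm x <= \sum_i `|x ord0 i|.
Proof.
rewrite -(@ler_pXn2r _ 2)// ?nnegrE ?enorm_ge0 ?sumr_ge0// enorm_sqr.
rewrite expr2 mulr_suml; apply: ler_sum => i _.
rewrite -real_normK ?num_real// expr2 ler_wpM2l//.
by rewrite (bigD1 i)//= lerDl sumr_ge0.
Qed.

(** Cauchy-Schwarz: the square of the norm of |y| x - |x| y equals 2 |x| |y| (|x| |y| - x . y). *)
Lemma dot_le_enorm x y : (x *m y^T) ord0 ord0 <= enorm x * enorm y.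
Proof.
have [->|x0] := eqVneq x 0; first by rewrite mul0mx mxE enorm0 mul0r.
have [->|y0] := eqVneq y 0; first by rewrite trmx0 mulmx0 mxE enorm0 mulr0.
have h : 0 <= enorm (enorm y *: x - enorm x *: y) ^+ 2 by exact: sqr_ge0.
have -> : (x *m y^T) ord0 ord0 = \sum_i x ord0 i * y ord0 i.
  by rewrite mxE; apply: eq_bigr => i _; rewrite mxE.
set s := \sum_i _.
have e : enorm (enorm y *: x - enorm x *: y) ^+ 2 =
    enorm y ^+ 2 * (\sum_i x ord0 i ^+ 2) - (2 * enorm x * enorm y) * s
    + enorm x ^+ 2 * (\sum_i y ord0 i ^+ 2).
  rewrite enorm_sqr !mulr_sumr -sumrB -big_split/=; apply: eq_bigr => i _.
  by rewrite !mxE; ring.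
rewrite e -!enorm_sqr in h.
have {}h : 0 <= (2 * (enorm x * enorm y)) * (enorm x * enorm y - s) by nra.
rewrite -subr_ge0; move: h; rewrite pmulr_rge0//.
by rewrite mulr_gt0// mulr_gt0// enorm_gt0.
Qed.

Lemma enormD x y : enorm (x + y) <= enorm x + enorm y.
Proof.
rewrite -(@ler_pXn2r _ 2)// ?nnegrE ?addr_ge0 ?enorm_ge0//.
rewrite sqrrD !enorm_sqr_mx (raddfD trmx) mulmxDl !mulmxDr.
have -> : y *m x^T = x *m y^T.
  by apply/matrixP => i j; rewrite !ord1 !mxE; apply: eq_bigr => k _; rewrite !mxE mulrC.
have := dot_le_enorm x y.
move: (x *m x^T) (x *m y^T) (y *m y^T) => a b c; rewrite !mxE mulr2n; lra.
Qed.

Lemma continuous_enorm : continuous (@enorm R n).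
Proof.
move=> x; apply: (@continuous_comp _ _ _ (fun x => \sum_i x ord0 i ^+ 2) Num.sqrt).
  apply: continuous_sumr => i _ {}x.
  by apply: (@continuousM _ _ (fun x => x ord0 i) (fun x => x ord0 i));
    exact: coord_continuous.
exact: sqrt_continuous.
Qed.

Lemma orthogonal_unitmx (Q : 'M[R]_n) : Q *m Q^T = 1%:M -> Q \in unitmx.
Proof. by move=> /mulmx1_unit[]. Qed.

(** The unit ball D is its own preimage. Its measure is finite and positive, because D lies between
    two cubes, and cancels in [mu_mulmx]. *)
Lemma mu_orthogonal (Q : 'M[R]_n) (A : set E) : Q *m Q^T = 1%:M ->
  measurable A -> mu ((mulmx^~ Q) @^-1` A) = mu A.
Proof.
move=> QQ mA; pose D := [set x : E | enorm x < 1].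
have oD : open D.
  have -> : D = @enorm R n @^-1` `]-oo, 1[%classic.
    by apply/seteqP; split => x /=; rewrite in_itv.
  by have /continuousP := continuous_enorm; apply; exact: interval_open.
have mD := open_measurable_rV oD.
have uQ := orthogonal_unitmx QQ.
have sD x : D x -> D (- x) by rewrite /D/= enormN.
have := mu_mulmx uQ mD mA sD.
rewrite (_ : _ @^-1` D = D); last first.
  by apply/seteqP; split => x; rewrite /D/= enorm_mulmx.
have Dfin : (mu D < +oo)%E.
  apply: le_lt_trans (mu_open_box_fin (const_mx (-1)) (const_mx 1)).
  apply: le_measure; rewrite ?inE//; first exact: measurable_open_box.
  move=> x Dx i; rewrite !mxE -ltr_norml; apply: le_lt_trans Dx.
  exact: coord_le_enorm.
have Dgt : (0 < mu D)%E.
  (* If all coordinates are below 1 / (n + 1) in absolute value, their sum is at most n / (n + 1) <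
     1, so this cube lies in the ball. *)
  pose c := ((n%:R + 1)^-1 : R).
  have c0 : 0 < c by rewrite invr_gt0 ltr_pwDr.
  apply: (@lt_le_trans _ _ (mu (open_box (const_mx (- c)) (const_mx c)))).
    rewrite mu_open_box prodEFin lte_fin prodr_gt0// => i _.
    by rewrite lt_max !mxE opprK addr_gt0// orbT.
  apply: le_measure; rewrite ?inE//; first exact: measurable_open_box.
  move=> x h; apply: le_lt_trans (enorm_le_sum x) _.
  apply: (@le_lt_trans _ _ (\sum_(i < n) c)).
    by apply: ler_sum => i _; have := h i; rewrite !mxE -ltr_norml => /ltW.
  rewrite sumr_const card_ord -[c *+ n]mulr_natl /c ltr_pdivrMr ?mul1r//.
    by rewrite ltrDl.
rewrite [RHS]muleC.
have Dnum : mu D \is a fin_num by rewrite ge0_fin_numE.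
by rewrite -(fineK Dnum) => /pmule_inj; apply; rewrite -lte_fin fineK.
Qed.

(** Again [mu_mulmx], now with a cube: its preimage under scaling is an explicit box, whose volume
    supplies the factor r^(-n). *)
Lemma mu_scale (r : R) (A : set E) : 0 < r -> measurable A ->
  mu ((fun x => r *: x) @^-1` A) = ((r ^- n)%:E * mu A)%E.
Proof.
move=> r0 mA; pose D : set E := open_box (const_mx (-1)) (const_mx 1).
have mD : measurable D by exact: measurable_open_box.
have uQ : r%:M \in @unitmx R n.
  by rewrite unitmxE det_scalar unitfE expf_neq0// gt_eqF.
have sD x : D x -> D (- x).
  by move=> h i; have := h i; rewrite !mxE -!ltr_norml normrN.
have := mu_mulmx uQ mD mA sD.
have -> : mulmx^~ r%:M = (fun x => r *: x) by apply/funext => x; rewrite mul_mx_scalar.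
have -> : (fun x => r *: x) @^-1` D = open_box (const_mx (- r^-1)) (const_mx r^-1).
  by apply/seteqP; split => x h i; have := h i;
    rewrite !mxE -!ltr_norml normrM gtr0_norm// -ltr_pdivlMl// mulr1.
rewrite !mu_open_box.
under eq_bigr do rewrite !mxE max_r ?opprK//.
under [X in _ = (_ * X)%E -> _]eq_bigr => i _.
  rewrite !mxE opprK max_r; last by rewrite addr_ge0// invr_ge0 ltW.
  over.
rewrite !prodEFin !prodr_const !card_ord.
have -> : (r^-1 + r^-1) ^+ n = r ^- n * (1 + 1) ^+ n.
  by rewrite -exprVn -exprMn mulrDr mulr1.
rewrite EFinM muleA => h.
have : (((1 + 1) ^+ n)%:E * mu ((fun x => (r *: x)%R) @^-1` A) =
       ((1 + 1) ^+ n)%:E * ((r ^- n)%:E * mu A))%E.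
  by rewrite h [RHS]muleC; congr (_ * _)%E; rewrite muleC.
by move/pmule_inj; apply; rewrite exprn_gt0// addr_gt0.
Qed.

Definition similarity (r : R) (Q : 'M[R]_n) b x : E := r *: (x *m Q) + b.

Lemma measurable_similarity r Q b : measurable_fun setT (similarity r Q b).
Proof.
apply: measurable_rVD => //.
under eq_fun do rewrite -mul_mx_scalar -mulmxA.
exact: measurable_rV_mulmx.
Qed.

Lemma mu_similarity r Q b (A : set E) : 0 < r -> Q *m Q^T = 1%:M ->
  measurable A -> mu (similarity r Q b @^-1` A) = ((r ^- n)%:E * mu A)%E.
Proof.
move=> r0 QQ mA.
have m1 : measurable ((fun x => x + b) @^-1` A).
  by rewrite -[X in measurable X]setTI; exact: measurable_translate.
have m2 : measurable ((fun x => r *: x) @^-1` ((fun x => x + b) @^-1` A)).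
  rewrite -[X in measurable X]setTI.
  under eq_fun do rewrite -mul_mx_scalar.
  exact: measurable_rV_mulmx.
rewrite -(mu_translate b mA) -mu_scale// -[RHS](mu_orthogonal QQ)//.
Qed.

Section similarity_integral.
Variables (r : R) (Q : 'M[R]_n) (b : E).
Hypotheses (r0 : 0 < r) (QQ : Q *m Q^T = 1%:M).
Local Notation S := (similarity r Q b).

Let k : {nonneg R} := NngNum (ltW (exprn_gt0 n (divr_gt0 ltr01 r0))).

Let pushE (A : set E) : measurable A ->
  pushforward mu S A = mscale k mu A.
Proof.
by move=> mA; rewrite /pushforward mu_similarity// /mscale/= div1r exprVn.
Qed.

Lemma ge0_integral_similarity (f : E -> \bar R) : measurable_fun setT f ->
  (forall x, 0 <= f x)%E ->
  (\int[mu]_x f (S x) = (r ^- n)%:E * \int[mu]_x f x)%E.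
Proof.
move=> mf f0; have mS := measurable_similarity r Q b.
transitivity (\int[pushforward mu S]_x f x)%E.
  by rewrite (ge0_integral_pushforward mS).
rewrite (@eq_measure_integral _ _ _ _ (mscale k mu)); last by move=> A mA _; exact: pushE.
by rewrite ge0_integral_mscale//= div1r exprVn.
Qed.

Lemma integrable_similarity (f : E -> \bar R) : mu.-integrable setT f ->
  mu.-integrable setT (f \o S).
Proof.
move=> /integrableP[mf foo]; have mS := measurable_similarity r Q b.
apply/integrableP; split; first exact: measurableT_comp.
rewrite /= (ge0_integral_similarity (f := fun x => `|f x|%E))//; last first.
  exact: (measurableT_comp (f := abse)).
by rewrite lte_mul_pinfty// lee_fin ltW// invr_gt0 exprn_gt0.
Qed.

Lemma Rintegral_similarity (f : E -> R) : mu.-integrable setT (EFin \o f) ->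
  \int[mu]_x f (S x) = r ^- n * \int[mu]_x f x.
Proof.
move=> intf; have mS := measurable_similarity r Q b.
have intfS := integrable_similarity intf.
have mf := measurable_int _ intf.
rewrite /Rintegral integralE [X in _ * fine X]integralE.
have -> : (fun x => (f (S x))%:E)^\+%E = ((EFin \o f)^\+ \o S)%E
  by apply/funext => x; rewrite /= !funeposE.
have -> : (fun x => (f (S x))%:E)^\-%E = ((EFin \o f)^\- \o S)%E
  by apply/funext => x; rewrite /= !funenegE.
rewrite !ge0_integral_similarity//; last 2 first.
- exact: measurable_funeneg.
- exact: measurable_funepos.
have p := integrable_pos_fin_num (measurableT) intf.
have m := integrable_neg_fin_num (measurableT) intf.
rewrite fineB; last 2 first.
- by rewrite fin_numM.
- by rewrite fin_numM.
rewrite !fineM//= -mulrBr; congr (_ * _).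
by rewrite -fineB.
Qed.

End similarity_integral.
End invariance.

(** * Functions of class C^k *)

Section lines.
Context {R : realType} {n : nat}.
Local Notation E := 'rV[R]_n.
Implicit Types (f g : E -> R) (x v w : E).

Lemma is_derive_cvg f x v (d : R) :
  h^-1 * (f (h *: v + x) - f x) @[h --> 0^'] --> d -> is_derive x v f d.
Proof.
move=> h; split; first by apply/cvg_ex; exists d.
exact/cvg_lim.
Qed.

Lemma cvg_is_derive f x v (d : R) : is_derive x v f d ->
  h^-1 * (f (h *: v + x) - f x) @[h --> 0^'] --> d.
Proof. by case=> df <-. Qed.

Lemma is_derive_line f x v (s : R) : derivable f (s *: v + x) v ->
  is_derive s 1 (fun t => f (t *: v + x)) ('D_v f (s *: v + x)).
Proof.
move=> /derivableP/cvg_is_derive h.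
have e : (fun t : R => t^-1 *: (((fun t => f (t *: v + x)) \o shift s) (t *: 1) -
    f (s *: v + x))) = (fun t => t^-1 * (f (t *: v + (s *: v + x)) - f (s *: v + x))).
  by apply/funext => t /=; rewrite /shift/= [t%:A]mulr1 scalerDl addrA.
split; first by apply/cvg_ex; exists ('D_v f (s *: v + x)); rewrite e.
by apply/cvg_lim => //; rewrite e.
Qed.

(** The segment is run through forwards or backwards according to the sign of h. Only [|t| <= |h|]
    is kept, which is what the continuity argument of [is_deriveD_dir] uses. *)
Lemma line_mvt f x v (h : R) : (forall y, derivable f y v) ->
  exists t : R, `|t| <= `|h| /\ f (h *: v + x) - f x = h * 'D_v f (t *: v + x).
Proof.
move=> df; pose g (t : R) := f (t *: v + x).
have dg (s : R) : is_derive s 1 g ('D_v f (s *: v + x)) by exact: is_derive_line.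
have cg : continuous g.
  by move=> s; apply/differentiable_continuous/derivable1_diffP; case: (dg s).
have [h0|h0] := leP 0 h.
  have [|t] := @MVT_segment _ g (fun s => 'D_v f (s *: v + x)) _ _ h0 (fun s _ => dg s).
    exact: continuous_subspaceT.
  rewrite in_itv/= => /andP[t0 th] e; exists t.
  rewrite !ger0_norm//; split => //; move: e.
  by rewrite /g scale0r add0r subr0 mulrC.
have [|t] := @MVT_segment _ g (fun s => 'D_v f (s *: v + x)) _ _ (ltW h0) (fun s _ => dg s).
  exact: continuous_subspaceT.
rewrite in_itv/= => /andP[th t0] e; exists t.
rewrite (ler0_norm t0) (ltr0_norm h0) lerN2; split => //; move: e.
rewrite /g scale0r add0r sub0r mulrN => /(congr1 -%R).
by rewrite opprB opprK mulrC.
Qed.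

(** The increment along v + w is one along v followed by one along w from the moved point x + h v.
    The mean value theorem and the continuity of the derivative along w bring the second back to
    x. *)
Lemma is_deriveD_dir f v w x : (forall y, derivable f y v) ->
  (forall y, derivable f y w) -> {for x, continuous ('D_w f)} ->
  is_derive x (v + w) f ('D_v f x + 'D_w f x).
Proof.
move=> dv dw cw; apply: is_derive_cvg.
have e (h : R) : h^-1 * (f (h *: (v + w) + x) - f x) =
   h^-1 * (f (h *: v + x) - f x) + h^-1 * (f (h *: w + (h *: v + x)) - f (h *: v + x)).
  have -> : h *: w + (h *: v + x) = h *: (v + w) + x.
    by rewrite scalerDr addrA [h *: w + _]addrC.
  by rewrite -mulrDr; congr (_ * _); ring.
under eq_fun do rewrite e.
apply: (@cvgD _ _ _ _ _ (fun h : R => h^-1 * (f (h *: v + x) - f x))).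
  exact: (cvg_is_derive (derivableP (dv x))).
apply/cvgrPdist_lt => eps eps0.
move/cvgrPdist_lt : cw => /(_ _ eps0)/nbhs_ballP[d /= d0 hd].
have M0 : 0 < `|v| + `|w| + 1 by rewrite ltr_wpDl// addr_ge0.
exists (d / (`|v| + `|w| + 1)) => /=; first by rewrite divr_gt0.
move=> h /=; rewrite sub0r normrN => hh h0.
have [t [th ->]] := line_mvt (h *: v + x) h dw.
rewrite mulrA mulVf// mul1r; apply: hd.
rewrite mx_norm_ball /ball_/= distrC addrA addrK.
apply: le_lt_trans (ler_normD _ _) _; rewrite !normrZ.
apply: (@le_lt_trans _ _ (`|h| * (`|v| + `|w| + 1))).
  have := ler_wpM2r (normr_ge0 w) th; have := normr_ge0 h.
  by rewrite !mulrDr mulr1; lra.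
by rewrite -ltr_pdivlMr.
Qed.

Lemma is_deriveZ_dir f v x (a : R) d : is_derive x v f d ->
  is_derive x (a *: v) f (a * d).
Proof.
move=> fd; have [->|a0] := eqVneq a 0.
  by rewrite scale0r mul0r; exact: is_derive0.
apply: is_derive_cvg.
have e (h : R) : h^-1 * (f (h *: (a *: v) + x) - f x) =
   a * ((h * a)^-1 * (f ((h * a) *: v + x) - f x)).
  have [->|h0] := eqVneq h 0; first by rewrite mul0r invr0 !mul0r mulr0.
  by rewrite scalerA invfM !mulrA; congr (_ * _); rewrite mulrAC mulfV// mul1r.
under eq_fun do rewrite e.
apply: cvgM; first exact: cvg_cst.
move/cvg_is_derive: fd => /cvgrPdist_lt fd; apply/cvgrPdist_lt => eps eps0.
have [r /= r0 hr] := fd _ eps0.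
exists (r / `|a|) => /=; first by rewrite divr_gt0// normr_gt0.
move=> h /=; rewrite sub0r normrN => hh h0; apply: hr => /=.
  by rewrite sub0r normrN normrM -ltr_pdivlMr// normr_gt0.
by rewrite mulf_neq0.
Qed.

End lines.

(** * Closure properties of the classes C^k *)

Section Ck.
Context {R : realType} {n : nat}.
Local Notation E := 'rV[R]_n.
Implicit Types (f g : E -> R) (x v w : E).

(** An inductive counterpart of [smooth], which quantifies over words of partial derivatives:
    closure under sums, products and affine maps becomes an induction on k (see [smoothP]). *)
Fixpoint Ck (k : nat) f : Prop :=
  match k with
  | 0%N => continuous f
  | k'.+1 => [/\ continuous f, forall i x, derivable f x (delta_mx ord0 i)
               & forall i, Ck k' (partial i f)]
  end.

Lemma Ck_continuous k f : Ck k f -> continuous f.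
Proof. by case: k => [//|k []]. Qed.

Lemma CkW k f : Ck k.+1 f -> Ck k f.
Proof.
elim: k f => [f []//|k IH f [cf df Hf]]; split => // i.
by apply: IH; exact: Hf.
Qed.

Lemma Ck_intro k f (df : 'I_n -> E -> R) : continuous f ->
  (forall i x, is_derive x (delta_mx ord0 i) f (df i x)) ->
  (forall i, Ck k (df i)) -> Ck k.+1 f.
Proof.
move=> cf dfE Hf; split => // i.
rewrite (_ : partial i f = df i)//.
by apply/funext => x; rewrite /partial; case: (dfE i x).
Qed.

Lemma Ck_partial k f i : Ck k.+1 f -> Ck k (partial i f).
Proof. by case=> _ _; exact. Qed.

Lemma Ck_partialP k f i x : Ck k.+1 f ->
  is_derive x (delta_mx ord0 i) f (partial i f x).
Proof. by case=> cf df _; exact: derivableP. Qed.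

Lemma smoothP f : smooth f <-> forall k, Ck k f.
Proof.
split=> [sf k|Hf s].
  elim: k f sf => [|k IH] f sf; first by have [] := sf [::].
  have [cf df] := sf [::].
  split => // i; apply: IH => s; have := sf (rcons s i).
  by rewrite foldr_rcons.
elim/last_ind: s f Hf => [|s i IH] f Hf.
  by split; [exact: Ck_continuous (Hf 0%N)|have [] := Hf 1%N].
by rewrite foldr_rcons; apply: IH => k; have [_ _ H] := Hf k.+1; exact: H.
Qed.

Lemma Ck_cst k (c : R) : Ck k (fun _ : E => c).
Proof.
elim: k c => [c|k IH c]; first exact: cst_continuous.
apply: (Ck_intro (df := fun _ _ => 0)) => //; first exact: cst_continuous.
Qed.

Lemma CkD k f g : Ck k f -> Ck k g -> Ck k (fun x => f x + g x).
Proof.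
elim: k f g => [f g cf cg x|k IH f g Hf Hg].
  by apply: continuousD; [exact: cf|exact: cg].
apply: (Ck_intro (df := fun i x => partial i f x + partial i g x)).
- by move=> x; apply: continuousD; [exact: (Ck_continuous Hf)|exact: (Ck_continuous Hg)].
- move=> i x; have df := Ck_partialP i x Hf; have dg := Ck_partialP i x Hg.
  exact: is_deriveD.
- by move=> i; apply: IH; exact: Ck_partial.
Qed.

Lemma CkM k f g : Ck k f -> Ck k g -> Ck k (fun x => f x * g x).
Proof.
elim: k f g => [f g cf cg x|k IH f g Hf Hg].
  by apply: continuousM; [exact: cf|exact: cg].
apply: (Ck_intro (df := fun i x => f x * partial i g x + g x * partial i f x)).
- by move=> x; apply: continuousM; [exact: (Ck_continuous Hf)|exact: (Ck_continuous Hg)].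
- move=> i x; have df := Ck_partialP i x Hf; have dg := Ck_partialP i x Hg.
  exact: is_deriveM.
- move=> i; apply: CkD; apply: IH.
  + exact: CkW.
  + exact: Ck_partial.
  + exact: CkW.
  + exact: Ck_partial.
Qed.

Lemma CkZ k (c : R) f : Ck k f -> Ck k (fun x => c * f x).
Proof. by move=> Hf; apply: CkM => //; exact: Ck_cst. Qed.

Lemma Ck_sum k I (r : seq I) (P : pred I) (F : I -> E -> R) :
  (forall i, P i -> Ck k (F i)) -> Ck k (fun x => \sum_(i <- r | P i) F i x).
Proof.
move=> HF; elim: r => [|i r IH].
  by under eq_fun do rewrite big_nil; exact: Ck_cst.
under eq_fun do rewrite big_cons; case: (boolP (P i)) => [Pi|_] //.
by apply: CkD => //; exact: HF.
Qed.

Lemma Ck_prod k I (r : seq I) (P : pred I) (F : I -> E -> R) :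
  (forall i, P i -> Ck k (F i)) -> Ck k (fun x => \prod_(i <- r | P i) F i x).
Proof.
move=> HF; elim: r => [|i r IH].
  by under eq_fun do rewrite big_nil; exact: Ck_cst.
under eq_fun do rewrite big_cons; case: (boolP (P i)) => [Pi|_] //.
by apply: CkM => //; exact: HF.
Qed.

(** Coordinate directions are added one at a time. The one being added has a continuous derivative,
    as [is_deriveD_dir] requires. *)
Lemma Ck1_is_derive f x v : Ck 1 f ->
  is_derive x v f (\sum_i v ord0 i * partial i f x).
Proof.
move=> [cf df cdf].
suff H (s : seq 'I_n) : (forall y, is_derive y (\sum_(i <- s) v ord0 i *: delta_mx ord0 i) f
    (\sum_(i <- s) v ord0 i * partial i f y)).
  by have := H (index_enum 'I_n) x; rewrite -row_sum_delta.
elim: s => [|i s IH] y; first by rewrite !big_nil; exact: is_derive0.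
rewrite !big_cons [X in is_derive _ X]addrC [X in is_derive _ _ _ X]addrC.
have dw z : is_derive z (v ord0 i *: delta_mx ord0 i) f (v ord0 i * partial i f z).
  by apply: is_deriveZ_dir; exact: derivableP.
have -> : \sum_(j <- s) v ord0 j * partial j f y =
   'D_(\sum_(j <- s) v ord0 j *: delta_mx ord0 j) f y by case: (IH y).
have -> : v ord0 i * partial i f y = 'D_(v ord0 i *: delta_mx ord0 i) f y.
  by case: (dw y).
apply: is_deriveD_dir; first by move=> z; case: (IH z).
  by move=> z; case: (dw z).
have -> : 'D_(v ord0 i *: delta_mx ord0 i) f = fun z => v ord0 i * partial i f z.
  by apply/funext => z; case: (dw z).
by apply: continuousM; [exact: cst_continuous|exact: cdf].
Qed.

Lemma continuous_rVP (T : topologicalType) (F : T -> E) :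
  (forall i, continuous (fun t : T => F t ord0 i)) -> continuous F.
Proof.
move=> cF x; apply/cvgrPdist_lt => e e0.
have H : \forall y \near x, forall i, `|F x ord0 i - F y ord0 i| < e / 2.
  apply: filter_forall => i; have /cvgrPdist_lt := cF i x; apply.
  by rewrite divr_gt0.
near=> y; apply: le_lt_trans (_ : e / 2 < e); last by rewrite ltr_pdivrMr// ltr_pMr// ltr1n.
apply: rV_norm_le => [|i]; first by rewrite divr_ge0// ltW.
by rewrite !mxE; move: i; near: y; apply: filterS H => y h i; exact/ltW.
Unshelve. all: by end_near. Qed.

Lemma continuous_mulmxD (L : 'M[R]_n) (b : E) : continuous (fun x : E => x *m L + b).
Proof.
apply: continuous_rVP => i; under eq_fun do rewrite !mxE.
move=> x; apply: continuousD; last exact: cst_continuous.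
apply: continuous_sumr => j _ {}x.
by apply: continuousM; [exact: coord_continuous|exact: cst_continuous].
Qed.

(** When x moves along e_i, the point x L + b moves along [row i L]. Hence the partial derivatives
    are combinations of those of f at x L + b, to which the induction hypothesis applies. *)
Lemma Ck_affine k f (L : 'M[R]_n) (b : E) : Ck k f -> Ck k (fun x => f (x *m L + b)).
Proof.
have cS : continuous (fun x : E => x *m L + b) by exact: continuous_mulmxD.
elim: k f => [f cf x|k IH f Hf].
  by apply: continuous_comp; [exact: cS|exact: cf].
apply: (Ck_intro (df := fun i x => \sum_j L i j * partial j f (x *m L + b))).
- by move=> x; apply: continuous_comp; [exact: cS|exact: (Ck_continuous Hf)].
- move=> i x; apply: is_derive_cvg.
  have Hf1 : Ck 1 f by case: Hf => ? ? h; split => // j; exact: Ck_continuous (h j).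
  have := cvg_is_derive (Ck1_is_derive (x *m L + b) (row i L) Hf1).
  under eq_bigr do rewrite mxE.
  by under [X in _ -> X @ _ --> _]eq_fun do
    rewrite mulmxDl -scalemxAl -rowE -addrA.
- by move=> i; apply: Ck_sum => j _; apply: CkZ; apply: IH; exact: Ck_partial.
Qed.

Lemma partial_affine f (L : 'M[R]_n) (b : E) i x : Ck 1 f ->
  partial i (fun y => f (y *m L + b)) x = \sum_j L i j * partial j f (x *m L + b).
Proof.
move=> Hf.
have := cvg_is_derive (Ck1_is_derive (x *m L + b) (row i L) Hf).
under eq_bigr do rewrite mxE.
move=> h; suff [] : is_derive x (delta_mx ord0 i) (fun y => f (y *m L + b))
  (\sum_j L i j * partial j f (x *m L + b)) by [].
apply: is_derive_cvg; move: h.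
by under [X in _ -> X @ _ --> _]eq_fun do
    rewrite mulmxDl -scalemxAl -rowE -addrA.
Qed.

End Ck.

(** * Flat functions and test functions *)

Section flat.
Context {R : realType}.
Implicit Types (P : {poly R}) (t y : R).

Lemma exprn_le_expR k y : 0 <= y -> y ^+ k <= k`!%:R * expR y.
Proof.
move=> y0; case: k => [|k].
  by rewrite expr0 fact0 mul1r (le_trans _ (expR_ge1Dx y))// lerDl.
have := expR_ge1Dxn k y0; rewrite -lerBrDl => h.
rewrite mulrC -ler_pdivrMr ?ltr0n ?fact_gt0//.
by apply: le_trans h _; rewrite gerBl.
Qed.

Lemma horner_le_expR P :
  exists2 C : R, 0 <= C & forall y, 0 <= y -> `|P.[y]| <= C * expR y.
Proof.
exists (\sum_(i < size P) `|P`_i| * i`!%:R).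
  by apply: sumr_ge0 => i _; rewrite mulr_ge0.
move=> y y0; rewrite horner_coef mulr_suml; apply: le_trans (ler_norm_sum _ _ _) _.
apply: ler_sum => i _; rewrite normrM -mulrA ler_wpM2l// ger0_norm ?exprn_ge0//.
exact: exprn_le_expR.
Qed.

(* The functions P(1/t) exp(-1/t) on t > 0, extended by 0, are stable under
   differentiation, hence smooth. *)
Definition flat P t := if 0 < t then P.[t^-1] * expR (- t^-1) else 0.

(** The exponential bound for X^2 P at y = 1 / t, divided by y^2 exp(y). Quadratic decay at 0 is
    what makes the derivative there exist and vanish. *)
Lemma flat_le P : exists2 C : R, 0 <= C & forall t, `|flat P t| <= C * t ^+ 2.
Proof.
have [C C0 hC] := horner_le_expR ('X^2 * P); exists C => // t.
rewrite /flat; case: ifPn => [t0|_]; last by rewrite normr0 mulr_ge0// sqr_ge0.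
have tV0 : 0 <= t^-1 by rewrite invr_ge0 ltW.
have := hC _ tV0; rewrite hornerM hornerXn !normrM => h.
rewrite -ler_pdivrMr ?exprn_gt0// (ger0_norm (expR_ge0 _)) expRN.
have := ler_wpM2r (ltW (expR_gt0 (- t^-1))) h.
rewrite expRN -[leRHS]mulrA mulfV ?expR_eq0// mulr1.
rewrite (ger0_norm tV0) -expr2 exprVn => {}h; apply: le_trans h.
by rewrite le_eqVlt; apply/orP; left; apply/eqP; ring.
Qed.

(** For t > 0, differentiating P(1/t) gives -P'(1/t) / t^2 and differentiating exp(-1/t) gives
    exp(-1/t) / t^2; together they form the polynomial X^2 (P - P') in 1/t. *)
Lemma is_derive_flat P t :
  is_derive t 1 (flat P) (flat ('X^2 * (P - P^`())) t).
Proof.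
have [t0|t0|->] := ltgtP t 0.
- rewrite {2}/flat ltNge (ltW t0)/=.
  apply: (@near_eq_is_derive _ _ _ (cst 0)).
  near=> s; rewrite /flat ifF//; apply/negbTE; rewrite -leNgt ltW//.
  by near: s; exact: lt_nbhsl.
- rewrite {2}/flat t0.
  have tn0 : t != 0 by rewrite gt_eqF.
  have dV : is_derive t 1 (fun s : R => s^-1) (- t ^- 2).
    apply: is_derive_eq; first exact: (@is_deriveV _ id t 1 1).
    by rewrite /GRing.scale/= mulr1.
  have dN : is_derive t 1 (fun s : R => - s^-1) (t ^- 2).
    by rewrite -[t ^- 2]opprK; exact: is_deriveN.
  have dP : is_derive t 1 (fun s => P.[s^-1]) (P^`().[t^-1] * - t ^- 2).
    exact: (is_derive1_comp (g := fun s => s^-1)).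
  have dE : is_derive t 1 (fun s => expR (- s^-1)) (expR (- t^-1) * t ^- 2).
    exact: (is_derive1_comp (g := fun s => - s^-1)).
  have dM : is_derive t 1 (fun s => P.[s^-1] * expR (- s^-1))
      (('X^2 * (P - P^`())).[t^-1] * expR (- t^-1)).
    apply: is_derive_eq.
    rewrite !hornerE exprVn /GRing.scale/=; ring.
  apply: near_eq_is_derive dM; near=> s; rewrite /flat ifT//.
  by near: s; exact: lt_nbhsr.
- rewrite {2}/flat ltxx.
  have [C C0 hC] := flat_le P.
  have f0 : flat P 0 = 0 by rewrite /flat ltxx.
  have cv : h^-1 *: ((flat P \o shift 0) (h *: 1) - flat P 0) @[h --> (0 : R)^'] --> (0 : R).
    apply/cvgrPdist_lt => e e0; exists (e / (C + 1)) => /=.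
      by rewrite divr_gt0// ltr_wpDl.
    move=> h /=; rewrite sub0r normrN => he h0.
    rewrite sub0r normrN f0 subr0 /shift/= addr0 [h *: 1]mulr1 normrM normfV.
    rewrite mulrC ltr_pdivrMr ?normr_gt0//.
    apply: le_lt_trans (hC h) _.
    have hp : 0 < `|h| by rewrite normr_gt0.
    move: he; rewrite ltr_pdivlMr ?ltr_wpDl// -[h ^+ 2]real_normK ?num_real//.
    nra.
  by split; [apply/cvg_ex; exists 0|exact/cvg_lim].
Unshelve. all: by end_near. Qed.

Lemma continuous_flat P : continuous (flat P).
Proof.
move=> t; apply/differentiable_continuous/derivable1_diffP.
by case: (is_derive_flat P t).
Qed.

(* Since it tends to 1 at infinity, its dilates approximate indicator functions
   and no partition of unity is needed. *)
Definition eta : R -> R := flat 1.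

Lemma eta_gt0 t : 0 < t -> 0 < eta t.
Proof. by move=> t0; rewrite /eta /flat t0 hornerC mul1r expR_gt0. Qed.

Lemma eta_le0 t : t <= 0 -> eta t = 0.
Proof. by move=> t0; rewrite /eta /flat ltNge t0. Qed.

Lemma eta_ge0 t : 0 <= eta t.
Proof. by have [/eta_gt0/ltW//|/eta_le0->] := ltP 0 t. Qed.

Lemma eta_le1 t : eta t <= 1.
Proof.
have [t0|/eta_le0->//] := ltP 0 t.
by rewrite /eta /flat t0 hornerC mul1r expR_le1 oppr_le0 invr_ge0 ltW.
Qed.

Lemma etaE t : 0 < t -> eta t = expR (- t^-1).
Proof. by move=> t0; rewrite /eta /flat t0 hornerC mul1r. Qed.

Lemma eta_cvg1 t : 0 < t -> eta (k.+1%:R * t) @[k --> \oo] --> (1 : R).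
Proof.
move=> t0; rewrite -[X in _ --> X]expR0 -[X in _ --> expR X]oppr0.
under eq_fun do rewrite etaE ?mulr_gt0// invfM.
have h : k.+1%:R^-1 * t^-1 @[k --> \oo] --> (0 : R).
  rewrite -[X in _ --> X](mul0r t^-1); apply: cvgMl; exact: cvg_harmonic.
by apply: continuous_cvg; [exact: continuous_expR|exact: cvgN].
Qed.

End flat.

(** * Smooth functions with bounded support *)

Section test_functions.
Context {R : realType} {n : nat}.
Local Notation E := 'rV[R]_n.
Implicit Types (f g phi chi : E -> R) (x v w a b : E).

Lemma Ck_flat_coord k (P : {poly R}) i : Ck k (fun x : E => flat P (x ord0 i)).
Proof.
have cf Q : continuous (fun x : E => flat Q (x ord0 i)).
  by move=> x; apply: continuous_comp; [exact: coord_continuous|exact: continuous_flat].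
elim: k P => [P|k IH P]; first exact: cf.
apply: (Ck_intro (df := fun j x => (i == j)%:R * flat ('X^2 * (P - P^`())) (x ord0 i))) => //.
- move=> j x; apply: is_derive_cvg.
  under eq_fun do rewrite !mxE eqxx/=.
  case: eqP => _; last first.
    under eq_fun do rewrite mulr0 add0r subrr mulr0.
    by rewrite mul0r; exact: cvg_cst.
  have [+ dE] := is_derive_flat P (x ord0 i).
  rewrite /derivable mul1r -dE.
  by under [X in cvg (X @ _)]eq_fun do rewrite /= /shift/=.
- by move=> j; apply: CkZ; exact: IH.
Qed.

Lemma compact_norm_le (N : R) : compact [set x : E | `|x| <= N].
Proof.
apply: bounded_closed_compact.
  exists N; split; first exact: num_real.
  by move=> M NM x /= xN; apply: le_trans xN _; exact: ltW.
have -> : [set x : E | `|x| <= N] = (fun x : E => `|x|) @^-1` `]-oo, N]%classic.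
  by apply/seteqP; split => x /=; rewrite in_itv.
by apply: closed_comp => [x _|]; [exact: norm_continuous|exact: interval_closed].
Qed.

Lemma compact_subset_norm (K : set E) : compact K ->
  exists2 N : R, 0 < N & forall x, K x -> `|x| <= N.
Proof.
move=> /compact_bounded[N [_ hN]]; exists (Num.max 1 (N + 1)).
  by rewrite lt_max ltr01.
by move=> x Kx; apply: hN => //; rewrite lt_max ltrDl ltr01 orbT.
Qed.

(** Closed bounded sets are compact here, so compact support amounts to a radius N, the form in
    which supports enter all later estimates. *)
Lemma test_functionP phi : test_function phi <->
  smooth phi /\ exists2 N : R, 0 < N & forall x, phi x != 0 -> `|x| <= N.
Proof.
split=> [[sp cp]|[sp [N N0 hN]]]; split => //.
  have [N N0 hN] := compact_subset_norm cp; exists N => // x px.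
  by apply: hN; exact: subset_closure.
have cN : compact [set x : E | `|x| <= N] by exact: compact_norm_le.
have clN : closed [set x : E | `|x| <= N].
  by apply: compact_closed => //; exact: norm_hausdorff.
apply: (subclosed_compact _ cN); first exact: closed_closure.
rewrite [X in _ `<=` X](iffLR (closure_id _))//.
by apply: closure_subset => x; exact: hN.
Qed.

Lemma compact_bounded_fun f (N : R) : continuous f ->
  exists2 M : R, 0 < M & forall x, `|x| <= N -> `|f x| <= M.
Proof.
move=> cf; have : compact (f @` [set x : E | `|x| <= N]).
  apply: continuous_compact; last exact: compact_norm_le.
  exact: continuous_subspaceT.
move=> /compact_bounded[M [_ hM]]; exists (Num.max 1 (M + 1)).
  by rewrite lt_max ltr01.
by move=> x Kx; apply: hM; [rewrite lt_max ltrDl ltr01 orbT|exists x].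
Qed.

Lemma test_function_continuous phi : test_function phi -> continuous phi.
Proof. by move=> [/(_ [::])[]]. Qed.

Lemma bounded_support_bounded f (N : R) : continuous f ->
  (forall x, f x != 0 -> `|x| <= N) ->
  exists2 M : R, 0 < M & forall x, `|f x| <= M.
Proof.
move=> cf hN; have [M M0 hM] := compact_bounded_fun N cf; exists M => // x.
have [->|fx] := eqVneq (f x) 0; first by rewrite normr0 ltW.
by apply: hM; exact: hN.
Qed.

Lemma smooth_partial i f : smooth f -> smooth (partial i f).
Proof.
by move=> /smoothP sf; apply/smoothP => k; apply: Ck_partial; exact: sf.
Qed.

Lemma partial_support i f (N : R) : (forall x, f x != 0 -> `|x| <= N) ->
  forall x, partial i f x != 0 -> `|x| <= N.
Proof.
move=> hN x; apply: contraNT; rewrite -ltNge => Nx.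
rewrite /partial (@near_eq_derive _ _ _ f (cst 0)) ?derive_cst//.
near=> y; apply/eqP; apply: contraTT (_ : N < `|y|) => [fy|].
  by rewrite -leNgt; exact: hN.
near: y; have := @norm_continuous _ _ x; move/cvgrPdist_lt.
move=> /(_ (`|x| - N)); rewrite subr_gt0 => /(_ Nx); apply: filterS => y.
by rewrite ltr_norml => /andP[_]; lra.
Unshelve. all: by end_near. Qed.

Lemma test_function_partial i phi : test_function phi -> test_function (partial i phi).
Proof.
move=> /test_functionP[sp [N N0 hN]]; apply/test_functionP; split.
  exact: smooth_partial.
by exists N => //; exact: partial_support.
Qed.

Lemma smoothM f g : smooth f -> smooth g -> smooth (fun x => f x * g x).
Proof. by move=> /smoothP sf /smoothP sg; apply/smoothP => k; exact: CkM. Qed.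

Lemma test_functionM chi phi : smooth chi -> test_function phi ->
  test_function (fun x => chi x * phi x).
Proof.
move=> sc /test_functionP[sp [N N0 hN]]; apply/test_functionP; split.
  exact: smoothM.
by exists N => // x; rewrite mulf_eq0 negb_or => /andP[_]; exact: hN.
Qed.

Lemma partialM chi phi i x : smooth chi -> smooth phi ->
  partial i (fun y => chi y * phi y) x = chi x * partial i phi x + phi x * partial i chi x.
Proof.
move=> /smoothP/(_ 1%N) sc /smoothP/(_ 1%N) sp.
have dc := Ck_partialP i x sc; have dp := Ck_partialP i x sp.
by have [_] := is_deriveM dc dp.
Qed.

Lemma smooth_affine f (L : 'M[R]_n) b : smooth f -> smooth (fun x => f (x *m L + b)).
Proof. by move=> /smoothP sf; apply/smoothP => k; exact: Ck_affine. Qed.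

Lemma smooth_eta_coord (c s : R) i : smooth (fun x => eta (s * x ord0 i + c)).
Proof.
have : smooth (fun x => eta (x ord0 i)) by apply/smoothP => k; exact: Ck_flat_coord.
move=> /(@smooth_affine _ s%:M (const_mx c)).
by under eq_fun do rewrite mul_mx_scalar !mxE.
Qed.

Lemma smooth_prod I (r : seq I) (F : I -> E -> R) : (forall i, smooth (F i)) ->
  smooth (fun x => \prod_(i <- r) F i x).
Proof. by move=> sF; apply/smoothP => k; apply: Ck_prod => i _; move/smoothP : (sF i). Qed.

Definition box_bump (k : R) a b x : R :=
  \prod_i (eta (k * (x ord0 i - a ord0 i)) * eta (k * (b ord0 i - x ord0 i))).

Lemma box_bump_test k a b : 0 < k -> test_function (box_bump k a b).
Proof.
move=> k0; apply/test_functionP; split.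
  apply: smooth_prod => i; apply: smoothM.
    have := @smooth_eta_coord (- (k * a ord0 i)) k i.
    by under eq_fun do rewrite -mulrBr.
  have := @smooth_eta_coord (k * b ord0 i) (- k) i.
  by under eq_fun do rewrite mulNr addrC -mulrBr.
exists (`|a| + `|b| + 1); first by rewrite ltr_wpDl// addr_ge0.
move=> x; rewrite /box_bump => /prodf_neq0 h; apply: rV_norm_le => [|i].
  by rewrite addr_ge0// addr_ge0.
have := h i isT; rewrite mulf_eq0 negb_or => /andP[h1 h2].
have {h1} : 0 < x ord0 i - a ord0 i.
  by rewrite -(pmulr_rgt0 _ k0) ltNge; apply: contra h1 => /eta_le0 ->.
have {h2} : 0 < b ord0 i - x ord0 i.
  by rewrite -(pmulr_rgt0 _ k0) ltNge; apply: contra h2 => /eta_le0 ->.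
have := coord_le_norm a i; have := coord_le_norm b i.
rewrite !ler_norml => /andP[? ?] /andP[? ?] ? ?; apply/andP; split.
  have := normr_ge0 b; lra.
have := normr_ge0 a; lra.
Qed.

Lemma box_bump_ge0 k a b x : 0 <= box_bump k a b x.
Proof. by apply: prodr_ge0 => i _; rewrite mulr_ge0// eta_ge0. Qed.

Lemma box_bump_le1 k a b x : box_bump k a b x <= 1.
Proof.
by apply: prodr_ile1 => i _; rewrite mulr_ge0 ?eta_ge0//= mulr_ile1 ?eta_ge0 ?eta_le1.
Qed.

Lemma box_bump_out k a b x : 0 < k -> ~ open_box a b x -> box_bump k a b x = 0.
Proof.
move=> k0 /existsNP[i /negP]; rewrite negb_and -!leNgt => h.
rewrite /box_bump (bigD1 i)//=; case/orP: h => h.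
  by rewrite eta_le0 ?mul0r// pmulr_rle0// subr_le0.
by rewrite (@eta_le0 _ (k * (b ord0 i - _))) ?mulr0 ?mul0r// pmulr_rle0// subr_le0.
Qed.

Lemma box_bump_cvg a b x : box_bump k.+1%:R a b x @[k --> \oo] --> (\1_(open_box a b) x : R).
Proof.
have [h|h] := pselect (open_box a b x); last first.
  under eq_fun do rewrite box_bump_out//.
  by rewrite indicE memNset//; exact: cvg_cst.
rewrite indicE mem_set//=.
have -> : 1%:R = \prod_(i < n) (1 * 1) :> R by rewrite big1// => i _; rewrite mulr1.
apply: cvg_big => //; first exact: mul_continuous.
by move=> i _; have /andP[? ?] := h i; apply: cvgM; apply: eta_cvg1; rewrite subr_gt0.
Qed.

End test_functions.

(** * Local integrability and the fundamental lemma *)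

Section local_integrability.
Context {R : realType} {n : nat}.
Local Notation E := 'rV[R]_n.
Local Notation mu := (rV_lebesgue R n).
Implicit Types (f g u phi : E -> R) (x a b : E) (N M : R).

Definition cube N : set E := [set x | `|x| <= N].

Lemma compact_cube N : compact (cube N). Proof. exact: compact_norm_le. Qed.

Lemma measurable_cube N : measurable (cube N).
Proof. by apply: compact_measurable_rV; exact: compact_cube. Qed.

Lemma cube_fin N : (mu (cube N) < +oo)%E.
Proof.
apply: le_lt_trans (mu_open_box_fin (const_mx (- (N + 1))) (const_mx (N + 1))).
apply: le_measure; rewrite ?inE; first exact: measurable_cube.
  exact: measurable_open_box.
move=> x xN i; rewrite !mxE -ltr_norml.
by apply: le_lt_trans (coord_le_norm x i) _; apply: le_lt_trans xN _; rewrite ltrDl.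
Qed.

Lemma rV_locally_integrable_cube f : rV_locally_integrable f <->
  measurable_fun setT f /\ forall N, mu.-integrable (cube N) (EFin \o f).
Proof.
split=> [[mf If]|[mf If]]; split => //.
  by move=> N; apply: If; exact: compact_cube.
move=> K cK; have [N _ hN] := compact_subset_norm cK.
apply: integrableS (If N) => //; first exact: measurable_cube.
exact: compact_measurable_rV.
Qed.

Lemma continuous_locally_integrable f : continuous f -> rV_locally_integrable f.
Proof.
move=> cf; apply/rV_locally_integrable_cube; split.
  exact: continuous_measurable_rV.
move=> N; apply: measurable_bounded_integrable.
- exact: measurable_cube.
- exact: cube_fin.
- by apply: measurable_funTS; exact: continuous_measurable_rV.
- have [M M0 hM] := compact_bounded_fun N cf; exists M; split; first exact: num_real.
  by move=> M' MM' x xN; apply: le_trans (hM _ xN) _; exact: ltW.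
Qed.

Lemma bounded_support_locally_integrable f N : rV_locally_integrable f ->
  (forall x, f x != 0 -> `|x| <= N) -> mu.-integrable setT (EFin \o f).
Proof.
move=> /rV_locally_integrable_cube[mf If] hN.
have -> : EFin \o f = (EFin \o f) \_ (cube N).
  apply/funext => x; rewrite patchE; case: ifPn => // /negP h /=.
  have [->//|/hN fx] := eqVneq (f x) 0; exfalso; apply: h.
  by rewrite inE.
by apply/(integrable_mkcond _ (measurable_cube N)); exact: If.
Qed.

Lemma rV_locally_integrable_bounded_mul f g : rV_locally_integrable f ->
  measurable_fun setT g ->
  (forall N, exists M, forall x, `|x| <= N -> `|g x| <= M) ->
  rV_locally_integrable (fun x => f x * g x).
Proof.
move=> /rV_locally_integrable_cube[mf If] mg bg; apply/rV_locally_integrable_cube.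
split; first exact: measurable_funM.
move=> N; have [M hM] := bg N.
have -> : EFin \o (fun x => f x * g x) = ((EFin \o g) \* (EFin \o f))%E.
  by apply/funext => x /=; rewrite -EFinM mulrC.
apply: integrableMr => //; first exact: measurable_cube.
  exact: measurable_funTS.
exists M; split; first exact: num_real.
by move=> M' MM' x xN; apply: le_trans (hM _ xN) _; exact: ltW.
Qed.

Lemma rV_locally_integrable_continuous_mul f g : rV_locally_integrable f ->
  continuous g -> rV_locally_integrable (fun x => f x * g x).
Proof.
move=> If cg; apply: rV_locally_integrable_bounded_mul => //.
  exact: continuous_measurable_rV.
by move=> N; have [M _ hM] := compact_bounded_fun N cg; exists M.
Qed.

Lemma integrable_test_mul f phi : rV_locally_integrable f -> test_function phi ->
  mu.-integrable setT (EFin \o (fun x => f x * phi x)).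
Proof.
move=> If tp; have /test_functionP[_ [N _ hN]] := tp.
apply: (@bounded_support_locally_integrable _ N).
  by apply: rV_locally_integrable_continuous_mul => //; exact: test_function_continuous.
by move=> x; rewrite mulf_eq0 negb_or => /andP[_]; exact: hN.
Qed.

Lemma rV_locally_integrableD f g : rV_locally_integrable f -> rV_locally_integrable g ->
  rV_locally_integrable (fun x => f x + g x).
Proof.
move=> [mf If] [mg Ig]; split; first exact: measurable_funD.
move=> K cK; have mK := compact_measurable_rV cK.
rewrite (_ : _ \o _ = ((EFin \o f) \+ (EFin \o g))%E)//.
by apply: integrableD => //; [exact: If|exact: Ig].
Qed.

Lemma rV_locally_integrableZ (c : R) f : rV_locally_integrable f ->
  rV_locally_integrable (fun x => c * f x).
Proof.
move=> [mf If]; split; first exact: measurable_funM.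
move=> K cK; have mK := compact_measurable_rV cK.
rewrite (_ : _ \o _ = (fun x => c%:E * (EFin \o f) x)%E)//.
by apply: integrableZl => //; exact: If.
Qed.

Lemma rV_locally_integrable_sum I (r : seq I) (F : I -> E -> R) :
  (forall i, rV_locally_integrable (F i)) ->
  rV_locally_integrable (fun x => \sum_(i <- r) F i x).
Proof.
move=> IF; elim: r => [|i r IH].
  under eq_fun do rewrite big_nil; apply: continuous_locally_integrable.
  exact: cst_continuous.
by under eq_fun do rewrite big_cons; exact: rV_locally_integrableD.
Qed.

Lemma rV_locally_integrable_le f g : measurable_fun setT f ->
  rV_locally_integrable g -> (forall x, `|f x| <= `|g x|) ->
  rV_locally_integrable f.
Proof.
move=> mf [mg Ig] fg; split => // K cK; have mK := compact_measurable_rV cK.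
apply: le_integrable (Ig _ cK) => //.
  by apply: measurable_funTS; exact/measurable_EFinP.
by move=> x _ /=; rewrite lee_fin.
Qed.

Lemma measurable_rVE : @measurable _ E = <<s [set A | exists a b, A = open_box a b] >>.
Proof.
apply/seteqP; split => [B|]; first exact: measurable_rV_boxes.
apply: smallest_sub; first exact: sigma_algebra_measurable.
by move=> _ [a [b ->]]; exact: measurable_open_box.
Qed.

(** Test with [box_bump] and let it tend to the indicator of the box. The integrands are dominated
    by |f| on a cube that contains the box. *)
Lemma integral_open_box_eq0 f : rV_locally_integrable f ->
  (forall phi, test_function phi -> \int[mu]_x (f x * phi x) = 0) ->
  forall a b, (\int[mu]_(x in open_box a b) (f x)%:E = 0)%E.
Proof.
move=> If f0 a b; have [mf _] := If.
have mB := measurable_open_box a b.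
rewrite integral_mkcond.
pose N := `|a| + `|b| + 1.
pose F (k : nat) x := (f x * box_bump k.+1%:R a b x)%:E.
have tB k : test_function (box_bump k.+1%:R a b) by apply: box_bump_test.
have h1 : forall x, F ^~ x @ \oo --> ((EFin \o f) \_ (open_box a b)) x.
  move=> x; rewrite (_ : _ x = (f x * \1_(open_box a b) x)%:E); last first.
    by rewrite patchE indicE; case: ifP => _; rewrite ?mulr1 ?mulr0.
  apply: cvg_EFin; first by near=> k.
  by apply: cvgMr; exact: box_bump_cvg.
have [] := @dominated_convergence _ _ _ mu setT measurableT F
    ((EFin \o f) \_ (open_box a b)) (fun x => `|((EFin \o f) \_ (cube N)) x|)%E.
- move=> k; apply/measurable_EFinP; apply: measurable_funM => //.
  by apply: continuous_measurable_rV; exact: test_function_continuous.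
- by apply/(measurable_restrictT _ mB)/measurable_funTS/measurable_EFinP.
- by apply: aeW => x _; exact: h1.
- apply: integrable_abse; apply/(integrable_mkcond _ (measurable_cube N)).
  by have /rV_locally_integrable_cube[_] := If; exact.
- apply: aeW => x k _; rewrite /F patchE; case: ifPn => [_|/negP xN] /=.
    rewrite lee_fin normrM ler_piMr// ger0_norm ?box_bump_ge0//.
    exact: box_bump_le1.
  rewrite box_bump_out ?mulr0 ?normr0// => Bx; apply: xN; rewrite inE.
  apply: rV_norm_le => [|i]; first by rewrite addr_ge0// addr_ge0.
  have := coord_le_norm a i; have := coord_le_norm b i; have := Bx i.
  have := normr_ge0 a; have := normr_ge0 b.
  by rewrite !ler_norml /N => ? ? /andP[? ?] /andP[? ?] /andP[? ?]; apply/andP; split; lra.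
move=> _ _ h; have : [sequence (\int[mu]_x F k x)%E]_k = cst 0%E.
  apply/funext => k /=; rewrite -[LHS]fineK.
    by rewrite -/(Rintegral mu setT (fun x => f x * box_bump k.+1%:R a b x)) f0.
  by apply: integrable_fin_num => //; exact: integrable_test_mul.
move=> e; move: h; rewrite e => /cvg_lim <-//.
by rewrite lim_cst.
Unshelve. all: by end_near. Qed.

(** For f restricted to a cube [Q k], the sets over which its integral vanishes form a Dynkin system
    that contains the boxes, hence all measurable sets. So f vanishes almost everywhere on each
    cube. *)
Lemma rV_locally_integrable_eq0 f : rV_locally_integrable f ->
  (forall phi, test_function phi -> \int[mu]_x (f x * phi x) = 0) ->
  {ae mu, forall x, f x = 0}.
Proof.
move=> If f0; have bf := integral_open_box_eq0 If f0; have [mf _] := If.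
pose Q (k : nat) : set E := open_box (const_mx (- k%:R)) (const_mx k%:R).
have mQ k : measurable (Q k) by exact: measurable_open_box.
have IQ k : mu.-integrable setT ((EFin \o f) \_ (Q k)).
  apply/(integrable_mkcond _ (mQ k)).
  have /rV_locally_integrable_cube[_ /(_ k%:R)] := If.
  apply: integrableS => //; first exact: measurable_cube.
  move=> x hx; apply: rV_norm_le => // i; apply: ltW.
  by have := hx i; rewrite !mxE -ltr_norml.
have H k : forall S, measurable S -> (\int[mu]_(x in S) ((EFin \o f) \_ (Q k)) x = 0)%E.
  move=> S; rewrite measurable_rVE; move: S.
  have IS S : measurable S -> mu.-integrable S ((EFin \o f) \_ (Q k)).
    by move=> mS; apply: integrableS (IQ k).
  apply: dynkin_induction.
  - exact: measurable_rVE.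
  - by move=> _ _ [a [b ->]] [a' [b' ->]]; rewrite open_box_setI; do 2 eexists.
  - by rewrite -integral_mkcond; exact: bf.
  - by move=> _ [a [b ->]]; rewrite -integral_mkcondr open_box_setI; exact: bf.
  - move=> S mS S0; have : (\int[mu]_(x in S `|` ~` S) ((EFin \o f) \_ (Q k)) x = 0)%E.
      by rewrite setUv -integral_mkcond; exact: bf.
    rewrite integral_setU//; last 3 first.
    + exact: measurableC.
    + by rewrite setUv; exact: measurable_int (IQ k).
    + by apply/disj_setPCl.
    by rewrite S0 add0e.
  - move=> F mF tF F0; rewrite integral_bigcup//; last first.
      by apply: IS; exact: bigcupT_measurable.
    by rewrite eseries0.
have ae0 k : {ae mu, forall x, setT x -> ((EFin \o f) \_ (Q k)) x = 0%E}.
  apply: (@integral_ae_eq _ _ _ mu setT measurableT (cst 0%E)) => //.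
  by move=> S _ mS; rewrite H// integral0.
have /ae_foralln := ae0; apply: filterS => x hx.
have [k hk] := rV_nat_bound x.
have := hx k I; rewrite patchE mem_set//.
  by move=> /= [].
by move=> i; rewrite !mxE -ltr_norml.
Qed.

Lemma weak_partial_unique i u g g' : is_weak_partial i u g ->
  is_weak_partial i u g' -> {ae mu, forall x, g x = g' x}.
Proof.
move=> [Ig Hg] [Ig' Hg'].
have Id : rV_locally_integrable (fun x => g x + -1 * g' x).
  by apply: rV_locally_integrableD => //; exact: rV_locally_integrableZ.
have := rV_locally_integrable_eq0 Id; move=> h.
have {h} : {ae mu, forall x, g x + -1 * g' x = 0}.
  apply: h => phi tp.
  under eq_Rintegral do rewrite mulrDl mulN1r mulNr.
  rewrite RintegralB//; last 2 first.
  - exact: integrable_test_mul.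
  - exact: integrable_test_mul.
  by apply/eqP; rewrite subr_eq0 -eqr_opp -Hg// -Hg'.
by apply: filterS => x; rewrite mulN1r => /subr0_eq.
Qed.

End local_integrability.

(** * Translations *)

Section translation.
Context {R : realType} {n : nat}.
Local Notation E := 'rV[R]_n.
Local Notation mu := (rV_lebesgue R n).
Implicit Types (f g u phi psi : E -> R) (x v a b : E) (N M h t : R).

Lemma similarity1E b x : similarity 1 1%:M b x = x + b.
Proof. by rewrite /similarity scale1r mulmx1. Qed.

Lemma orthogonal1 : (1%:M : 'M[R]_n) *m (1%:M)^T = 1%:M.
Proof. by rewrite trmx1 mulmx1. Qed.

Lemma Rintegral_translate f b : mu.-integrable setT (EFin \o f) ->
  \int[mu]_x f (x + b) = \int[mu]_x f x.
Proof.
move=> If; have := Rintegral_similarity b ltr01 orthogonal1 If.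
by rewrite expr1n invr1 mul1r; under eq_Rintegral do rewrite similarity1E.
Qed.

Lemma integrable_translate f b : mu.-integrable setT (EFin \o f) ->
  mu.-integrable setT (EFin \o (fun x => f (x + b))).
Proof.
move=> If; have := integrable_similarity b ltr01 orthogonal1 If.
by congr (_.-integrable _ _); apply/funext => x /=; rewrite similarity1E.
Qed.

Lemma test_function_translate phi b : test_function phi ->
  test_function (fun x => phi (x + b)).
Proof.
move=> /test_functionP[sp [N N0 hN]]; apply/test_functionP; split.
  by have := @smooth_affine _ _ phi 1%:M b sp; under eq_fun do rewrite mulmx1.
exists (N + `|b|); first by rewrite ltr_wpDr.
move=> x /hN; have := ler_normB (x + b) b; rewrite addrK; lra.
Qed.

Lemma partial_translate phi b i x : smooth phi ->
  partial i (fun y => phi (y + b)) x = partial i phi (x + b).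
Proof.
move=> /smoothP/(_ 1%N) sp; have := @partial_affine _ _ phi 1%:M b i x sp.
under [X in partial _ X]eq_fun do rewrite mulmx1.
move=> ->; rewrite mulmx1 (bigD1 i)//= mxE eqxx mul1r big1 ?addr0// => j ji.
by rewrite mxE eq_sym (negbTE ji) mul0r.
Qed.

Lemma rV_locally_integrable_translate f b : rV_locally_integrable f ->
  rV_locally_integrable (fun x => f (x + b)).
Proof.
move=> /rV_locally_integrable_cube[mf If]; apply/rV_locally_integrable_cube; split.
  by apply: (measurableT_comp mf); exact: measurable_translate.
move=> N; have mC := @measurable_cube R n N.
have mC' := @measurable_cube R n (N + `|b|).
have := If (N + `|b|); rewrite integrable_mkcond// restrict_EFin => /(integrable_translate b) h.
rewrite integrable_mkcond//; apply: le_integrable h => //.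
  apply/(measurable_restrictT _ mC)/measurable_funTS/measurable_EFinP.
  by apply: (measurableT_comp mf); exact: measurable_translate.
move=> x _; rewrite /= !patchE; case: ifPn => [|_]; last by rewrite abse0 lee_fin.
rewrite inE => xN; rewrite mem_set//.
by have := ler_normD x b; move: xN; rewrite /cube/=; lra.
Qed.

Lemma is_derive_test_line i phi x h : test_function phi ->
  is_derive h 1 (fun s : R => phi (s *: delta_mx ord0 i + x))
    (partial i phi (h *: delta_mx ord0 i + x)).
Proof. by move=> [/(_ [::])[_ dp] _]; exact: is_derive_line. Qed.

Lemma norm_delta i : `|delta_mx ord0 i : E| = 1.
Proof.
apply/eqP; rewrite eq_le; apply/andP; split.
  by apply: rV_norm_le => // j; rewrite mxE eqxx/=; case: eqP => _; rewrite ?normr1 ?normr0.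
by have := coord_le_norm (delta_mx ord0 i : E) i; rewrite mxE !eqxx normr1.
Qed.

(** Differentiation under the integral sign: the parameter sits in phi alone, so local integrability
    of u is enough. *)
Lemma is_derive_integral_translate u phi i h : rV_locally_integrable u ->
  test_function phi ->
  is_derive h 1 (fun s : R => \int[mu]_x (u x * phi (x + s *: delta_mx ord0 i)))
    (\int[mu]_x (u x * partial i phi (x + h *: delta_mx ord0 i))).
Proof.
move=> Iu tp; set v := delta_mx ord0 i.
have tdp := test_function_partial i tp.
have [_ [N N0 hN]] := (test_functionP _).1 tdp.
have [M M0 hM] := bounded_support_bounded (test_function_continuous tdp) hN.
pose F (s : R) x := u x * phi (x + s *: v).
have dF (s : R) x : is_derive s 1 (F^~ x) (u x * partial i phi (x + s *: v)).
  have := is_derive_test_line i x s tp.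
  under eq_fun do rewrite addrC.
  by rewrite addrC => d; exact: is_deriveZ.
(* For s within 1 of h, the translates of the derivative of phi are supported in this cube, so one
   dominating function serves them all. *)
pose C := N + `|h| + 1.
pose G x := `|u x| * M * \1_(cube C) x.
have Ia s : mu.-integrable setT (EFin \o F s).
  by apply: integrable_test_mul => //; exact: test_function_translate.
have d1E s x : partial1of2 F s x = u x * partial i phi (x + s *: v).
  by rewrite partial1of2E; case: (dF s x).
have key := @cvg_differentiation_under_integral R _ _ mu F setT measurableT h
  (h - 1) (h + 1) _ (fun s _ => Ia s) _ G _ _ _.
have {}key : t^-1 *: (\int[mu]_x F (t + h) x - \int[mu]_x F h x) @[t --> 0^'] -->
    \int[mu]_x (u x * partial i phi (x + h *: v)).
  under [X in _ --> X]eq_Rintegral do rewrite -d1E.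
  apply: key.
  - by rewrite /= in_itv/= ltrBlDr ltrDl ltr01.
  - by move=> s x _ _; case: (dF s x).
  - by move=> x; rewrite /G mulr_ge0// mulr_ge0// ltW.
  - have /rV_locally_integrable_cube[mu' /(_ C)] := Iu.
    move=> /(integrable_mkcond _ (@measurable_cube R n C)).1.
    move=> /integrable_abse/(integrableZl measurableT M); congr (_.-integrable _ _).
    apply/funext => x; rewrite /G /= patchE indicE; case: ifP => _.
      by rewrite -EFinM mulr1 mulrC.
    by rewrite abse0 mule0 mulr0.
  - move=> s x; rewrite /= in_itv/= => /andP[s1 s2] _; rewrite d1E /G normrM.
    have [->|/hN hs] := eqVneq (partial i phi (x + s *: v)) 0.
      by rewrite normr0 mulr0 mulr_ge0// mulr_ge0// ltW.
    rewrite indicE mem_set ?mulr1 ?ler_wpM2l//.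
    rewrite /cube/= /C; have := ler_normB (x + s *: v) (s *: v); rewrite addrK normrZ norm_delta mulr1.
    have : `|s| <= `|h| + 1 by rewrite ler_norml; have := ler_norm h; have := ler_norm (- h);
      rewrite normrN; lra.
    lra.
have e : (fun t : R => t^-1 *: (((fun s : R => \int[mu]_x F s x) \o shift h) (t *: 1) -
    \int[mu]_x F h x)) = (fun t => t^-1 *: (\int[mu]_x F (t + h) x - \int[mu]_x F h x)).
  by apply/funext => t /=; rewrite /shift/= [t%:A]mulr1.
split; first by apply/cvg_ex; exists (\int[mu]_x (u x * partial i phi (x + h *: v))); rewrite e.
by apply/cvg_lim => //; rewrite e.
Qed.

End translation.

(** * Averages along segments *)

Lemma ge0_integral_translate (R : realType) n (f : 'rV[R]_n -> \bar R) b :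
  measurable_fun setT f -> (forall x, 0 <= f x)%E ->
  (\int[rV_lebesgue R n]_x f (x + b)%R = \int[rV_lebesgue R n]_x f x)%E.
Proof.
move=> mf f0; have := ge0_integral_similarity b ltr01 (orthogonal1 (n := n)) mf f0.
by rewrite expr1n invr1 mul1e => <-; apply: eq_integral => x _; rewrite similarity1E.
Qed.

Section segment_average.
Context {R : realType} {n : nat}.
Local Notation E := 'rV[R]_n.
Local Notation mu := (rV_lebesgue R n).
Local Notation nu := (@lebesgue_measure R).
Implicit Types (u phi psi : E -> R) (x a b : E) (N M t : R).
Variables (g : E -> R) (i : 'I_n) (h : R).
Hypotheses (Ig : rV_locally_integrable g) (h0 : 0 < h).
Let v : E := delta_mx ord0 i.

(** If g is the weak derivative of u along e_i, this will be the increment of u from x - h e_i to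
    x. *)
Definition segment_integral x : R := \int[nu]_(t in `[0, h]) g (x - t *: v).

Section kernel.
Variables (psi : E -> R) (N M : R).
Hypotheses (mpsi : measurable_fun setT psi) (Mpsi : forall x, `|psi x| <= M)
  (Npsi : forall x, psi x != 0 -> `|x| <= N).

Let M0 : 0 <= M. Proof. exact: le_trans (Mpsi 0). Qed.

Let C := \int[mu]_x (`|(g \_ (cube (N + h))) x| * M).

Let IC : mu.-integrable setT (EFin \o (fun x => `|(g \_ (cube (N + h))) x| * M)).
Proof.
have /rV_locally_integrable_cube[_ /(_ (N + h))] := Ig.
move=> /(integrable_mkcond _ (@measurable_cube R n (N + h))).1.
move=> /integrable_abse/(integrableZl measurableT M); congr (_.-integrable _ _).
apply/funext => x; rewrite /= !patchE; case: ifP => _.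
  by rewrite -EFinM mulrC.
by rewrite abse0 mule0 normr0 mul0r.
Qed.

(** A translation moves t from g to psi. The support of the translated psi stays in the cube of
    radius N + h, so the bound C does not depend on t. *)
Lemma kernel_slice_le t : 0 <= t <= h ->
  (\int[mu]_x `|(g (x - t *: v) * psi x)%:E| <= C%:E)%E.
Proof.
move=> /andP[t0 th]; have [mg _] := Ig.
have mgt : measurable_fun setT (fun x => g (x - t *: v)).
  by apply: (measurableT_comp mg); exact: measurable_translate.
have mpt : measurable_fun setT (fun x => psi (x + t *: v)).
  by apply: (measurableT_comp mpsi); exact: measurable_translate.
have := @ge0_integral_translate R n (fun x => `|(g x * psi (x + t *: v))%:E|%E) (- (t *: v)).
under eq_integral do rewrite subrK.
move=> ->//; last first.
  by apply/measurable_EFinP; apply: measurableT_comp => //; exact: measurable_funM.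
rewrite /C /Rintegral fineK; last exact: integrable_fin_num.
apply: ge0_le_integral => //.
- by apply/measurable_EFinP; apply: measurableT_comp => //; exact: measurable_funM.
- by case/integrableP: IC.
move=> x _; rewrite lee_fin normrM patchE.
have [->|/Npsi hp] := eqVneq (psi (x + t *: v)) 0.
  by rewrite normr0 mulr0 mulr_ge0.
rewrite mem_set ?ler_wpM2l//.
rewrite /cube/=; have := ler_normB (x + t *: v) (t *: v).
by rewrite addrK normrZ norm_delta mulr1 (ger0_norm t0); lra.
Qed.

(** The range of t enters through an indicator, so that Fubini's theorem is applied on the whole
    product space. *)
Definition kernel (z : R * E) : \bar R :=
  (\1_(`[0, h]%classic) z.1 * (g (z.2 - z.1 *: v) * psi z.2))%:E.

Lemma measurable_kernel : measurable_fun setT kernel.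
Proof.
have [mg _] := Ig; apply/measurable_EFinP; apply: measurable_funM.
  have mI : measurable_fun setT (\1_(`[0, h]%classic) : R -> R) by exact: measurable_indic.
  exact: (measurableT_comp mI measurable_fst).
apply: measurable_funM; last exact: (measurableT_comp mpsi).
apply: (measurableT_comp mg); apply: measurable_rVD => //; apply: measurable_rVN.
apply: measurable_fun_rVP => j; under eq_fun do rewrite mxE.
by apply: measurable_funM.
Qed.

Lemma kernel_fst t : (\int[mu]_x kernel (t, x) =
  (\1_(`[0, h]%classic) t)%:E * \int[mu]_x (g (x - t *: v) * psi x)%:E)%E.
Proof.
rewrite /kernel/= indicE; case: (boolP (t \in _)) => [ht|_] /=.
  by under eq_integral do rewrite mul1r; rewrite mul1e.
by under eq_integral do rewrite mul0r; rewrite integral0 mul0e.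
Qed.

Lemma integrable_kernel : (nu \x mu)%E.-integrable setT kernel.
Proof.
apply/integrable12ltyP; first exact: measurable_kernel.
apply: (@le_lt_trans _ _ (\int[nu]_t ((\1_(`[0, h]%classic) t)%:E * C%:E))%E).
  apply: ge0_le_integral => //.
  - by move=> t _; exact: integral_ge0.
  - have mk : measurable_fun setT (abse \o kernel).
      by apply: measurableT_comp => //; exact: measurable_kernel.
    by apply: (@measurable_fun_fubini_tonelli_F _ _ (measurableTypeR R) E R mu _ mk) => z; exact: abse_ge0.
  - apply/measurable_EFinP; apply: measurable_funM => //.
  move=> t _; rewrite /kernel/= indicE; case: (boolP (t \in _)) => [ht|_] /=.
    under eq_integral do rewrite mul1r.
    by rewrite mul1e; apply: kernel_slice_le; move: ht; rewrite inE/= in_itv.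
  by under eq_integral do rewrite mul0r normr0; rewrite integral0 mul0e.
rewrite ge0_integralZr//; last 2 first.
- exact/measurable_EFinP.
- by rewrite lee_fin Rintegral_ge0// => x _; rewrite mulr_ge0.
rewrite integral_indic// setIT.
rewrite (_ : _ `[0, h]%classic = h%:E); first by rewrite -EFinM ltry.
by rewrite /= lebesgue_measure_itv/= lte_fin h0 -EFinB subr0.
Qed.

(** Where psi x is nonzero, dividing by it transfers integrability from the kernel to g along the
    segment; where psi x is 0, both sides are 0. *)
Lemma kernel_snd x :
  nu.-integrable setT (fun t => kernel (t, x)) ->
  (\int[nu]_t kernel (t, x) = (segment_integral x * psi x)%:E)%E.
Proof.
move=> Ik; have [p0|p0] := eqVneq (psi x) 0.
  rewrite p0 mulr0; rewrite (eq_integral (cst 0%E)) ?integral0// => t _.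
  by rewrite /kernel/= p0 !mulr0.
have Ik' : nu.-integrable setT (fun t => (\1_(`[0, h]%classic) t * g (x - t *: v))%:E).
  have := integrableZl measurableT (psi x)^-1 Ik; congr (_.-integrable _ _).
  by apply/funext => t; rewrite /kernel/= -EFinM; congr EFin; field.
have -> : (fun t => kernel (t, x)) = (fun t => (psi x)%:E * (\1_(`[0, h]%classic) t * g (x - t *: v))%:E)%E.
  by apply/funext => t; rewrite /kernel/= -EFinM; congr EFin; ring.
rewrite integralZl// muleC EFinM; congr (_ * _)%E.
rewrite /segment_integral /Rintegral [in RHS]integral_mkcond.
have e : (fun t => (\1_(`[0, h]%classic) t * g (x - t *: v))%:E) =
     ((fun t => (g (x - t *: v))%:E) \_ `[0, h]).
  by apply/funext => t; rewrite patchE indicE; case: ifP => _; rewrite ?mul1r ?mul0r.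
rewrite -e fineK//; exact: integrable_fin_num.
Qed.

End kernel.

(** With psi the indicator of a cube, the inner integral of the integrable [kernel] is measurable
    and integrable, and on that cube it coincides with [segment_integral]. The cubes exhaust the
    space. *)
Lemma rV_locally_integrable_segment : rV_locally_integrable segment_integral.
Proof.
have mC N := @measurable_cube R n N.
have b1 N x : `|\1_(cube N) x : R| <= 1.
  by rewrite indicE; case: (_ \in _); rewrite ?normr1 ?normr0.
have s1 N x : (\1_(cube N) x : R) != 0 -> `|x| <= N.
  by rewrite indicE; case: (boolP (x \in _)); rewrite ?inE// eqxx.
have m1 N : measurable_fun setT (\1_(cube N) : E -> R) by exact: measurable_indic.
have Ik N := integrable_kernel (m1 N) (b1 N) (s1 N).
have e N x : cube N x -> segment_integral x = fine (\int[nu]_t kernel \1_(cube N) (t, x)).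
  move=> xN; rewrite /segment_integral /Rintegral integral_mkcond; congr fine.
  apply: eq_integral => t _; rewrite patchE /kernel/= !indicE (mem_set xN)/=.
  by case: ifP => _; rewrite ?mul1r ?mulr1 ?mul0r.
have mG N := measurable_fubini_G (Ik N).
have IG N : mu.-integrable (cube N) (EFin \o segment_integral).
  have IGN : mu.-integrable (cube N) (EFin \o (fine \o fubini_G nu (kernel \1_(cube N)))).
    apply: (@le_integrable _ _ _ mu (cube N) (mC N) _ (fubini_G nu (kernel \1_(cube N)))).
    - apply/measurable_EFinP; apply: measurable_funTS.
      exact: (measurableT_comp (f := fine)).
    - by move=> x _ /=; case: (fubini_G _ _ x) => [r||] //=; rewrite normr0 leey.
    - apply: (@integrableS _ _ _ mu setT) => //; apply/integrableP; split => //.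
      have mk := measurable_int _ (Ik N).
      have Ioo := (integrable21ltyP _ _ mk).1 (Ik N); apply: le_lt_trans Ioo.
      apply: ge0_le_integral => //.
      + exact: (measurableT_comp (f := abse)).
      + have mak : measurable_fun setT (abse \o kernel \1_(cube N)) by exact: measurableT_comp.
        by apply: (@measurable_fun_fubini_tonelli_G _ _ (measurableTypeR R) E R nu _ mak) => z; exact: abse_ge0.
      + move=> x _; apply: le_abse_integral => //.
        by apply: (measurableT_comp mk); exact: pair2_measurable.
  apply: eq_integrable IGN => // x; rewrite inE => xN /=.
  by rewrite (e N x xN).
apply/rV_locally_integrable_cube; split => //.
have -> : [set: E] = \bigcup_k cube k%:R.
  apply/seteqP; split => // x _; have [k hk] := rV_nat_bound x.
  by exists k => //; apply: rV_norm_le => // j; exact/ltW.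
apply/measurable_fun_bigcup => [k|k]; first exact: mC.
by apply/measurable_EFinP; exact: measurable_int (IG _).
Qed.

Section fubini.
Variables (psi : E -> R) (N M : R).
Hypotheses (mpsi : measurable_fun setT psi) (Mpsi : forall x, `|psi x| <= M)
  (Npsi : forall x, psi x != 0 -> `|x| <= N).

Let slice t : R := \int[mu]_x (g (x - t *: v) * psi x).

Let kernel_sliceE : (fun t => \int[mu]_x kernel psi (t, x))%E = (EFin \o slice) \_ `[0, h].
Proof.
apply/funext => t; rewrite kernel_fst patchE indicE; case: ifPn => [|_]; last by rewrite mul0e.
rewrite inE/= in_itv/= => ht; rewrite mul1e /= /slice /Rintegral fineK//.
apply: integrable_fin_num => //; apply/integrableP; split.
  have [mg _] := Ig; apply/measurable_EFinP; apply: measurable_funM => //.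
  by apply: (measurableT_comp mg); exact: measurable_translate.
by apply: le_lt_trans (kernel_slice_le mpsi Mpsi Npsi ht) _; rewrite ltry.
Qed.

Lemma integrable_slice : nu.-integrable `[0, h] (EFin \o slice).
Proof.
apply/integrable_mkcond => //; rewrite -kernel_sliceE.
exact: (integrable_fubini_F (integrable_kernel mpsi Mpsi Npsi)).
Qed.

Lemma segment_integral_fubini : \int[mu]_x (segment_integral x * psi x) =
  \int[nu]_(t in `[0, h]) (\int[mu]_x (g (x - t *: v) * psi x)).
Proof.
have Ik := integrable_kernel mpsi Mpsi Npsi.
have [ms _] := rV_locally_integrable_segment.
rewrite /Rintegral; congr fine.
transitivity (\int[mu]_x \int[nu]_t kernel psi (t, x))%E.
  apply: ae_eq_integral => //.
  - by apply/measurable_EFinP; exact: measurable_funM.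
  - exact: (measurable_fubini_G Ik).
  (* The slice in t is integrable for almost every x only, which is enough under the outer
     integral. *)
  - have := ae_integrable2 Ik; apply: filterS => x Ikx _.
    by rewrite kernel_snd.
rewrite -Fubini//; rewrite [RHS]integral_mkcond; apply: eq_integral => t _.
by have := kernel_sliceE => /(congr1 (fun F => F t)).
Qed.

End fubini.

End segment_average.

(** * The chain rule for weak derivatives *)

Section weak_difference.
Context {R : realType} {n : nat}.
Local Notation E := 'rV[R]_n.
Local Notation mu := (rV_lebesgue R n).
Local Notation nu := (@lebesgue_measure R).
Implicit Types (u g phi psi : E -> R) (x a b : E) (N M t h : R) (i : 'I_n).
Local Notation e_ i := (delta_mx ord0 i : E).

Lemma is_derive_weak_translate i u g phi h : rV_locally_integrable u ->
  is_weak_partial i u g -> test_function phi ->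
  is_derive h 1 (fun s : R => \int[mu]_x (u x * phi (x + s *: e_ i)))
    (- \int[mu]_x (g x * phi (x + h *: e_ i))).
Proof.
move=> Iu [Ig wg] tp; have := is_derive_integral_translate i h Iu tp.
rewrite -wg; last exact: test_function_translate.
suff -> : \int[mu]_x (u x * partial i phi (x + h *: e_ i)) =
    \int[mu]_x (u x * partial i (fun y => phi (y + h *: e_ i)) x) by [].
by apply: eq_Rintegral => x _; rewrite partial_translate//; case: tp.
Qed.

Lemma integral_mul_translate u phi b : rV_locally_integrable u -> test_function phi ->
  \int[mu]_x (u x * phi (x + b)) = \int[mu]_x (u (x - b) * phi x).
Proof.
move=> Iu tp; have := @Rintegral_translate R n (fun x => u x * phi (x + b)) (- b).
by under eq_Rintegral do rewrite subrK; move=> <-//; apply: integrable_test_mul => //;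
  exact: test_function_translate.
Qed.

(** Tested against phi, the left side becomes A(0) - A(h) and the right side the integral of B = -A'
    over [0, h]. The fundamental theorem of calculus makes them equal, and phi is arbitrary. *)
Lemma weak_partial_difference i u g h : continuous u -> is_weak_partial i u g ->
  0 < h -> {ae mu, forall x, u x - u (x - h *: e_ i) = segment_integral g i h x}.
Proof.
move=> cu wg h0; have Iu := continuous_locally_integrable cu; have [Ig _] := wg.
have Iub := rV_locally_integrable_translate (- (h *: e_ i)) Iu.
have Is := rV_locally_integrable_segment i Ig h0.
have : rV_locally_integrable (fun x => (u x + -1 * u (x - h *: e_ i)) + -1 * segment_integral g i h x).
  have I1 := rV_locally_integrableD Iu (rV_locally_integrableZ (-1) Iub).
  exact: (rV_locally_integrableD I1 (rV_locally_integrableZ (-1) Is)).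
move=> /rV_locally_integrable_eq0 key.
have {key} : {ae mu, forall x, (u x + -1 * u (x - h *: e_ i)) + -1 * segment_integral g i h x = 0}.
  apply: key => phi tp.
  have Iup := integrable_test_mul Iu tp; have Iubp := integrable_test_mul Iub tp.
  have Isp := integrable_test_mul Is tp.
  under eq_Rintegral do rewrite !mulrDl !mulN1r !mulNr.
  rewrite RintegralB//; last first.
    exact: (integrableB measurableT Iup Iubp).
  rewrite RintegralB//.
  have /test_functionP[_ [N N0 hN]] := tp.
  have cp := test_function_continuous tp.
  have [M M0 hM] := bounded_support_bounded cp hN.
  rewrite (segment_integral_fubini i Ig h0 (continuous_measurable_rV cp) hM hN).
  pose A (s : R) := \int[mu]_x (u x * phi (x + s *: e_ i)).
  pose B (s : R) := \int[mu]_x (g x * phi (x + s *: e_ i)).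
  have dA (s : R) : is_derive s 1 A (- B s) by exact: is_derive_weak_translate.
  have cA : continuous A.
    by move=> s; apply/differentiable_continuous/derivable1_diffP; case: (dA s).
  have cB : continuous B.
    move=> s; apply/differentiable_continuous/derivable1_diffP.
    by case: (is_derive_integral_translate i s Ig tp).
  have ftc : (\int[nu]_(t in `[0%R, h]) (B t)%:E = (- A h)%R%:E - (- A 0)%R%:E)%E.
    have dNA (s : R) : is_derive s 1 (fun s => - A s) (B s).
      by rewrite -[B s]opprK; exact: is_deriveN.
    have cNA : continuous (fun s => - A s) by move=> s; apply: continuousN; exact: cA.
    apply: (@continuous_FTC2 _ B (fun s => - A s)) => //.
    - exact: continuous_subspaceT.
    - split.
      + by move=> s _; case: (dNA s).
      + by apply: cvg_at_right_filter; exact: cNA.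
      + by apply: cvg_at_left_filter; exact: cNA.
    - by move=> s _; rewrite derive1E; case: (dNA s).
  have -> : \int[mu]_x (u x * phi x) = A 0.
    by apply: eq_Rintegral => x _; rewrite scale0r addr0.
  have -> : \int[mu]_x (u (x - h *: e_ i) * phi x) = A h.
    by rewrite -integral_mul_translate.
  have -> : \int[nu]_(t in `[0, h]) (\int[mu]_x (g (x - t *: e_ i) * phi x)) =
      \int[nu]_(t in `[0, h]) B t.
    by apply: eq_Rintegral => t _; rewrite -integral_mul_translate.
  rewrite [X in _ - X]/Rintegral ftc /=; ring.
apply: filterS => x; rewrite !mulN1r => /eqP; rewrite subr_eq0 => /eqP.
exact.
Qed.

Lemma near0_uniform u N i (eps : R) : continuous u -> 0 < eps ->
  exists2 d : R, 0 < d & forall h x, 0 < h < d -> `|x| <= N ->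
    `|u x - u (x - h *: e_ i)| <= eps.
Proof.
move=> cu eps0.
have /compact_near_coveringP/(_ R (nbhs (0 : R))
  (fun h x => `|u x - u (x - h *: e_ i)| <= eps) _) := @compact_cube R n N.
have pt x : cube N x -> \forall x' \near x & h \near (0 : R),
    `|u x' - u (x' - h *: e_ i)| <= eps.
  move=> _; have /cvgrPdist_lt/(_ (eps / 2)) := cu x.
  rewrite divr_gt0// => /(_ isT)/nbhs_ballP[d /= d0 hd].
  exists (ball x (d / 2), ball (0 : R) (d / 2)) => /=.
    by split; apply: nbhsx_ballx; rewrite divr_gt0.
  move=> [y h] /= [xy]; rewrite /ball/= sub0r normrN => hh.
  have xy' : `|x - y| < d / 2 by move: xy; rewrite mx_norm_ball.
  have h1 : `|u x - u y| < eps / 2.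
    by apply: hd; rewrite mx_norm_ball /ball_/=; lra.
  have h2 : `|u x - u (y - h *: e_ i)| < eps / 2.
    apply: hd; rewrite mx_norm_ball /ball_/= opprB addrCA addrC.
    apply: le_lt_trans (ler_normD _ _) _; rewrite normrZ norm_delta mulr1; lra.
  have := ler_normD (u y - u x) (u x - u (y - h *: e_ i)).
  rewrite [`|u y - u x|]distrC (_ : u y - u x + _ = u y - u (y - h *: e_ i)); first lra.
  by ring.
move=> /(_ pt)/nbhs_ballP[d /= d0 hd]; exists d => // h x /andP[h0 hd'] xN.
by apply: (hd h) => //; rewrite /ball/= sub0r normrN gtr0_norm.
Qed.

End weak_difference.

(** * First-order expansion of F(u) and the chain rule *)

Section chain_rule.
Context {R : realType} {n : nat}.
Local Notation E := 'rV[R]_n.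
Local Notation mu := (rV_lebesgue R n).
Local Notation nu := (@lebesgue_measure R).
Implicit Types (u g phi psi : E -> R) (x a b : E) (N M t h : R) (i : 'I_n).
Local Notation e_ i := (delta_mx ord0 i : E).

Lemma continuous_translate u b : continuous u -> continuous (fun x => u (x + b)).
Proof.
move=> cu x; have c : continuous (fun y : E => y + b).
  move=> y; apply: (@continuousD _ _ _ (fun y : E => y) (fun=> b)).
    exact: cvg_id.
  exact: cst_continuous.
exact: (continuous_comp (c x) (cu (x + b))).
Qed.

(** Holds when F' = f is Lipschitz with constant 2 L. Together with the continuity of f, this is the
    form in which the regularity of F enters the chain rule. *)
Definition quadratic_remainder (F f : R -> R) (L : R) :=
  forall s t : R, `|F t - F s - f s * (t - s)| <= L * (t - s) ^+ 2.

Lemma quadratic_remainder_continuous (F f : R -> R) (L : R) :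
  quadratic_remainder F f L -> continuous F.
Proof.
move=> FL a; apply/cvgrPdist_lt => e e0.
have L0 : 0 <= L.
  by have := FL 0 1; rewrite subr0 expr1n !mulr1; exact: le_trans (normr_ge0 _).
have K0 : 0 < `|f a| + L + 1 by rewrite ltr_wpDl// addr_ge0.
near=> b.
have ba1 : `|b - a| < 1.
  rewrite distrC; near: b; exists 1 => //=.
have bae : `|b - a| < e / (`|f a| + L + 1).
  by rewrite distrC; near: b; exists (e / (`|f a| + L + 1)) => //=; rewrite divr_gt0.
rewrite distrC; have := ler_normD (F b - F a - f a * (b - a)) (f a * (b - a)).
rewrite subrK => /le_lt_trans; apply.
move: bae; rewrite ltr_pdivlMr// => bae; apply: le_lt_trans bae.
have := FL a b; rewrite -[(b - a) ^+ 2]real_normK ?num_real// normrM.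
have : L * `|b - a| ^+ 2 <= L * `|b - a|.
  by rewrite ler_wpM2l// expr2 ler_piMl// ltW.
by have := normr_ge0 (b - a); rewrite !mulrDr mulr1 [`|b - a| * _]mulrC [`|b - a| * L]mulrC; lra.
Unshelve. all: by end_near. Qed.

(** The L^1 norm of an increment is O(h). Giving |phi| the sign of the increment, as [sg] does,
    removes the absolute value, so the increment can be replaced by a segment integral and Fubini's
    theorem applies. *)
Lemma integral_difference_le i u g phi N M h : continuous u -> is_weak_partial i u g ->
  measurable_fun setT phi -> (forall x, `|phi x| <= M) ->
  (forall x, phi x != 0 -> `|x| <= N) -> 0 < h <= 1 ->
  \int[mu]_x (`|u x - u (x - h *: e_ i)| * `|phi x|) <=
  h * \int[mu]_x (`|(g \_ (cube (N + 1))) x| * M).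
Proof.
move=> cu wg mphi Mphi Nphi /andP[h0 h1]; have [Ig _] := wg.
have cD : continuous (fun x => u x - u (x - h *: e_ i)).
  move=> x; apply: continuousB; first exact: cu.
  exact: continuous_translate.
have mD := continuous_measurable_rV cD.
pose sg x := if 0 <= u x - u (x - h *: e_ i) then `|phi x| else - `|phi x|.
have msg : measurable_fun setT sg.
  apply: measurable_fun_ifT => //.
  - exact: measurable_fun_ler.
  - exact: measurableT_comp.
  - by apply: measurableT_comp => //; exact: measurableT_comp.
have Msg x : `|sg x| <= M by rewrite /sg; case: ifP => _; rewrite ?normrN normr_id.
have Nsg x : sg x != 0 -> `|x| <= N.
  by rewrite /sg; case: ifP => _; rewrite ?oppr_eq0 normr_eq0; exact: Nphi.
have -> : \int[mu]_x (`|u x - u (x - h *: e_ i)| * `|phi x|) =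
    \int[mu]_x (segment_integral g i h x * sg x).
  have [ms _] := rV_locally_integrable_segment i Ig h0.
  rewrite /Rintegral; congr fine; apply: ae_eq_integral => //.
  - apply/measurable_EFinP; apply: measurable_funM; exact: measurableT_comp.
  - by apply/measurable_EFinP; exact: measurable_funM.
  - have := weak_partial_difference cu wg h0; apply: filterS => x <- _.
    rewrite /sg; case: leP => D0; first by rewrite (ger0_norm D0).
    by rewrite (ltr0_norm D0) mulrN mulNr.
rewrite (segment_integral_fubini i Ig h0 msg Msg Nsg).
set C := \int[mu]_x _.
have bC t : 0 <= t <= h -> \int[mu]_x (g (x - t *: e_ i) * sg x) <= C.
  move=> /andP[t0 th].
  have t1 : 0 <= t <= 1 by rewrite t0 (le_trans th).
  (* Applied with length 1 instead of h, so that the constant is the same for all h <= 1. *)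
  have := @kernel_slice_le R n g i 1 Ig sg N M msg Msg Nsg t t1.
  rewrite -/C => key.
  have It : mu.-integrable setT (EFin \o (fun x => g (x - t *: e_ i) * sg x)).
    apply/integrableP; split; last by apply: le_lt_trans key _; rewrite ltry.
    have [mg _] := Ig; apply/measurable_EFinP; apply: measurable_funM => //.
    by apply: (measurableT_comp mg); exact: measurable_translate.
  apply: le_trans (ler_norm _) _.
  apply: le_trans (le_normr_Rintegral _ It) _ => //.
  by rewrite -lee_fin; apply: le_trans key; rewrite /Rintegral fineK//;
    apply: integrable_fin_num => //; exact: integrable_norm.
apply: (@le_trans _ _ (\int[nu]_(t in `[0, h]) C)).
  apply: le_Rintegral => //.
  - exact: (integrable_slice i Ig h0 msg Msg Nsg).
  - apply: continuous_compact_integrable; first exact: segment_compact.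
    by apply: continuous_subspaceT; exact: cst_continuous.
rewrite Rintegral_cst//= lebesgue_measure_itv/= lte_fin h0/= subr0.
by rewrite mulrC.
Qed.

(** X is the right derivative of A at 0, and -J is the first-order part of the increment of A. Only
    h > 0 occurs, the range that [segment_integral] describes. *)
Lemma difference_quotient_limit (X Y A0 : R) (A J : R -> R) :
  (forall e, 0 < e -> exists2 d : R, 0 < d & forall h, 0 < h < d ->
     `|X - h^-1 * (A h - A0)| <= e) ->
  (forall e, 0 < e -> exists2 d : R, 0 < d & forall h, 0 < h < d ->
     `|A h - A0 + J h| <= e * h) ->
  (forall e, 0 < e -> exists2 d : R, 0 < d & forall h, 0 < h < d ->
     `|J h - h * Y| <= h * e) ->
  X = - Y.
Proof.
move=> H1 H2 H3; apply/eqP; rewrite -subr_eq0 opprK -normr_le0.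
apply/ler_addgt0Pl => e e0; rewrite addr0.
have e3 : 0 < e / 3 by rewrite divr_gt0.
have [d1 d10 {}H1] := H1 _ e3; have [d2 d20 {}H2] := H2 _ e3; have [d3 d30 {}H3] := H3 _ e3.
pose m := Num.min d1 (Num.min d2 d3).
have m0 : 0 < m by rewrite !lt_min d10 d20 d30.
pose h := m / 2.
have h0 : 0 < h by rewrite divr_gt0.
have : h < m by rewrite ltr_pdivrMr// ltr_pMr// ltr1n.
rewrite !lt_min => /and3P[h1 h2 h3].
have := H1 h; have := H2 h; have := H3 h; rewrite h0 h1 h2 h3.
move=> /(_ isT) k3 /(_ isT) k2 /(_ isT) k1; set dA := A h - A0 in k1 k2.
have {}k2 : `|h^-1 * dA + h^-1 * J h| <= e / 3.
  by rewrite -mulrDr normrM gtr0_norm ?invr_gt0// mulrC ler_pdivrMr.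
have {}k3 : `|h^-1 * J h - Y| <= e / 3.
  have -> : h^-1 * J h - Y = h^-1 * (J h - h * Y) by field; rewrite gt_eqF.
  by rewrite normrM gtr0_norm ?invr_gt0// mulrC ler_pdivrMr// [e / 3 * _]mulrC.
have -> : X + Y = (X - h^-1 * dA) + (h^-1 * dA + h^-1 * J h) - (h^-1 * J h - Y) by ring.
apply: le_trans (ler_normB _ _) _.
have := ler_normD (X - h^-1 * dA) (h^-1 * dA + h^-1 * J h).
move: k1 k2 k3; lra.
Qed.

Lemma average_cvg (b : R -> R) (eps : R) : {for 0, continuous b} -> 0 < eps ->
  exists2 d : R, 0 < d & forall h, 0 < h < d ->
    nu.-integrable `[0, h] (EFin \o b) ->
    `|\int[nu]_(t in `[0, h]) b t - h * b 0| <= h * eps.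
Proof.
move=> /cvgrPdist_le cb eps0; have [d /= d0 hd] := cb _ eps0.
exists d => // h /andP[h0 hdd] Ib.
have Ic (c : R) : nu.-integrable `[0, h] (EFin \o (fun=> c)).
  apply: continuous_compact_integrable; first exact: segment_compact.
  by apply: continuous_subspaceT; exact: cst_continuous.
have ic (c : R) : \int[nu]_(t in `[0, h]) c = h * c.
  by rewrite Rintegral_cst//= lebesgue_measure_itv/= lte_fin h0/= subr0 mulrC.
rewrite -ic -RintegralB//.
have Id : nu.-integrable `[0, h] (EFin \o (fun t => b t - b 0)).
  exact: (integrableB _ Ib (Ic (b 0))).
apply: le_trans (le_normr_Rintegral _ Id) _ => //.
rewrite -ic; apply: le_Rintegral => //; first exact: integrable_norm.
move=> t; rewrite /= in_itv/= => /andP[t0 th]; rewrite distrC; apply: hd => /=.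
by rewrite sub0r normrN ger0_norm// (le_lt_trans th).
Qed.

(** Moving the translation onto psi makes the integrand continuous in t for each x, and for |t| < 1
    it is dominated by M |g| on the cube of radius N + 1. *)
Lemma continuous_slice i g psi N M : rV_locally_integrable g -> continuous psi ->
  (forall x, `|psi x| <= M) -> (forall x, psi x != 0 -> `|x| <= N) ->
  {for 0, continuous (fun t => \int[mu]_x (g (x - t *: e_ i) * psi x))}.
Proof.
move=> Ig cpsi Mpsi Npsi; have [mg _] := Ig.
have M0 : 0 <= M by exact: le_trans (Mpsi 0).
have Ibd t : rV_locally_integrable (fun x => g x * psi (x + t *: e_ i)).
  apply: rV_locally_integrable_continuous_mul => //.
  exact: continuous_translate.
have It t : mu.-integrable setT (EFin \o (fun x => g x * psi (x + t *: e_ i))).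
  apply: (@bounded_support_locally_integrable _ _ _ (N + `|t|)) => // x.
  rewrite mulf_eq0 negb_or => /andP[_ /Npsi].
  have := ler_normB (x + t *: e_ i) (t *: e_ i).
  by rewrite addrK normrZ norm_delta mulr1; lra.
have -> : (fun t => \int[mu]_x (g (x - t *: e_ i) * psi x)) =
    (fun t => \int[mu]_x (g x * psi (x + t *: e_ i))).
  apply/funext => t; rewrite -(Rintegral_translate (- (t *: e_ i)) (It t)).
  by under [RHS]eq_Rintegral do rewrite subrK.
pose G x := `|(g \_ (cube (N + 1))) x| * M.
have := @continuity_under_integral R _ _ mu (fun t x => g x * psi (x + t *: e_ i))
  setT measurableT (-1) 1 (fun t _ => It t) _ G _ _.
move=> key; apply: key.
- apply: aeW => x _ t _; apply: continuousM; first exact: cst_continuous.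
  apply: (@continuous_comp _ _ _ (fun t : R => x + t *: e_ i) psi); last exact: cpsi.
  apply: (@continuousD _ _ _ (fun=> x) (fun t : R => t *: e_ i)).
    exact: cst_continuous.
  exact: scalel_continuous.
- have /rV_locally_integrable_cube[_ /(_ (N + 1))] := Ig.
  move=> /(integrable_mkcond _ (@measurable_cube R n (N + 1))).1.
  move=> /integrable_abse/(integrableZl measurableT M); congr (_.-integrable _ _).
  apply/funext => x; rewrite /G /= !patchE; case: ifP => _.
    by rewrite -EFinM mulrC.
  by rewrite abse0 mule0 normr0 mul0r.
- move=> t; rewrite /= in_itv/= => /andP[t1 t2]; apply: aeW => x _.
  rewrite /G patchE normrM.
  have [->|/Npsi hp] := eqVneq (psi (x + t *: e_ i)) 0.
    by rewrite normr0 mulr0 mulr_ge0.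
  rewrite mem_set ?ler_wpM2l//.
  rewrite /cube/=; have := ler_normB (x + t *: e_ i) (t *: e_ i).
  rewrite addrK normrZ norm_delta mulr1.
  have : `|t| <= 1 by rewrite ler_norml !ltW.
  by lra.
- by rewrite inE/= in_itv/= ltrN10 ltr01.
Qed.

(** The Taylor remainder is bounded by L times the product of two increments of u. One is uniformly
    small on the support of phi because u is continuous; the other has L^1 norm O(h) by
    [integral_difference_le]. So the remainder is o(h) although g is merely locally integrable. *)
Lemma weak_partial_comp i u g (F f : R -> R) (L : R) : continuous u ->
  is_weak_partial i u g -> continuous f -> quadratic_remainder F f L ->
  is_weak_partial i (fun x => F (u x)) (fun x => f (u x) * g x).
Proof.
move=> cu wg cf FL; have [Ig _] := wg.
have cF := quadratic_remainder_continuous FL.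
have cFu : continuous (fun x => F (u x)).
  by move=> x; apply: continuous_comp; [exact: cu|exact: cF].
have cfu : continuous (fun x => f (u x)).
  by move=> x; apply: continuous_comp; [exact: cu|exact: cf].
have Ifg : rV_locally_integrable (fun x => f (u x) * g x).
  under eq_fun do rewrite mulrC; exact: rV_locally_integrable_continuous_mul.
split => // phi tp.
have L0 : 0 <= L.
  by have := FL 0 1; rewrite subr0 expr1n !mulr1; exact: le_trans (normr_ge0 _).
have cp := test_function_continuous tp.
have /test_functionP[sp [N N0 hN]] := tp.
have [M M0 hM] := bounded_support_bounded cp hN.
pose psi x := f (u x) * phi x.
have cpsi : continuous psi.
  by move=> x; apply: continuousM; [exact: cfu|exact: cp].
have hNpsi x : psi x != 0 -> `|x| <= N.
  by rewrite mulf_eq0 negb_or => /andP[_]; exact: hN.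
have [M' M'0 hM'] := bounded_support_bounded cpsi hNpsi.
pose b t := \int[mu]_x (g (x - t *: e_ i) * psi x).
have cb : {for 0, continuous b} by exact: continuous_slice hM' hNpsi.
have -> : \int[mu]_x (f (u x) * g x * phi x) = b 0.
  by apply: eq_Rintegral => x _; rewrite scale0r subr0 /psi; ring.
set C := \int[mu]_x (`|(g \_ (cube (N + 1))) x| * M).
have C0 : 0 <= C by apply: Rintegral_ge0 => x _; rewrite mulr_ge0// ltW.
set X := \int[mu]_x _.
have IFu := continuous_locally_integrable cFu.
(* The increments of F(u), tested against phi, are linear up to o(h). *)
have err h w : 0 < h <= 1 -> (forall x, `|x| <= N -> `|u x - u (x - h *: e_ i)| <= w) ->
    0 <= w ->
    `|\int[mu]_x (F (u x) * phi (x + h *: e_ i)) - \int[mu]_x (F (u x) * phi x)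
      + \int[nu]_(t in `[0, h]) b t| <= L * w * (h * C).
  move=> h01 hw w0; have /andP[h0 h1] := h01.
  pose D x := u x - u (x - h *: e_ i).
  have cD : continuous D.
    by move=> x; apply: continuousB; [exact: cu|exact: continuous_translate].
  have ID : mu.-integrable setT (EFin \o (fun x => D x * psi x)).
    apply: (@bounded_support_locally_integrable _ _ _ N).
      apply: rV_locally_integrable_continuous_mul => //.
      exact: continuous_locally_integrable.
    by move=> x; rewrite mulf_eq0 negb_or => /andP[_]; exact: hNpsi.
  have eD : \int[nu]_(t in `[0, h]) b t = \int[mu]_x (D x * psi x).
    rewrite -(segment_integral_fubini i Ig h0 (continuous_measurable_rV cpsi) hM' hNpsi).
    have [ms _] := rV_locally_integrable_segment i Ig h0.
    rewrite /Rintegral; congr fine; apply: ae_eq_integral => //.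
    - apply/measurable_EFinP; apply: measurable_funM => //.
      exact: continuous_measurable_rV.
    - by case/integrableP: ID.
    - by have := weak_partial_difference cu wg h0; apply: filterS => x <- _.
  have cFub := @continuous_translate (fun x => F (u x)) (- (h *: e_ i)) cFu.
  have IFub := continuous_locally_integrable cFub.
  have I1 := integrable_test_mul IFub tp.
  have I2 := integrable_test_mul IFu tp.
  rewrite integral_mul_translate// eD -RintegralB// -RintegralD//; last first.
    exact: (integrableB _ I1 I2).
  have Itot := integrableD measurableT (integrableB measurableT I1 I2) ID.
  apply: le_trans (le_normr_Rintegral _ Itot) _ => //.
  have cDp : continuous (fun x => `|D x| * `|phi x|).
    have cn (k : E -> R) : continuous k -> continuous (fun x => `|k x|).
      by move=> ck x; apply: continuous_comp; [exact: ck|exact: norm_continuous].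
    move=> x; apply: (@continuousM _ _ (fun x => `|D x|) (fun x => `|phi x|)); exact: cn.
  have IDp : mu.-integrable setT (EFin \o (fun x => `|D x| * `|phi x|)).
    apply: (@bounded_support_locally_integrable _ _ _ N).
      exact: continuous_locally_integrable.
    by move=> x; rewrite mulf_eq0 negb_or !normr_eq0 => /andP[_]; exact: hN.
  apply: (@le_trans _ _ (\int[mu]_x ((L * w) * (`|D x| * `|phi x|)))); last first.
    rewrite RintegralZl// ler_wpM2l ?mulr_ge0//.
    exact: integral_difference_le (continuous_measurable_rV cp) hM hN h01.
  apply: le_Rintegral => //.
  - exact: (integrable_norm Itot).
  - exact: (integrableZl measurableT (L * w) IDp).
  move=> x _; set s := u x; set t := u (x - h *: e_ i).
  have [p0|p0] := eqVneq (phi x) 0.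
    by rewrite /psi p0 !mulr0 subrr addr0 normr0 !mulr0.
  have -> : F t * phi x - F s * phi x + D x * psi x = (F t - F s - f s * (t - s)) * phi x.
    by rewrite /psi /D -/s -/t; ring.
  rewrite normrM mulrA ler_wpM2r//; apply: le_trans (FL s t) _.
  rewrite -mulrA ler_wpM2l// -[_ ^+ 2]real_normK ?num_real// expr2 distrC.
  by rewrite ler_wpM2r//; exact: hw (hN _ p0).
apply: (@difference_quotient_limit X (b 0) (\int[mu]_x (F (u x) * phi x))
  (fun h => \int[mu]_x (F (u x) * phi (x + h *: e_ i)))
  (fun h => \int[nu]_(t in `[0, h]) b t)) => e e0.
- have := is_derive_integral_translate i 0 IFu tp.
  have -> : \int[mu]_x (F (u x) * partial i phi (x + 0 *: delta_mx ord0 i)) = X.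
    by apply: eq_Rintegral => x _; rewrite scale0r addr0.
  move=> [dA valA]; move: dA; rewrite /derivable => /cvgrPdist_lt/(_ _ e0).
  move: valA; rewrite /derive => -> [d /= d0 hd]; exists d => // h /andP[h0 hdd].
  have := hd h; rewrite /= sub0r normrN gtr0_norm// => /(_ hdd (lt0r_neq0 h0)).
  rewrite /shift/= addr0 [h *: 1]mulr1.
  have -> : \int[mu]_x (F (u x) * phi (x + 0 *: delta_mx ord0 i)) =
      \int[mu]_x (F (u x) * phi x) by apply: eq_Rintegral => x _; rewrite scale0r addr0.
  exact: ltW.
- have LC0 : 0 < L * C + 1 by apply: ltr_wpDl => //; exact: mulr_ge0.
  (* With increments bounded by this w, the error [L * w * (h * C)] is at most [e * h]; the summand
     1 keeps the denominator positive if L or C is 0. *)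
  have w0 : 0 < e / (L * C + 1) by exact: divr_gt0.
  have [d d0 hd] := near0_uniform N i cu w0.
  exists (Num.min d 1); first by rewrite lt_min d0 ltr01.
  move=> h; rewrite lt_min => /andP[h0 /andP[hdd h1]].
  have h01 : 0 < h <= 1 by rewrite h0 ltW.
  have h0d : 0 < h < d by rewrite h0 hdd.
  apply: le_trans (err h _ h01 (fun x => hd h x h0d) (ltW w0)) _.
  have -> : L * (e / (L * C + 1)) * (h * C) = (e * h) * (L * C / (L * C + 1)).
    by field; rewrite gt_eqF.
  apply: ler_piMr; first by apply: mulr_ge0; exact: ltW.
  by rewrite ler_pdivrMr// mul1r lerDl ler01.
- have [d d0 hd] := average_cvg cb e0; exists d => // h hh; apply: hd => //.
  have /andP[h0 _] := hh.
  exact: (integrable_slice i Ig h0 (continuous_measurable_rV cpsi) hM' hNpsi).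
Qed.

End chain_rule.

(** * Weak gradients and energy *)

Lemma powR_mono (R : realType) (p a b : R) : 0 <= p -> 0 <= a -> a <= b ->
  a `^ p <= b `^ p.
Proof.
move=> p0 a0 ab; apply: ge0_ler_powR => //; rewrite nnegrE//.
exact: le_trans ab.
Qed.

Section energy.
Context {R : realType} {n : nat}.
Local Notation E := 'rV[R]_n.
Local Notation mu := (rV_lebesgue R n).
Implicit Types (u v g phi psi chi : E -> R) (G H : E -> E) (x y b : E) (p : R) (i : 'I_n).

Definition is_weak_grad u G := forall i, is_weak_partial i u (fun x => G x ord0 i).

Definition energy p u : R := \int[mu]_x (enorm (weak_grad u x) `^ p).

Definition finite_energy p G := mu.-integrable setT (EFin \o (fun x => enorm (G x) `^ p)).

Lemma weak_grad_is u G : is_weak_grad u G -> is_weak_grad u (weak_grad u).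
Proof.
move=> uG i; rewrite (_ : (fun x => _) = xget (cst 0) [set g | is_weak_partial i u g]).
  by apply: xgetPex; exists (fun x => G x ord0 i); exact: uG.
by apply/funext => x; rewrite mxE.
Qed.

Lemma weak_grad_unique u G H : is_weak_grad u G -> is_weak_grad u H ->
  {ae mu, forall x, G x = H x}.
Proof.
move=> uG uH.
have : {ae mu, forall x, forall i, G x ord0 i = H x ord0 i}.
  by apply: filter_forall => i; exact: weak_partial_unique (uG i) (uH i).
by apply: filterS => x h; apply/rowP.
Qed.

Lemma measurable_weak_grad u G : is_weak_grad u G -> measurable_fun setT G.
Proof. by move=> uG; apply: measurable_fun_rVP => i; have [[]] := uG i. Qed.

Lemma measurable_enorm_powR d (T : measurableType d) (F : T -> E) p :
  measurable_fun setT F -> measurable_fun setT (fun t => enorm (F t) `^ p).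
Proof.
move=> mF; apply: (measurableT_comp (measurable_powR p)).
apply: (measurableT_comp (f := @enorm R n)) => //.
by apply: continuous_measurable_rV; exact: continuous_enorm.
Qed.

Lemma finite_energy_ae p G H : measurable_fun setT G -> measurable_fun setT H ->
  {ae mu, forall x, G x = H x} -> finite_energy p G -> finite_energy p H.
Proof.
move=> mG mH GH /integrableP[_ Goo]; apply/integrableP; split.
  by apply/measurable_EFinP; exact: measurable_enorm_powR.
apply: le_lt_trans Goo; rewrite le_eqVlt; apply/orP; left; apply/eqP.
apply: ae_eq_integral => //.
- by apply/measurable_EFinP; apply: measurableT_comp => //; exact: measurable_enorm_powR.
- by apply/measurable_EFinP; apply: measurableT_comp => //; exact: measurable_enorm_powR.
- by move: GH; apply: filterS => x e _ /=; rewrite e.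
Qed.

(** [weak_grad] is an arbitrary choice within a class of functions equal almost everywhere, and the
    integral sees only the class. *)
Lemma energyE p u G : is_weak_grad u G ->
  energy p u = \int[mu]_x (enorm (G x) `^ p).
Proof.
move=> uG; have uW := weak_grad_is uG.
have mW := measurable_weak_grad uW; have mG := measurable_weak_grad uG.
rewrite /energy /Rintegral; apply: (congr1 fine); apply: ae_eq_integral.
- exact: measurableT.
- by apply/measurable_EFinP; exact: measurable_enorm_powR.
- by apply/measurable_EFinP; exact: measurable_enorm_powR.
- by have := weak_grad_unique uW uG; apply: filterS => x -> _.
Qed.

Lemma finite_energy_weak_grad p u G : is_weak_grad u G -> finite_energy p G ->
  finite_energy p (weak_grad u).
Proof.
move=> uG; have uW := weak_grad_is uG; apply: finite_energy_ae.
- exact: measurable_weak_grad uG.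
- exact: measurable_weak_grad uW.
- exact: weak_grad_unique.
Qed.

Lemma enorm_le_norm x : enorm x <= n%:R * `|x|.
Proof.
apply: le_trans (enorm_le_sum x) _; rewrite mulr_natl -[X in _ *+ X]card_ord -sumr_const.
by apply: ler_sum => i _; exact: coord_le_norm.
Qed.

(** The factor n^p is crude; only integrability and boundedness are drawn from it, never a constant
    of the theorem. *)
Lemma enorm_powR_le p x : 0 < p ->
  enorm x `^ p <= n%:R `^ p * \sum_i `|x ord0 i| `^ p.
Proof.
move=> p0; apply: (@le_trans _ _ ((n%:R * `|x|) `^ p)).
  by apply: powR_mono; [exact: ltW|exact: enorm_ge0|exact: enorm_le_norm].
rewrite powRM// ler_wpM2l ?powR_ge0//.
have [->|x0] := eqVneq `|x| 0.
  by rewrite powR0 ?gt_eqF// sumr_ge0// => i _; exact: powR_ge0.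
have [[k j] /= e] := mx_norm_neq0 x0.
have -> : `|x| = `|x ord0 j| by rewrite [LHS]e (ord1 k).
by rewrite (bigD1 j)//= lerDl sumr_ge0// => i _; exact: powR_ge0.
Qed.

Lemma integrable_Lfun p g : 1 <= p -> measurable_fun setT g ->
  mu.-integrable setT (fun x => (`|g x| `^ p)%:E) -> g \in Lfun mu p%:E.
Proof.
move=> p1 mg /integrableP[_]; have p0 : 0 < p by exact: lt_le_trans p1.
under eq_integral => x _ do rewrite gee0_abs ?lee_fin ?powR_ge0//.
move=> goo; rewrite inE; apply/andP; split; first by rewrite inE.
rewrite inE /finite_norm unlock; apply: poweR_lty.
exact: goo.
Qed.

(** The p-th power of the Euclidean norm is dominated by a multiple of the sum over the coordinates,
    and dominates each of them. Local integrability of u follows from continuity. *)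
Lemma D1pP p u : 1 <= p -> D1p p u <->
  continuous u /\ exists G, is_weak_grad u G /\ finite_energy p G.
Proof.
move=> p1; have p0 : 0 < p by exact: lt_le_trans p1.
split=> [[Iu Hg cu]|[cu [G [uG fG]]]].
  split => //; have /choice[g hg] : forall i, exists g, is_weak_partial i u g /\ g \in Lfun mu p%:E.
    by move=> i; have [g ? ?] := Hg i; exists g.
  pose G x := \row_i g i x.
  have uG : is_weak_grad u G.
    move=> i; rewrite (_ : (fun x => _) = g i); first by have [] := hg i.
    by apply/funext => x; rewrite mxE.
  exists G; split => //.
  have mG := measurable_weak_grad uG.
  have Ig i : mu.-integrable setT (fun x => (`|g i x| `^ p)%:E).
    by apply: Lfun_integrable => //; have [] := hg i.
  have Is := integrable_sum measurableT (index_enum 'I_n) (fun i _ => Ig i).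
  apply: le_integrable (integrableZl measurableT (n%:R `^ p) (Is predT)) => //.
    by apply/measurable_EFinP; exact: measurable_enorm_powR.
  move=> x _ /=; rewrite sumEFin -EFinM !abse_EFin lee_fin.
  rewrite (ger0_norm (powR_ge0 _ _)); apply: le_trans (ler_norm _).
  by have := enorm_powR_le (G x) p0; under [X in _ * X]eq_bigr do rewrite mxE.
split=> //; first exact: continuous_locally_integrable.
move=> i; exists (fun x => G x ord0 i); first exact: uG.
have mGi : measurable_fun setT (fun x => G x ord0 i) by have [[]] := uG i.
apply: integrable_Lfun => //; apply: le_integrable fG => //.
  apply/measurable_EFinP; apply: (measurableT_comp (measurable_powR p)).
  exact: measurableT_comp.
move=> x _ /=; rewrite lee_fin !(ger0_norm (powR_ge0 _ _)).
by apply: powR_mono => //; [exact: ltW|exact: coord_le_enorm].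
Qed.

(** The integral of phi(x + s e_i) does not depend on s; differentiate it at s = 0. *)
Lemma integral_partial_eq0 i phi : test_function phi -> \int[mu]_x partial i phi x = 0.
Proof.
move=> tp; have c1 : continuous (fun _ : E => 1 : R) by exact: cst_continuous.
have I1 := continuous_locally_integrable c1.
have Ip : mu.-integrable setT (EFin \o phi).
  have := integrable_test_mul I1 tp; congr (_.-integrable _ _).
  by apply/funext => x /=; rewrite mul1r.
have := is_derive_integral_translate i 0 I1 tp.
have -> : (fun s : R => \int[mu]_x (1 * phi (x + s *: delta_mx ord0 i))) =
    cst (\int[mu]_x phi x).
  apply/funext => s; rewrite /cst -(Rintegral_translate (s *: delta_mx ord0 i) Ip).
  by under eq_Rintegral do rewrite mul1r.
have -> : \int[mu]_x (1 * partial i phi (x + 0 *: delta_mx ord0 i)) = \int[mu]_x partial i phi x.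
  by apply: eq_Rintegral => x _; rewrite mul1r scale0r addr0.
by move=> [_ <-]; rewrite derive_cst.
Qed.

Lemma weak_partialD i u v g h : rV_locally_integrable u -> rV_locally_integrable v ->
  is_weak_partial i u g -> is_weak_partial i v h ->
  is_weak_partial i (fun x => u x + v x) (fun x => g x + h x).
Proof.
move=> Iu Iv [Ig wg] [Ih wh]; split; first exact: rV_locally_integrableD.
move=> phi tp; have tdp := test_function_partial i tp.
under eq_Rintegral do rewrite mulrDl.
under [in RHS]eq_Rintegral do rewrite mulrDl.
rewrite !RintegralD//; try exact: integrable_test_mul.
by rewrite wg// wh// opprD.
Qed.

Lemma weak_partialZ i (c : R) u g : rV_locally_integrable u ->
  is_weak_partial i u g -> is_weak_partial i (fun x => c * u x) (fun x => c * g x).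
Proof.
move=> Iu [Ig wg]; split; first exact: rV_locally_integrableZ.
move=> phi tp; have tdp := test_function_partial i tp.
under eq_Rintegral do rewrite -mulrA.
under [in RHS]eq_Rintegral do rewrite -mulrA.
rewrite !RintegralZl//; try exact: integrable_test_mul.
by rewrite wg// mulrN.
Qed.

Lemma weak_partial_cst i (c : R) : is_weak_partial i (fun _ : E => c) (fun _ => 0).
Proof.
split; first by apply: continuous_locally_integrable; exact: cst_continuous.
move=> phi tp; have tdp := test_function_partial i tp.
have c1 : continuous (fun _ : E => c) by exact: cst_continuous.
have Ic := continuous_locally_integrable c1.
have Ip : mu.-integrable setT (EFin \o partial i phi).
  have c0 : continuous (fun _ : E => 1 : R) by exact: cst_continuous.
  have := integrable_test_mul (continuous_locally_integrable c0) tdp; congr (_.-integrable _ _).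
  by apply/funext => x /=; rewrite mul1r.
rewrite RintegralZl// integral_partial_eq0// mulr0.
under eq_Rintegral do rewrite mul0r.
by rewrite /Rintegral integral0 oppr0.
Qed.

(** Integration by parts is [integral_partial_eq0] for the product of u and phi. *)
Lemma smooth_weak_partial i u : smooth u -> is_weak_partial i u (partial i u).
Proof.
move=> su; have cu : continuous u by have [] := su [::].
have cdu : continuous (partial i u) by have [] := su [:: i].
split; first exact: continuous_locally_integrable.
move=> phi tp; have tdp := test_function_partial i tp; have [sp _] := tp.
have I1 := integrable_test_mul (continuous_locally_integrable cu) tdp.
have I2 := integrable_test_mul (continuous_locally_integrable cdu) tp.
have := integral_partial_eq0 i (test_functionM su tp).
under eq_Rintegral do rewrite partialM//.
under eq_Rintegral do rewrite [phi _ * _]mulrC.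
by rewrite RintegralD// => /eqP; rewrite addr_eq0 => /eqP.
Qed.

(** The weak equation for u is tested against chi phi, and the product rule for chi phi produces the
    extra term. *)
Lemma weak_partialM i u g chi : rV_locally_integrable u -> is_weak_partial i u g ->
  smooth chi ->
  is_weak_partial i (fun x => u x * chi x) (fun x => g x * chi x + u x * partial i chi x).
Proof.
move=> Iu [Ig wg] sc; have cc : continuous chi by have [] := sc [::].
have cdc : continuous (partial i chi) by have [] := sc [:: i].
have I1 := rV_locally_integrable_continuous_mul Iu cc.
have I2 := rV_locally_integrable_continuous_mul Ig cc.
have I3 := rV_locally_integrable_continuous_mul Iu cdc.
split; first exact: rV_locally_integrableD.
move=> phi tp; have tdp := test_function_partial i tp; have [sp _] := tp.
have := wg _ (test_functionM sc tp).
have J1 := integrable_test_mul I1 tdp.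
have J2 := integrable_test_mul I2 tp.
have J3 := integrable_test_mul I3 tp.
have -> : \int[mu]_x (u x * partial i (fun y => chi y * phi y) x) =
    \int[mu]_x (u x * chi x * partial i phi x) + \int[mu]_x (u x * partial i chi x * phi x).
  rewrite -RintegralD//; apply: eq_Rintegral => x _.
  by rewrite partialM//; ring.
have -> : \int[mu]_x ((g x * chi x + u x * partial i chi x) * phi x) =
    \int[mu]_x (g x * chi x * phi x) + \int[mu]_x (u x * partial i chi x * phi x).
  by rewrite -RintegralD//; apply: eq_Rintegral => x _; rewrite mulrDl.
have -> : \int[mu]_x (g x * (chi x * phi x)) = \int[mu]_x (g x * chi x * phi x).
  by apply: eq_Rintegral => x _; rewrite mulrA.
by move=> h; rewrite opprD -h addrK.
Qed.

Lemma integrable_sumR (I : finType) (F : I -> E -> R) :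
  (forall j, mu.-integrable setT (EFin \o F j)) ->
  mu.-integrable setT (EFin \o (fun x => \sum_j F j x)).
Proof.
move=> IF; have := integrable_sum measurableT (index_enum I) (fun j _ => IF j) (P := predT).
by congr (_.-integrable _ _); apply/funext => x /=; rewrite sumEFin.
Qed.

Lemma Rintegral_sum (I : finType) (F : I -> E -> R) :
  (forall j, mu.-integrable setT (EFin \o F j)) ->
  \int[mu]_x (\sum_j F j x) = \sum_j \int[mu]_x F j x.
Proof.
move=> IF; have H (s : seq I) :
    mu.-integrable setT (EFin \o (fun x => \sum_(j <- s) F j x)) /\
    \int[mu]_x (\sum_(j <- s) F j x) = \sum_(j <- s) \int[mu]_x F j x.
  elim: s => [|j s [IH1 IH2]].
    rewrite big_nil; split; last first.
      by under eq_Rintegral do rewrite big_nil; rewrite /Rintegral integral0.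
    rewrite (_ : _ \o _ = cst 0%E); first exact: integrable0.
    by apply/funext => x /=; rewrite big_nil.
  rewrite big_cons -IH2; split; last first.
    by rewrite -RintegralD//; apply: eq_Rintegral => x _; rewrite big_cons.
  rewrite (_ : _ \o _ = ((EFin \o F j) \+ (EFin \o (fun x => (\sum_(j <- s) F j x)%R)))%E).
    exact: integrableD.
  by apply/funext => x /=; rewrite big_cons.
by have [] := H (index_enum I).
Qed.

Section similarity.
Variables (r : R) (Q : 'M[R]_n) (b : E).
Hypotheses (r0 : 0 < r) (QQ : Q *m Q^T = 1%:M).
Local Notation S := (similarity r Q b).
Local Notation SV := (similarity r^-1 Q^T (- (r^-1 *: (b *m Q^T)))).

Lemma similarity_affine x : S x = x *m (r *: Q) + b.
Proof. by rewrite /similarity -scalemxAr. Qed.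

Lemma similarityK : cancel S SV.
Proof.
move=> x; rewrite /similarity mulmxDl -scalemxAl -mulmxA QQ mulmx1 scalerDr scalerA.
by rewrite mulVf ?gt_eqF// scale1r addrK.
Qed.

Lemma trQQ : Q^T *m Q = 1%:M. Proof. exact: mulmx1C. Qed.

Lemma continuous_similarity : continuous S.
Proof.
have -> : S = (fun x => x *m (r *: Q) + b) by apply/funext => x; exact: similarity_affine.
exact: continuous_mulmxD.
Qed.

Lemma test_function_similarity phi : test_function phi ->
  test_function (fun x => phi (S x)).
Proof.
move=> /test_functionP[sp [N N0 hN]]; apply/test_functionP; split.
  under eq_fun do rewrite similarity_affine; exact: smooth_affine.
have c0 : 0 <= r^-1 * (n%:R * (N + `|b|)).
  by apply: mulr_ge0; [rewrite invr_ge0 ltW|apply: mulr_ge0 => //; apply: addr_ge0 => //; exact: ltW].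
exists (r^-1 * (n%:R * (N + `|b|)) + 1); first by rewrite ltr_wpDl.
move=> x /hN Sx; apply: rV_norm_le.
  exact: addr_ge0.
move=> i; apply: le_trans (coord_le_enorm x i) _.
have -> : enorm x = r^-1 * enorm (S x - b).
  rewrite /similarity addrK enormZ gtr0_norm// enorm_mulmx// mulrA mulVf ?mul1r// gt_eqF//.
rewrite ler_wpDr//; apply: ler_wpM2l; first by rewrite invr_ge0 ltW.
apply: le_trans (enorm_le_norm _) _; apply: ler_wpM2l => //.
by apply: le_trans (ler_normB _ _) _; rewrite lerD2r.
Qed.

Lemma rV_locally_integrable_similarity f : rV_locally_integrable f ->
  rV_locally_integrable (fun x => f (S x)).
Proof.
move=> /rV_locally_integrable_cube[mf If]; apply/rV_locally_integrable_cube.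
have mS := measurable_similarity r Q b.
split; first exact: (measurableT_comp mf).
move=> N; have mC := @measurable_cube R n N.
have cn : continuous (fun x => `|S x|).
  by move=> x; apply: continuous_comp; [exact: continuous_similarity|exact: norm_continuous].
have [M M0 hM] := compact_bounded_fun N cn.
have mC' := @measurable_cube R n M.
have /(integrable_mkcond _ mC').1/(integrable_similarity b r0 QQ) h := If M.
apply/(integrable_mkcond _ mC).2; apply: le_integrable h => //.
  apply/(measurable_restrictT _ mC)/measurable_funTS/measurable_EFinP.
  exact: (measurableT_comp mf).
move=> x _; rewrite /= !patchE; case: ifPn => [|_]; last by rewrite abse0 abse_ge0.
rewrite inE => xN; rewrite mem_set// /cube/=.
by have := hM _ xN; rewrite normr_id.
Qed.

End similarity.

Lemma Rintegral_similarity_sum r (Q : 'M[R]_n) (F : 'I_n -> E -> R) (c : 'I_n -> R) b :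
  0 < r -> Q *m Q^T = 1%:M ->
  (forall j, mu.-integrable setT (EFin \o F j)) ->
  \int[mu]_x (\sum_j c j * F j (similarity r Q b x)) =
    r ^- n * \sum_j c j * \int[mu]_x F j x.
Proof.
move=> r0 QQ IF; have IL j := integrableZl measurableT (c j) (IF j).
rewrite (Rintegral_similarity b r0 QQ (integrable_sumR IL)) Rintegral_sum//.
by congr (_ * _); apply: eq_bigr => j _; rewrite RintegralZl.
Qed.

(** A test function is written as psi o S by means of the inverse similarity. Its partial derivative
    is then a combination of those of psi at S x, and the same combination of the weak equations for
    u, after a change of variables, is the claim. *)
Lemma is_weak_grad_similarity r (Q : 'M[R]_n) b u G : 0 < r -> Q *m Q^T = 1%:M ->
  rV_locally_integrable u -> is_weak_grad u G ->
  is_weak_grad (u \o similarity r Q b) (fun x => r *: (G (similarity r Q b x) *m Q^T)).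
Proof.
move=> r0 QQ Iu uG i; set S := similarity r Q b.
have GE x : (r *: (G (S x) *m Q^T)) ord0 i = \sum_j (r * Q i j) * G (S x) ord0 j.
  by rewrite !mxE mulr_sumr; apply: eq_bigr => j _; rewrite !mxE; ring.
under eq_fun do rewrite GE.
have IS := rV_locally_integrable_similarity b r0 QQ.
split.
  apply: rV_locally_integrable_sum => j; apply: rV_locally_integrableZ.
  by apply: (IS (fun x => G x ord0 j)); have [] := uG j.
move=> phi tp; pose psi x := phi (similarity r^-1 Q^T (- (r^-1 *: (b *m Q^T))) x).
have rV0 : 0 < r^-1 by rewrite invr_gt0.
have QTQ : Q^T *m Q^T^T = 1%:M by rewrite trmxK; exact: trQQ.
have tpsi : test_function psi by exact: test_function_similarity.
have phiE : phi = psi \o S by apply/funext => x; rewrite /psi /= similarityK.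
have [spsi _] := tpsi.
have dphiE x : partial i phi x = \sum_j (r * Q i j) * partial j psi (S x).
  have -> : phi = (fun y => psi (y *m (r *: Q) + b)).
    by rewrite phiE; apply/funext => y; rewrite /= -similarity_affine.
  rewrite partial_affine; last by move/smoothP: spsi.
  by rewrite -similarity_affine; apply: eq_bigr => j _; rewrite mxE.
have Idpsi j := integrable_test_mul Iu (test_function_partial j tpsi).
have Ig j : rV_locally_integrable (fun x => G x ord0 j) by have [] := uG j.
have Igpsi j := integrable_test_mul (Ig j) tpsi.
have -> : \int[mu]_x ((u \o S) x * partial i phi x) =
    r ^- n * \sum_j (r * Q i j) * \int[mu]_x (u x * partial j psi x).
  rewrite -(Rintegral_similarity_sum _ b r0 QQ Idpsi); apply: eq_Rintegral => x _.
  by rewrite dphiE mulr_sumr; apply: eq_bigr => j _; rewrite /=; ring.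
have -> : \int[mu]_x ((\sum_j r * Q i j * G (S x) ord0 j) * phi x) =
    r ^- n * \sum_j (r * Q i j) * \int[mu]_x (G x ord0 j * psi x).
  rewrite -(Rintegral_similarity_sum _ b r0 QQ Igpsi); apply: eq_Rintegral => x _.
  by rewrite phiE mulr_suml; apply: eq_bigr => j _; rewrite /=; ring.
rewrite -mulrN -sumrN; congr (_ * _); apply: eq_bigr => j _.
by have [_ ->] := uG j; rewrite ?mulrN.
Qed.

End energy.

(** * Truncation *)

Section trunc.
Context {R : realType}.
Implicit Types d s t : R.

(* A differentiable approximation from below of the positive part, with Lipschitz
   derivative, that vanishes on [(-oo, d]]. *)
Definition trunc d t : R := Num.max (t - d) 0 ^+ 2 / (Num.max (t - d) 0 + d).
Definition dtrunc d t : R := 1 - d ^+ 2 / (Num.max (t - d) 0 + d) ^+ 2.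

Lemma trunc_small d t : t <= d -> trunc d t = 0.
Proof. by move=> td; rewrite /trunc (max_idPr _) ?subr_le0// expr0n mul0r. Qed.

Lemma trunc_ge0 d t : 0 < d -> 0 <= trunc d t.
Proof. by move=> d0; rewrite /trunc divr_ge0 ?sqr_ge0// addr_ge0 ?(ltW d0)// le_max lexx orbT. Qed.

Lemma truncE d t : 0 < d -> d <= t -> trunc d t = t - 2 * d + d ^+ 2 / t.
Proof.
move=> d0 dt; rewrite /trunc (max_idPl _) ?subr_ge0// subrK.
by field; rewrite gt_eqF// (lt_le_trans d0).
Qed.

Lemma dtrunc_small d t : 0 < d -> t <= d -> dtrunc d t = 0.
Proof.
move=> d0 td; rewrite /dtrunc (max_idPr _) ?subr_le0// add0r divff ?subrr//.
by rewrite gt_eqF// exprn_gt0.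
Qed.

Lemma dtruncE d t : d <= t -> dtrunc d t = 1 - d ^+ 2 / t ^+ 2.
Proof. by move=> dt; rewrite /dtrunc (max_idPl _) ?subr_ge0// subrK. Qed.

Lemma trunc_le d t : 0 < d -> trunc d t <= Num.max t 0.
Proof.
move=> d0; have [dt|/ltW td] := leP d t; last by rewrite trunc_small// le_max lexx orbT.
have t0 := lt_le_trans d0 dt.
rewrite truncE// le_max; apply/orP; left; rewrite -subr_ge0.
have -> : t - (t - 2 * d + d ^+ 2 / t) = d * (2 - d / t) by field; rewrite gt_eqF.
apply: mulr_ge0; first exact: ltW.
by rewrite subr_ge0 ler_pdivrMr//; lra.
Qed.

Lemma trunc_ge d t : 0 < d -> t - 2 * d <= trunc d t.
Proof.
move=> d0; have [dt|/ltW td] := leP d t; last by rewrite trunc_small//; lra.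
have t0 := lt_le_trans d0 dt.
by rewrite truncE// lerDl divr_ge0 ?sqr_ge0// ltW.
Qed.

Lemma dtrunc_ge0 d t : 0 < d -> 0 <= dtrunc d t.
Proof.
move=> d0; have [dt|/ltW td] := leP d t; last by rewrite dtrunc_small.
have t0 := lt_le_trans d0 dt.
by rewrite dtruncE// subr_ge0 ler_pdivrMr ?exprn_gt0// mul1r ler_pXn2r// nnegrE ltW.
Qed.

Lemma dtrunc_le1 d t : 0 < d -> dtrunc d t <= 1.
Proof. by move=> d0; rewrite /dtrunc gerBl divr_ge0// sqr_ge0. Qed.

Lemma continuous_dtrunc d : 0 < d -> continuous (dtrunc d).
Proof.
move=> d0 t; have c t1 : {for t1, continuous (fun t => Num.max (t - d) 0 + d)}.
  apply: cvgD; last exact: cvg_cst.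
  apply: (@continuous_max _ _ (fun t => t - d) (cst 0)); last exact: cst_continuous.
  by apply: cvgB; [exact: cvg_id|exact: cvg_cst].
apply: cvgB; first exact: cvg_cst.
apply: cvgM; first exact: cvg_cst.
apply: cvgV; last by apply: (@cvgM _ _ _ _ (fun t => Num.max (t - d) 0 + d)); exact: c.
by rewrite expf_neq0// gt_eqF// ltr_wpDl// le_max lexx orbT.
Qed.

(** [dtrunc d] is 0 up to d and 1 - d^2 / t^2 beyond, with slope at most 2 / d, whence the constant.
    Its kink at d separates four cases. *)
Lemma quadratic_remainder_trunc d : 0 < d -> quadratic_remainder (trunc d) (dtrunc d) d^-1.
Proof.
move=> d0 s t; have [ds|sd] := leP d s; have [dt|/ltW td] := leP d t.
- have s0 := lt_le_trans d0 ds; have t0 := lt_le_trans d0 dt.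
  rewrite !truncE// dtruncE//.
  have -> : t - 2 * d + d ^+ 2 / t - (s - 2 * d + d ^+ 2 / s) -
      (1 - d ^+ 2 / s ^+ 2) * (t - s) = d ^+ 2 / (s ^+ 2 * t) * (t - s) ^+ 2.
    by field; rewrite !gt_eqF.
  rewrite normrM (ger0_norm (sqr_ge0 _)) ler_wpM2r ?sqr_ge0//.
  rewrite ger0_norm; last by rewrite divr_ge0 ?sqr_ge0// mulr_ge0 ?sqr_ge0// ltW.
  rewrite ler_pdivrMr ?mulr_gt0 ?exprn_gt0// ler_pdivlMl//.
  rewrite [leLHS]mulrC; apply: ler_pM => //; rewrite ?sqr_ge0 ?(ltW d0)//.
  by rewrite ler_pXn2r// nnegrE ltW.
- have s0 := lt_le_trans d0 ds.
  rewrite (trunc_small td) truncE// dtruncE//.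
  (* With q = d / s in [0, 1], A = s - d and B = d - t, the remainder times d is q^2 A^2 + q (1 + q)
     A B, which is at most A^2 + 2 A B <= (A + B)^2. *)
  have -> : 0 - (s - 2 * d + d ^+ 2 / s) - (1 - d ^+ 2 / s ^+ 2) * (t - s) =
     d^-1 * ((d / s) ^+ 2 * (s - d) ^+ 2 + (d / s) * (1 + d / s) * (s - d) * (d - t)).
    by field; rewrite !gt_eqF.
  rewrite normrM (ger0_norm (_ : 0 <= d^-1)) ?invr_ge0 ?(ltW d0)//.
  rewrite ler_wpM2l ?invr_ge0 ?(ltW d0)//.
  have q0 : 0 <= d / s by rewrite divr_ge0// ltW.
  have q1 : d / s <= 1 by rewrite ler_pdivrMr// mul1r.
  move: (d / s) q0 q1 => q q0 q1.
  have A0 : 0 <= s - d by rewrite subr_ge0.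
  have B0 : 0 <= d - t by rewrite subr_ge0.
  rewrite (_ : t - s = - ((s - d) + (d - t))); last by ring.
  rewrite sqrrN; move: (s - d) (d - t) A0 B0 => A B A0 B0.
  have AB : 0 <= A * B by exact: mulr_ge0.
  rewrite ger0_norm; last by rewrite addr_ge0// ?mulr_ge0 ?sqr_ge0// addr_ge0.
  have h1 : q ^+ 2 * A ^+ 2 <= A ^+ 2 by rewrite ler_piMl ?sqr_ge0// expr_le1.
  have h2 : q * (1 + q) * A * B <= 2 * (A * B).
    by rewrite -[_ * A * B]mulrA ler_wpM2r//; nra.
  by apply: le_trans (lerD h1 h2) _; rewrite sqrrD mulr_natl lerDl sqr_ge0.
- rewrite (trunc_small (ltW sd)) (dtrunc_small d0 (ltW sd)) mul0r !subr0.
  have t0 := lt_le_trans d0 dt.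
  rewrite truncE//; have -> : t - 2 * d + d ^+ 2 / t = (d^-1 * ((d / t) * (t - d) ^+ 2)).
    by field; rewrite !gt_eqF.
  have h : (d / t) * (t - d) ^+ 2 <= (t - s) ^+ 2.
    have q1 : d / t <= 1 by rewrite ler_pdivrMr// mul1r.
    apply: (@le_trans _ _ ((t - d) ^+ 2)); first by rewrite ler_piMl// sqr_ge0.
    by rewrite ler_sqr ?nnegrE ?subr_ge0// ?(ltW (lt_le_trans sd dt))//; lra.
  rewrite ger0_norm ?ler_wpM2l// ?invr_ge0 ?(ltW d0)//.
  by rewrite mulr_ge0 ?invr_ge0 ?(ltW d0)// mulr_ge0 ?sqr_ge0// divr_ge0// ltW.
- rewrite (trunc_small (ltW sd)) (trunc_small td) (dtrunc_small d0 (ltW sd)).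
  by rewrite mul0r !subr0 normr0 mulr_ge0 ?sqr_ge0// invr_ge0 ltW.
Qed.

Lemma cvg_invS : (k.+1%:R^-1 : R) @[k --> \oo] --> (0 : R).
Proof. exact: cvg_harmonic. Qed.

Lemma trunc_cvg t : trunc k.+1%:R^-1 t @[k --> \oo] --> Num.max t 0.
Proof.
have [t0|t0] := leP t 0.
  under eq_fun do rewrite trunc_small ?(le_trans t0) ?invr_ge0//.
  exact: cvg_cst.
apply: (@squeeze_cvgr _ _ _ _ (fun k => t - 2 * k.+1%:R^-1) (cst t)).
- near=> k; rewrite trunc_ge ?invr_gt0//=.
  by have := @trunc_le _ t (ltac:(by rewrite invr_gt0) : 0 < k.+1%:R^-1); rewrite (max_idPl (ltW t0)).
- rewrite -[X in _ --> X]subr0 -[X in _ --> t - X](mulr0 2).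
  by apply: cvgB; [exact: cvg_cst|apply: cvgMr; exact: cvg_invS].
- exact: cvg_cst.
Unshelve. all: by end_near. Qed.

Lemma dtrunc_cvg t : dtrunc k.+1%:R^-1 t @[k --> \oo] --> ((0 < t)%R%:R : R).
Proof.
have [t0|t0] /= := ltP 0 t; last first.
  under eq_fun do rewrite dtrunc_small ?invr_gt0// ?(le_trans t0) ?invr_ge0//.
  exact: cvg_cst.
have h : 1 - k.+1%:R^-1 ^+ 2 / t ^+ 2 @[k --> \oo] --> (1 : R).
  rewrite -[X in _ --> X]subr0; apply: cvgB; first exact: cvg_cst.
  rewrite -[X in _ --> X](mul0r (t ^+ 2)^-1); apply: cvgMl.
  by rewrite -[X in _ --> X](mul0r 0); apply: cvgM; exact: cvg_invS.
apply: cvg_trans h; apply: near_eq_cvg.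
near=> k; rewrite dtruncE//; apply/ltW.
by near: k; exact: (@near_infty_natSinv_lt _ (PosNum t0)).
Unshelve. all: by end_near. Qed.

End trunc.

(** * Dominated limits of weak derivatives; the positive part *)

Section limit.
Context {R : realType} {n : nat}.
Local Notation E := 'rV[R]_n.
Local Notation mu := (rV_lebesgue R n).
Implicit Types (u v g h phi : E -> R) (G : E -> E) (x y : E) (i j : 'I_n).

Lemma Rintegral_dominated (F : nat -> E -> R) f h :
  (forall k, measurable_fun setT (F k)) ->
  (forall x, F k x @[k --> \oo] --> f x) ->
  mu.-integrable setT (EFin \o h) -> (forall k x, `|F k x| <= h x) ->
  \int[mu]_x F k x @[k --> \oo] --> \int[mu]_x f x.
Proof.
move=> mF Ff Ih Fh.
have mf : measurable_fun setT f by apply: (measurable_fun_cvg mF) => x _; exact: Ff.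
have [||||If _ hc] := @dominated_convergence _ _ _ mu setT measurableT
    (fun k => EFin \o F k) (EFin \o f) (EFin \o h) _ _ _ Ih _.
- by move=> k; exact/measurable_EFinP.
- exact/measurable_EFinP.
- by apply: aeW => x _; apply: cvg_EFin; [exact: nearW|exact: Ff].
- by apply: aeW => x k _; rewrite /= lee_fin.
apply: fine_cvg; rewrite /Rintegral fineK//.
exact: integrable_fin_num.
Qed.

Lemma measurable_weak_partial i u g : is_weak_partial i u g -> measurable_fun setT g.
Proof. by case=> -[]. Qed.

Lemma weak_partial_limit i (w_ g_ : nat -> E -> R) w g W H :
  (forall k, measurable_fun setT (w_ k)) ->
  (forall k, is_weak_partial i (w_ k) (g_ k)) ->
  rV_locally_integrable W -> rV_locally_integrable H ->
  (forall x, w_ k x @[k --> \oo] --> w x) -> (forall x, g_ k x @[k --> \oo] --> g x) ->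
  (forall k x, `|w_ k x| <= W x) -> (forall k x, `|g_ k x| <= H x) ->
  is_weak_partial i w g.
Proof.
move=> mw wg IW IH cw cg lw lg.
have mg k : measurable_fun setT (g_ k) by exact: measurable_weak_partial (wg k).
split.
  apply: rV_locally_integrable_le IH _.
    by apply: (measurable_fun_cvg mg) => x _; exact: cg.
  move=> x; apply: (ler_cvg_to (cvg_norm (cg x)) (cvg_cst `|H x|)).
  by apply: nearW => k; apply: le_trans (lg k x) _; exact: ler_norm.
move=> phi tp; have tdp := test_function_partial i tp.
have mp : measurable_fun setT phi.
  by apply: continuous_measurable_rV; exact: test_function_continuous.
have mdp : measurable_fun setT (partial i phi).
  by apply: continuous_measurable_rV; exact: test_function_continuous.
have dom (f_ : nat -> E -> R) (f F psi : E -> R) : (forall k, measurable_fun setT (f_ k)) ->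
    measurable_fun setT psi -> (forall k x, `|f_ k x| <= F x) ->
    (forall x, f_ k x @[k --> \oo] --> f x) ->
    mu.-integrable setT (EFin \o (fun x => F x * psi x)) ->
    \int[mu]_x (f_ k x * psi x) @[k --> \oo] --> \int[mu]_x (f x * psi x).
  move=> mf mpsi lf cf IF.
  apply: (Rintegral_dominated (h := fun x => `|F x * psi x|)).
  - by move=> k; exact: measurable_funM.
  - by move=> x; apply: cvgMl; exact: cf.
  - exact: (integrable_norm IF).
  - move=> k x; rewrite !normrM ler_wpM2r//; apply: le_trans (lf k x) _.
    exact: ler_norm.
have c1 := dom _ _ _ _ mw mdp lw cw (integrable_test_mul IW tdp).
have c2 := dom _ _ _ _ mg mp lg cg (integrable_test_mul IH tp).
apply: (cvg_unique _ c1) => //=.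
under eq_fun do rewrite (wg _).2//.
exact: cvgN.
Qed.

(** Limit of [trunc d (u x)] for d = 1 / (k + 1). The derivative [dtrunc d] vanishes up to d, so the
    limit carries the strict indicator of u > 0 and is 0 where u = 0. *)
Lemma weak_partial_pos i u g : continuous u -> is_weak_partial i u g ->
  is_weak_partial i (fun x => Num.max (u x) 0) (fun x => (0 < u x)%R%:R * g x).
Proof.
move=> cu wg; have kV0 (k : nat) : 0 < k.+1%:R^-1 :> R by rewrite invr_gt0.
have wk (k : nat) := weak_partial_comp cu wg (continuous_dtrunc (kV0 k))
  (quadratic_remainder_trunc (kV0 k)).
have [Ig _] := wg.
have ct k := quadratic_remainder_continuous (quadratic_remainder_trunc (kV0 k)).
apply: (weak_partial_limit (W := fun x => `|u x|) (H := fun x => `|g x|) _ wk).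
- move=> k; apply: continuous_measurable_rV => x.
  by apply: continuous_comp; [exact: cu|exact: ct].
- apply: continuous_locally_integrable => x.
  by apply: continuous_comp; [exact: cu|exact: norm_continuous].
- apply: rV_locally_integrable_le Ig _; last by move=> x; rewrite normr_id.
  by apply: measurableT_comp => //; exact: measurable_weak_partial wg.
- by move=> x; exact: trunc_cvg.
- by move=> x; apply: cvgMl; exact: dtrunc_cvg.
- move=> k x; rewrite ger0_norm ?trunc_ge0//; apply: le_trans (trunc_le _ (kV0 k)) _.
  by rewrite ge_max normr_ge0 ler_norm.
- move=> k x; rewrite normrM ler_piMl// ger0_norm ?dtrunc_ge0// dtrunc_le1//.
Qed.

(** Write u as the positive part of u minus that of -u. Both derivatives vanish where u = 0, which
    yields a second weak derivative of the same u; uniqueness then forces g to vanish almost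
    everywhere there. *)
Lemma weak_partial_neq0 i u g : continuous u -> is_weak_partial i u g ->
  is_weak_partial i u (fun x => (u x != 0)%R%:R * g x).
Proof.
move=> cu wg; have Iu := continuous_locally_integrable cu.
have cNu : continuous (fun x => -1 * u x).
  by move=> x; apply: (@continuousM _ _ (cst (-1)) u); [exact: cst_continuous|exact: cu].
have cp v : continuous v -> rV_locally_integrable (fun x => Num.max (v x) 0).
  move=> cv; apply: continuous_locally_integrable => x.
  by apply: (@continuous_max _ _ v (cst 0)); [exact: cv|exact: cst_continuous].
have h1 := weak_partial_pos cu wg.
have h2 := weak_partialZ (-1) (cp _ cNu) (weak_partial_pos cNu (weak_partialZ (-1) Iu wg)).
have := weak_partialD (cp _ cu) (rV_locally_integrableZ (-1) (cp _ cNu)) h1 h2.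
have -> : (fun x => Num.max (u x) 0 + -1 * Num.max (-1 * u x) 0) = u.
  apply/funext => x; rewrite !mulN1r; have [x0|x0] := leP (u x) 0.
    by rewrite add0r (max_idPl _) ?oppr_ge0// opprK.
  by rewrite (max_idPr _) ?oppr_le0 ?ltW// oppr0 addr0.
congr is_weak_partial; apply/funext => x; rewrite !mulN1r oppr_gt0 mulrN opprK.
by case: ltgtP => _; rewrite ?mul1r ?mul0r ?addr0 ?add0r.
Qed.

Lemma weak_grad_eq0 u G : continuous u -> is_weak_grad u G ->
  {ae mu, forall x, u x = 0 -> G x = 0}.
Proof.
move=> cu uG; have : is_weak_grad u (fun x => (u x != 0)%R%:R *: G x).
  move=> i; under eq_fun do rewrite mxE.
  exact: weak_partial_neq0.
move=> /(weak_grad_unique uG); apply: filterS => x h ux.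
by rewrite h ux eqxx scale0r.
Qed.

Lemma partial_eta_coord (s : R) i j x :
  partial i (fun y : E => eta (s * y ord0 j + 0)) x =
  (i == j)%:R * (flat 'X^2 (s * x ord0 j) * s).
Proof.
suff [] : is_derive x (delta_mx ord0 i) (fun y : E => eta (s * y ord0 j + 0))
  ((i == j)%:R * (flat 'X^2 (s * x ord0 j) * s)) by [].
apply: is_derive_cvg; under eq_fun do rewrite !mxE eqxx/= !addr0 [j == i]eq_sym.
case: eqP => _; last first.
  under eq_fun do rewrite mulr0 add0r subrr mulr0.
  by rewrite mul0r; exact: cvg_cst.
have df := is_derive_flat (1 : {poly R}) (s * x ord0 j).
rewrite derivC subr0 mulr1 in df.
have dl : is_derive (x ord0 j) 1 (fun t : R => s * t) s.
  by apply: is_derive_eq; rewrite /= ?scaler0 ?add0r ?addr0 ?mulr1; exact: mulr1.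
have [+ dE] := is_derive1_comp df dl.
rewrite /derivable mul1r -dE.
by under [X in cvg (X @ _)]eq_fun do rewrite /= /shift/=.
Qed.

End limit.

(** * Cutting along a coordinate hyperplane *)

Section half_space_cut.
Context {R : realType} {n : nat}.
Local Notation E := 'rV[R]_n.
Local Notation mu := (rV_lebesgue R n).
Implicit Types (u v g h phi : E -> R) (G : E -> E) (x y : E) (i j : 'I_n) (d : R).

(** Truncation comes before the cut: if v is continuous and 0 on the hyperplane x_j = 0, then
    [trunc d (v x)] vanishes near it, and the cut creates neither a jump nor a boundary term. *)
Definition half_trunc j d v x : R := (0 < x ord0 j)%R%:R * trunc d (v x).

Lemma continuous_trunc d v : 0 < d -> continuous v -> continuous (fun x => trunc d (v x)).
Proof.
move=> d0 cv x; apply: continuous_comp; first exact: cv.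
exact: quadratic_remainder_continuous (quadratic_remainder_trunc d0) _.
Qed.

Lemma continuous_half_trunc j d v : 0 < d -> continuous v ->
  (forall x, x ord0 j = 0 -> v x = 0) -> continuous (half_trunc j d v).
Proof.
move=> d0 cv v0 x; have ct := continuous_trunc d0 cv.
have cj : (fun y : E => y ord0 j) @ x --> x ord0 j by exact: coord_continuous.
have near_cont (f : E -> R) : {for x, continuous f} -> f x = half_trunc j d v x ->
    (\forall y \near x, f y = half_trunc j d v y) -> {for x, continuous (half_trunc j d v)}.
  move=> cf e ne; rewrite /prop_for /continuous_at -e; apply: cvg_trans cf.
  exact: (near_eq_cvg ne).
have [xj|xj|xj] := ltgtP (x ord0 j) 0.
- apply: (near_cont (cst 0)); first exact: cst_continuous.
    by rewrite /half_trunc ltNge (ltW xj) mul0r.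
  near=> y; rewrite /half_trunc ltNge ltW ?mul0r//.
  by near: y; exact: (cvgr_lt _ cj).
- apply: (near_cont (fun y => trunc d (v y))); first exact: ct.
    by rewrite /half_trunc xj mul1r.
  near=> y; rewrite /half_trunc (_ : 0 < _) ?mul1r//.
  by near: y; exact: (cvgr_gt _ cj).
- apply: (near_cont (cst 0)); first exact: cst_continuous.
    by rewrite /half_trunc xj ltxx mul0r.
  near=> y; rewrite /half_trunc trunc_small ?mulr0//.
  apply: ltW; near: y; apply: (cvgr_lt _ (cv x)); by rewrite v0.
Unshelve. all: by end_near. Qed.

Lemma powRN2 (a : R) : 0 <= a -> a `^ (- 2) = (a ^+ 2)^-1.
Proof. by move=> a0; rewrite powRN powR_mulrn. Qed.

(** The derivative of eta(s t) is s (s t)^(-2) exp(-1 / (s t)) for t > 0. The bound tends to 0 as s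
    grows, at every fixed t != 0. *)
Lemma eta_coord_partial_le (s : R) i j x : 0 < s ->
  `|partial i (fun y : E => eta (s * y ord0 j + 0)) x| <= s^-1 * `|x ord0 j| `^ (- 2).
Proof.
move=> s0; rewrite partial_eta_coord.
have b0 : 0 <= s^-1 * `|x ord0 j| `^ (- 2) by rewrite mulr_ge0 ?powR_ge0// invr_ge0 ltW.
case: eqP => _; last by rewrite mul0r normr0.
rewrite mul1r /flat; case: ifPn => [h|_]; last by rewrite mul0r normr0.
have x0 : 0 < x ord0 j by move: h; rewrite pmulr_rgt0.
rewrite powRN2// (gtr0_norm x0) hornerXn ger0_norm; last first.
  by rewrite mulr_ge0 ?(ltW s0)// mulr_ge0 ?expR_ge0 ?sqr_ge0.
have -> : (s * x ord0 j)^-1 ^+ 2 * expR (- (s * x ord0 j)^-1) * s =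
    s^-1 * (x ord0 j ^+ 2)^-1 * expR (- (s * x ord0 j)^-1).
  by field; rewrite !gt_eqF.
rewrite ler_piMr ?mulr_ge0 ?invr_ge0 ?(ltW s0) ?sqr_ge0//.
by rewrite expR_le1 oppr_le0 invr_ge0 ltW.
Qed.

(** On the compact set where |x| <= N and v >= d, the function |x_j| attains its minimum, which is
    positive because v vanishes where x_j = 0. *)
Lemma level_set_coord j d v (N : R) : 0 < d -> continuous v ->
  (forall x, x ord0 j = 0 -> v x = 0) ->
  exists2 c : R, 0 < c & forall x, `|x| <= N -> d <= v x -> c <= `|x ord0 j|.
Proof.
move=> d0 cv v0.
pose K := [set x : E | `|x| <= N] `&` (v @^-1` [set t | d <= t]).
have cN := @compact_norm_le R n N.
have cK : compact K.
  apply: (subclosed_compact _ cN) => [|x []//].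
  apply: closedI; first by apply: (compact_closed _ cN); exact: norm_hausdorff.
  by apply: preimage_closed; [move=> x _; exact: cv|exact: closed_ge].
have [K0|/nonemptyPn K0] := pselect (K !=set0); last first.
  by exists 1 => // x xN ux; have : K x by []; rewrite K0.
have cj : continuous (fun x : E => `|x ord0 j|).
  by move=> x; apply: continuous_comp; [exact: coord_continuous|exact: norm_continuous].
have [c /set_mem[_ /= cd] hc] := EVT_min_rV K0 cK (continuous_subspaceT cj).
exists `|c ord0 j|; last by move=> x xN vx; apply: hc; rewrite inE.
by rewrite normr_gt0; apply/eqP => /v0 vc; move: cd; rewrite vc leNgt d0.
Qed.

Lemma trunc_div_bounded j d v (N : R) : 0 < d -> continuous v ->
  (forall x, x ord0 j = 0 -> v x = 0) ->
  exists M : R, forall x, `|x| <= N -> `|trunc d (v x) * `|x ord0 j| `^ (- 2)| <= M.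
Proof.
move=> d0 cv v0; have [M M0 hM] := compact_bounded_fun N (continuous_trunc d0 cv).
have [c c0 hc] := level_set_coord N d0 cv v0.
exists (M * (c ^+ 2)^-1) => x xN.
have [dv|/ltW vd] := leP d (v x); last first.
  by rewrite trunc_small// mul0r normr0 mulr_ge0 ?(ltW M0)// invr_ge0 sqr_ge0.
have xc := hc _ xN dv; have x0 := lt_le_trans c0 xc.
rewrite normrM (ger0_norm (powR_ge0 _ _)) powRN2//; apply: ler_pM => //.
- exact: hM.
- by rewrite lef_pV2 ?ler_sqr ?posrE ?exprn_gt0// nnegrE ltW.
Qed.

Lemma cvg_eta_coord j x :
  eta (k.+1%:R * x ord0 j + 0) @[k --> \oo] --> ((0 < x ord0 j)%R%:R : R).
Proof.
have [x0|x0] := ltP 0 (x ord0 j).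
  by under eq_fun do rewrite addr0; exact: eta_cvg1.
under eq_fun do rewrite addr0 eta_le0 ?pmulr_rle0//.
exact: cvg_cst.
Qed.

(** Multiply [trunc d (v x)] by eta((k + 1) x_j) and let k grow. The derivative of the cutoff
    contributes at most q / (k + 1), where q = trunc d (v) / x_j^2 is locally bounded by
    [trunc_div_bounded]. *)
Lemma weak_partial_half_trunc i j d v g : 0 < d -> continuous v ->
  (forall x, x ord0 j = 0 -> v x = 0) -> is_weak_partial i v g ->
  is_weak_partial i (half_trunc j d v)
    (fun x => (0 < x ord0 j)%R%:R * (dtrunc d (v x) * g x)).
Proof.
move=> d0 cv v0 wg; have ct := continuous_trunc d0 cv.
have It := continuous_locally_integrable ct.
have wt := weak_partial_comp cv wg (continuous_dtrunc d0) (quadratic_remainder_trunc d0).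
have [Ig _] := wg; have mg := measurable_weak_partial wg.
have wk (k : nat) := weak_partialM It wt (smooth_eta_coord 0 k.+1%:R j).
have mt : measurable_fun setT (fun x : E => trunc d (v x)) by exact: continuous_measurable_rV.
pose q x : R := trunc d (v x) * `|x ord0 j| `^ (- 2).
have mq : measurable_fun setT q.
  apply: measurable_funM => //; apply: (measurableT_comp (measurable_powR (- 2))).
  by apply: measurableT_comp => //; exact: measurable_rV_coord.
have Iq : rV_locally_integrable q.
  have c1 : continuous (fun _ : E => 1 : R) by exact: cst_continuous.
  have := rV_locally_integrable_bounded_mul (continuous_locally_integrable c1) mq
    (fun N => trunc_div_bounded N d0 cv v0).
  by under eq_fun do rewrite mul1r.
have Iabs f : measurable_fun setT f -> rV_locally_integrable f ->
    rV_locally_integrable (fun x => `|f x|).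
  move=> mf If; apply: rV_locally_integrable_le If _; last by move=> x; rewrite normr_id.
  exact: measurableT_comp.
have qle (k : nat) x : `|trunc d (v x) * partial i (fun y : E => eta (k.+1%:R * y ord0 j + 0)) x| <=
    k.+1%:R^-1 * q x.
  rewrite normrM (ger0_norm (trunc_ge0 _ d0)) /q mulrCA ler_wpM2l ?trunc_ge0//.
  exact: eta_coord_partial_le.
have q0 x : 0 <= q x by rewrite mulr_ge0 ?powR_ge0 ?trunc_ge0.
apply: (weak_partial_limit (W := fun x => `|trunc d (v x)|)
  (H := fun x => `|g x| + q x) _ wk).
- move=> k; apply: measurable_funM => //; apply: continuous_measurable_rV.
  exact: ((@smooth_eta_coord R n 0 k.+1%:R j [::]).1).
- exact: Iabs.
- by apply: rV_locally_integrableD => //; exact: Iabs.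
- by move=> x; rewrite /half_trunc mulrC; apply: cvgMr; exact: cvg_eta_coord.
- move=> x; rewrite -[X in _ --> X]addr0; apply: cvgD.
    by rewrite [X in _ --> X]mulrC; apply: cvgMr; exact: cvg_eta_coord.
  apply/norm_cvg0P; apply: (@squeeze_cvgr _ _ _ _ (cst 0) (fun k => k.+1%:R^-1 * q x)).
  + by apply: nearW => k; rewrite normr_ge0 qle.
  + exact: cvg_cst.
  + by rewrite -[X in _ --> X](mul0r (q x)); apply: cvgMl; exact: cvg_invS.
- by move=> k x; rewrite normrM ler_piMr// ger0_norm ?eta_ge0// eta_le1.
- move=> k x; apply: le_trans (ler_normD _ _) _; apply: lerD.
    rewrite !normrM -mulrA mulrCA ler_piMr// ger0_norm ?dtrunc_ge0//.
    by rewrite (ger0_norm (eta_ge0 _)) mulr_ile1 ?dtrunc_ge0 ?eta_ge0 ?dtrunc_le1 ?eta_le1.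
  apply: le_trans (qle k x) _; rewrite ler_piMl// invf_le1// ?ler1n ?ltr0n//.
Qed.

End half_space_cut.

(** * Calculus in the Sobolev space *)

(** Convexity of the power at the points a / (1 - l) and b / l. As l tends to 0 the factor of a^p
    tends to 1, so a perturbation b of vanishing energy does not affect the sharp constant. *)
Lemma powRD_le (R : realType) (a b l p : R) : 1 <= p -> 0 <= a -> 0 <= b -> 0 < l < 1 ->
  (a + b) `^ p <= (1 - l) `^ (1 - p) * a `^ p + l `^ (1 - p) * b `^ p.
Proof.
move=> p1 a0 b0 /andP[l0 l1]; have p0 : 0 < p by lra.
have m0 : 0 < 1 - l by rewrite subr_gt0.
have m1 : 1 - l <= 1 by lra.
have scale (m c : R) : 0 < m -> 0 <= c -> m * (c / m) `^ p = m `^ (1 - p) * c `^ p.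
  move=> mp c0; rewrite powRM// ?invr_ge0 ?(ltW mp)// powRB; last by rewrite (gt_eqF mp) implybT.
  rewrite powRr1 ?(ltW mp)// -powR_inv1 ?(ltW mp)// -powRrM mulN1r powRN; ring.
have := @convex_powR R p p1 (Itv01 (ltW m0) m1) (a / (1 - l)) (b / l).
have ge0 (c m : R) : 0 <= c -> 0 < m -> c / m \in `[0, +oo[%classic.
  by move=> c0 mp; rewrite inE/= in_itv/= andbT divr_ge0// ltW.
move=> /(_ (ge0 _ _ a0 m0) (ge0 _ _ b0 l0)); rewrite convRE [X in X `^ _ <= _ -> _]convRE /= /unstable.onem subKr.
by rewrite !scale// mulrCA divff ?mulr1 ?gt_eqF// mulrCA divff ?mulr1 ?gt_eqF.
Qed.

Section D1p_calculus.
Context {R : realType} {n : nat}.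
Local Notation E := 'rV[R]_n.
Local Notation mu := (rV_lebesgue R n).
Variable p : R.
Hypothesis p1 : 1 <= p.
Implicit Types (u v w g h chi : E -> R) (G H : E -> E) (x y b : E) (i j : 'I_n).

Let p0 : 0 < p. Proof. exact: lt_le_trans p1. Qed.

Let half01 : 0 < (2^-1 : R) < 1. Proof. by apply/andP; split; lra. Qed.

Let enorm0_powR : enorm (0 : E) `^ p = 0.
Proof. by rewrite enorm0 powR0 ?(gt_eqF p0). Qed.

Lemma energy_ge0 u : 0 <= energy p u.
Proof. by apply: Rintegral_ge0 => x _; exact: powR_ge0. Qed.

Lemma D1p_grad u : D1p p u -> exists G, [/\ continuous u, is_weak_grad u G,
  finite_energy p G & energy p u = \int[mu]_x (enorm (G x) `^ p)].
Proof.
move=> /(D1pP u p1)[cu [G [uG fG]]]; exists G.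
by split; [exact: cu|exact: uG|exact: fG|exact: energyE].
Qed.

Lemma D1p_intro w H h : continuous w -> is_weak_grad w H ->
  mu.-integrable setT (EFin \o h) -> (forall x, enorm (H x) `^ p <= h x) ->
  D1p p w /\ energy p w <= \int[mu]_x h x.
Proof.
move=> cw wH Ih le; have mH := measurable_weak_grad wH.
have fH : finite_energy p H.
  apply: le_integrable Ih => //; first by apply/measurable_EFinP; exact: measurable_enorm_powR.
  move=> x _ /=; rewrite lee_fin (ger0_norm (powR_ge0 _ _)).
  by apply: le_trans (le x) _; exact: ler_norm.
split; first by apply/(D1pP w p1); split => //; exists H.
by rewrite (energyE p wH); apply: le_Rintegral => // x _; exact: le.
Qed.

Lemma is_weak_gradD u v G H : continuous u -> continuous v ->
  is_weak_grad u G -> is_weak_grad v H ->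
  is_weak_grad (fun x => u x + v x) (fun x => G x + H x).
Proof.
move=> cu cv uG vH i; under [X in is_weak_partial _ _ X]eq_fun do rewrite mxE.
by apply: weak_partialD => //; exact: continuous_locally_integrable.
Qed.

Lemma is_weak_gradZ (c : R) u G : continuous u -> is_weak_grad u G ->
  is_weak_grad (fun x => c * u x) (fun x => c *: G x).
Proof.
move=> cu uG i; under [X in is_weak_partial _ _ X]eq_fun do rewrite mxE.
by apply: weak_partialZ => //; exact: continuous_locally_integrable.
Qed.

Lemma continuous_addf u v : continuous u -> continuous v -> continuous (fun x => u x + v x).
Proof. by move=> cu cv x; apply: (@continuousD _ _ _ u v); [exact: cu|exact: cv]. Qed.

Lemma continuous_mulf u v : continuous u -> continuous v -> continuous (fun x => u x * v x).
Proof. by move=> cu cv x; apply: (@continuousM _ _ u v); [exact: cu|exact: cv]. Qed.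

Lemma continuous_scalef (c : R) u : continuous u -> continuous (fun x => c * u x).
Proof. by apply: continuous_mulf; exact: cst_continuous. Qed.

Lemma D1pZ (c : R) u : D1p p u ->
  D1p p (fun x => c * u x) /\ energy p (fun x => c * u x) = `|c| `^ p * energy p u.
Proof.
move=> /D1p_grad[G [cu uG fG ->]]; have wG := is_weak_gradZ c cu uG.
have e x : enorm (c *: G x) `^ p = `|c| `^ p * enorm (G x) `^ p.
  by rewrite enormZ powRM// enorm_ge0.
have fZ : finite_energy p (fun x => c *: G x).
  rewrite /finite_energy; under [X in EFin \o X]eq_fun do rewrite e.
  exact: (integrableZl measurableT _ fG).
split; first by apply/(D1pP _ p1); split; [exact: continuous_scalef|exists (fun x => c *: G x)].
rewrite (energyE p wG); under eq_Rintegral do rewrite e.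
exact: (RintegralZl _ measurableT fG).
Qed.

Lemma D1p_addc (c : R) u : D1p p u ->
  D1p p (fun x => u x + c) /\ energy p (fun x => u x + c) = energy p u.
Proof.
move=> /D1p_grad[G [cu uG fG ->]].
have cc : continuous (fun _ : E => c) by exact: cst_continuous.
have wG : is_weak_grad (fun x => u x + c) G.
  move=> i; have := weak_partialD (continuous_locally_integrable cu)
    (continuous_locally_integrable cc) (uG i) (weak_partial_cst i c).
  by under [X in is_weak_partial _ _ X -> _]eq_fun do rewrite addr0.
split; last exact: energyE.
by apply/(D1pP _ p1); split; [exact: continuous_addf|exists G].
Qed.

(** The gradient contributes r^p and the change of variables r^(-n). *)
Lemma D1p_similarity (r : R) (Q : 'M[R]_n) b u : 0 < r -> Q *m Q^T = 1%:M -> D1p p u ->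
  D1p p (u \o similarity r Q b) /\
  energy p (u \o similarity r Q b) = r `^ (p - n%:R) * energy p u.
Proof.
move=> r0 QQ /D1p_grad[G [cu uG fG ->]].
have wG := is_weak_grad_similarity b r0 QQ (continuous_locally_integrable cu) uG.
have QTQ : Q^T *m Q^T^T = 1%:M by rewrite trmxK; exact: trQQ.
have e x : enorm (r *: (G (similarity r Q b x) *m Q^T)) `^ p =
    r `^ p * enorm (G (similarity r Q b x)) `^ p.
  by rewrite enormZ (gtr0_norm r0) enorm_mulmx// powRM ?enorm_ge0 ?ltW.
have fS := integrable_similarity b r0 QQ fG.
split.
  apply/(D1pP _ p1); split.
    by move=> x; apply: continuous_comp; [exact: continuous_similarity|exact: cu].
  exists (fun x => r *: (G (similarity r Q b x) *m Q^T)); split; first exact: wG.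
  rewrite /finite_energy; under [X in EFin \o X]eq_fun do rewrite e.
  exact: (integrableZl measurableT _ fS).
rewrite (energyE p wG); under eq_Rintegral do rewrite e.
rewrite (RintegralZl _ measurableT fS) (Rintegral_similarity b r0 QQ fG) mulrA; congr (_ * _).
by rewrite powRB ?(gt_eqF r0) ?implybT// powR_mulrn ?(ltW r0).
Qed.

Lemma D1pD_le (l : R) u v : 0 < l < 1 -> D1p p u -> D1p p v ->
  D1p p (fun x => u x + v x) /\ energy p (fun x => u x + v x) <=
    (1 - l) `^ (1 - p) * energy p u + l `^ (1 - p) * energy p v.
Proof.
move=> l01 /D1p_grad[G [cu uG fG ->]] /D1p_grad[H [cv vH fH ->]].
have wGH := is_weak_gradD cu cv uG vH.
have I1 := integrableZl measurableT ((1 - l) `^ (1 - p)) fG.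
have I2 := integrableZl measurableT (l `^ (1 - p)) fH.
rewrite -!RintegralZl// -RintegralD//; apply: D1p_intro wGH _ _.
- exact: continuous_addf.
- exact: (integrableD measurableT I1 I2).
- move=> x; apply: le_trans (powRD_le p1 (enorm_ge0 _) (enorm_ge0 _) l01).
  by apply: powR_mono; rewrite ?enorm_ge0 ?(ltW p0)// enormD.
Qed.

(** By [weak_grad_eq0], at almost every point at least one of the two gradients is 0, so the p-th
    powers add exactly. *)
Lemma D1pD_disjoint u v : D1p p u -> D1p p v -> (forall x, u x = 0 \/ v x = 0) ->
  D1p p (fun x => u x + v x) /\ energy p (fun x => u x + v x) = energy p u + energy p v.
Proof.
move=> Du Dv uv; have [G [cu uG fG ->]] := D1p_grad Du.
have [H [cv vH fH ->]] := D1p_grad Dv.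
have [D _] := D1pD_le half01 Du Dv; split; first exact: D.
have wGH := is_weak_gradD cu cv uG vH.
rewrite (energyE p wGH) -(RintegralD measurableT fG fH).
have z1 := weak_grad_eq0 cu uG; have z2 := weak_grad_eq0 cv vH.
apply: (congr1 fine); apply: ae_eq_integral.
- exact: measurableT.
- by apply/measurable_EFinP; apply: measurable_enorm_powR; exact: measurable_weak_grad wGH.
- apply/measurable_EFinP; apply: measurable_funD; apply: measurable_enorm_powR.
    exact: measurable_weak_grad uG.
  exact: measurable_weak_grad vH.
- apply: filterS2 z1 z2 => x h1 h2 _ /=; have [/h1 ->|/h2 ->] := uv x.
    by rewrite add0r enorm0_powR add0r.
  by rewrite addr0 enorm0_powR addr0.
Qed.

Lemma D1p_comp (F f : R -> R) (L : R) u : D1p p u -> continuous f ->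
  quadratic_remainder F f L -> (forall t, `|f t| <= 1) ->
  D1p p (F \o u) /\ energy p (F \o u) <= energy p u.
Proof.
move=> /D1p_grad[G [cu uG fG ->]] cf FL f1.
have cF := quadratic_remainder_continuous FL.
have wG : is_weak_grad (F \o u) (fun x => f (u x) *: G x).
  move=> i; under [X in is_weak_partial _ _ X]eq_fun do rewrite mxE.
  exact: weak_partial_comp cu (uG i) cf FL.
apply: D1p_intro wG fG _.
  by move=> x; apply: continuous_comp; [exact: cu|exact: cF].
move=> x; apply: powR_mono; rewrite ?enorm_ge0 ?(ltW p0)// enormZ.
by rewrite ler_piMl// enorm_ge0.
Qed.

Lemma D1p_trunc (d : R) u : 0 < d -> D1p p u ->
  D1p p (trunc d \o u) /\ energy p (trunc d \o u) <= energy p u.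
Proof.
move=> d0 Du; apply: D1p_comp Du (continuous_dtrunc d0) (quadratic_remainder_trunc d0) _.
by move=> t; rewrite ger0_norm ?dtrunc_ge0// dtrunc_le1.
Qed.

(** A truncation from above: the result equals u where u <= d, and for u >= 0 it is at most 2 d by
    [subtrunc_le]. *)
Lemma D1p_subtrunc (d : R) u : 0 < d -> D1p p u ->
  D1p p (fun x => u x - trunc d (u x)) /\
  energy p (fun x => u x - trunc d (u x)) <= energy p u.
Proof.
move=> d0 Du.
have := D1p_comp (F := fun t => t - trunc d t) (f := fun t => 1 - dtrunc d t) (L := d^-1) Du.
apply.
- by move=> t; apply: cvgB; [exact: cvg_cst|exact: continuous_dtrunc].
- move=> s t; have -> : t - trunc d t - (s - trunc d s) - (1 - dtrunc d s) * (t - s) =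
    - (trunc d t - trunc d s - dtrunc d s * (t - s)) by ring.
  by rewrite normrN; exact: quadratic_remainder_trunc.
- move=> t; have := dtrunc_ge0 t d0; have := dtrunc_le1 t d0.
  by rewrite ler_norml => ? ?; apply/andP; split; lra.
Qed.

Lemma test_function_D1p chi : test_function chi -> D1p p chi.
Proof.
move=> tc; have [sc _] := tc; have cc := test_function_continuous tc.
apply/(D1pP _ p1); split => //; exists (fun x => \row_i partial i chi x).
have wc : is_weak_grad chi (fun x => \row_i partial i chi x).
  by move=> i; under [X in is_weak_partial _ _ X]eq_fun do rewrite mxE; exact: smooth_weak_partial.
split => //; have /test_functionP[_ [N N0 hN]] := tc.
apply: (bounded_support_locally_integrable (N := N)); last first.
  move=> x; apply: contraNT; rewrite -ltNge => Nx; rewrite (_ : \row_i _ = 0).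
    by rewrite enorm0 powR0 ?(gt_eqF p0).
  apply/rowP => i; rewrite !mxE; apply/eqP; apply: contraTT Nx => h.
  by rewrite -leNgt; exact: (partial_support hN h).
have cd i : continuous (partial i chi) by apply: test_function_continuous; exact: test_function_partial.
have [M hM] : exists M, forall i x, `|partial i chi x| <= M.
  have /choice[M hM] : forall i, exists M, forall x, `|partial i chi x| <= M.
    move=> i; have [M M0 hM] := bounded_support_bounded (cd i) (partial_support hN).
    by exists M.
  exists (\sum_i `|M i|) => i x; apply: le_trans (hM i x) _.
  by rewrite (bigD1 i)//= ler_wpDr ?ler_norm// sumr_ge0.
have c1 : continuous (fun _ : E => n%:R `^ p * \sum_(i < n) `|M| `^ p) by exact: cst_continuous.
apply: rV_locally_integrable_le (continuous_locally_integrable c1) _.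
  by apply: measurable_enorm_powR; exact: measurable_weak_grad wc.
move=> x; rewrite (ger0_norm (powR_ge0 _ _)); apply: le_trans (ler_norm _).
apply: le_trans (enorm_powR_le _ p0) _; rewrite ler_wpM2l ?powR_ge0//.
apply: ler_sum => i _; apply: powR_mono => //; first exact: ltW.
by rewrite mxE; apply: le_trans (hM i x) (ler_norm _).
Qed.

(** The gradient is chi Dv + v Dchi, with |chi| <= 1 and |v| <= B; [powRD_le] separates the two
    terms. *)
Lemma D1p_cutoff (l B : R) v chi : 0 < l < 1 -> D1p p v -> (forall x, `|v x| <= B) ->
  test_function chi -> (forall x, `|chi x| <= 1) ->
  D1p p (fun x => v x * chi x) /\ energy p (fun x => v x * chi x) <=
    (1 - l) `^ (1 - p) * energy p v + l `^ (1 - p) * (B `^ p * energy p chi).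
Proof.
move=> l01 /D1p_grad[G [cv vG fG ->]] vB tc chi1; have [sc _] := tc.
have Dc := test_function_D1p tc; have cc := test_function_continuous tc.
have wc : is_weak_grad chi (fun x => \row_i partial i chi x).
  by move=> i; under [X in is_weak_partial _ _ X]eq_fun do rewrite mxE; exact: smooth_weak_partial.
have fC : finite_energy p (fun x => \row_i partial i chi x).
  have [G' [_ cG' fG' _]] := D1p_grad Dc.
  apply: finite_energy_ae (measurable_weak_grad cG') (measurable_weak_grad wc) _ fG'.
  exact: weak_grad_unique.
rewrite (energyE p wc).
have wH : is_weak_grad (fun x => v x * chi x)
    (fun x => chi x *: G x + v x *: \row_i partial i chi x).
  move=> i; have := weak_partialM (continuous_locally_integrable cv) (vG i) sc.
  by congr is_weak_partial; apply/funext => x; rewrite !mxE mulrC.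
have I1 := integrableZl measurableT ((1 - l) `^ (1 - p)) fG.
have I2 := integrableZl measurableT (B `^ p) fC.
have I3 := integrableZl measurableT (l `^ (1 - p)) I2.
rewrite -!RintegralZl// -RintegralD//; apply: D1p_intro wH _ _.
- exact: continuous_mulf.
- exact: (integrableD measurableT I1 I3).
- move=> x; have B0 : 0 <= B := le_trans (normr_ge0 _) (vB x).
  rewrite -powRM ?enorm_ge0//.
  apply: le_trans (powRD_le p1 (enorm_ge0 _) (mulr_ge0 B0 (enorm_ge0 _)) l01).
  apply: powR_mono; rewrite ?enorm_ge0 ?(ltW p0)//.
  apply: le_trans (enormD _ _) _; rewrite !enormZ.
  by apply: lerD; [rewrite ler_piMl// enorm_ge0|rewrite ler_wpM2r// enorm_ge0].
Qed.

End D1p_calculus.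

(** * Reflections and distances *)

Section geometry.
Context {R : realType} {n : nat}.
Local Notation E := 'rV[R]_n.
Implicit Types (x y z a e : E) (i j : 'I_n) (Omega : set E).

Lemma trmxZ (c : R) x : (c *: x)^T = c *: x^T.
Proof. by apply/matrixP => i j; rewrite !mxE. Qed.

(** For a unit vector a, the Householder reflection in the hyperplane orthogonal to a, acting on
    rows from the right. *)
Definition reflection a : 'M[R]_n := 1%:M - 2 *: (a^T *m a).

Lemma reflectionE a x : x *m reflection a = x - (2 * (x *m a^T) ord0 ord0) *: a.
Proof.
rewrite mulmxBr mulmx1 -scalemxAr mulmxA [x *m a^T]mx11_scalar mul_scalar_mx.
by rewrite scalerA [_%:M _ _]mxE eqxx mulr1n.
Qed.

Lemma enorm1_mx a : enorm a = 1 -> a *m a^T = 1%:M.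
Proof. by move=> a1; rewrite [LHS]mx11_scalar -enorm_sqr_mx a1 expr1n. Qed.

Lemma reflection_orthogonal a : enorm a = 1 -> reflection a *m (reflection a)^T = 1%:M.
Proof.
move=> /enorm1_mx a1; have -> : (reflection a)^T = reflection a.
  by rewrite /reflection linearB/= linearZ/= trmx_mul trmxK trmx1.
rewrite {2}/reflection mulmxBr mulmx1 -scalemxAr mulmxA {2}/reflection mulmxBl mul1mx.
rewrite -scalemxAl -mulmxA a1 mulmx1 mulmxBl -scalemxAl /reflection.
rewrite scalerBr scalerA -addrA -opprD; apply/eqP; rewrite subr_eq addrC -subr_eq0.
apply/eqP/matrixP => i j; rewrite !mxE; ring.
Qed.

(** The reflection in the bisecting hyperplane of e and a, whose unit normal is b, exchanges
    them. *)
Lemma orthogonal_transitive e a : enorm e = 1 -> enorm a = 1 ->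
  exists2 Q : 'M[R]_n, Q *m Q^T = 1%:M & e *m Q = a.
Proof.
move=> e1 a1; have [->|ea] := eqVneq e a; first by exists 1%:M; rewrite ?orthogonal1 ?mulmx1.
have s0 : 0 < enorm (e - a) by rewrite enorm_gt0 subr_eq0.
pose b := (enorm (e - a))^-1 *: (e - a); have b1 : enorm b = 1.
  by rewrite enormZ gtr0_norm ?invr_gt0// mulVf ?gt_eqF.
exists (reflection b); first exact: reflection_orthogonal.
have -> : e *m reflection b = e -
    ((2 * ((enorm (e - a))^-1 * (e *m (e - a)^T) ord0 ord0)) * (enorm (e - a))^-1) *: (e - a).
  have -> : (enorm (e - a))^-1 * (e *m (e - a)^T) ord0 ord0 = (e *m b^T) ord0 ord0.
    by rewrite /b trmxZ -scalemxAr [RHS]mxE.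
  by rewrite reflectionE {2}/b scalerA.
(* Because e and a have the same length; it makes the coefficient of e - a equal to 1. *)
have sE : enorm (e - a) ^+ 2 = 2 * (e *m (e - a)^T) ord0 ord0.
  rewrite enorm_sqr_mx linearB/= !mulmxBr !mulmxBl (enorm1_mx e1) (enorm1_mx a1).
  have -> : a *m e^T = e *m a^T.
    apply/matrixP => i j; rewrite !ord1 !mxE; apply: eq_bigr => k _.
    by rewrite !mxE mulrC.
  by rewrite !mxE; ring.
rewrite [X in X *: _](_ : _ = 1) ?scale1r ?subKr//.
by rewrite mulrCA -sE expr2 mulrA mulVf ?gt_eqF// mul1r mulfV ?gt_eqF.
Qed.

Lemma has_lbound_dist Omega x : has_lbound [set enorm (x - y) | y in ~` Omega].
Proof. by exists 0 => _ [y _ <-]; exact: enorm_ge0. Qed.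

Lemma dist_compl_le Omega x y : ~ Omega y -> dist_compl Omega x <= enorm (x - y).
Proof. by move=> Oy; apply: ge_inf; [exact: has_lbound_dist|exists y]. Qed.

Lemma dist_compl_ge0 Omega x : 0 <= dist_compl Omega x.
Proof.
have [[y Oy]|/nonemptyPn h] := pselect ((~` Omega) !=set0).
  by apply: lb_le_inf; [exists (enorm (x - y)), y|move=> _ [z _ <-]; exact: enorm_ge0].
by rewrite /dist_compl h image_set0 inf0.
Qed.

Lemma setC_nonempty Omega : Omega <> setT -> exists y, ~ Omega y.
Proof.
move=> h; apply/existsNP => h'; apply: h.
by apply/seteqP; split => x // _; exact: h'.
Qed.

Lemma norm_le_enorm x : `|x| <= enorm x.
Proof. by apply: rV_norm_le => [|i]; [exact: enorm_ge0|exact: coord_le_enorm]. Qed.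

(** The infimum is decided among the points of the complement no farther from x than a given one y1,
    and these lie in the compact set K. *)
Lemma dist_compl_attained Omega x : open Omega -> Omega <> setT ->
  exists2 y, ~ Omega y & dist_compl Omega x = enorm (x - y).
Proof.
move=> oO /setC_nonempty[y1 Oy1].
pose K := ~` Omega `&` [set y : E | `|y| <= `|x| + enorm (x - y1)].
have cN := @compact_norm_le R n (`|x| + enorm (x - y1)).
have cK : compact K.
  apply: (subclosed_compact _ cN) => [|y []//].
  apply: closedI; first exact: open_closedC.
  by apply: (compact_closed _ cN); exact: norm_hausdorff.
have Kin y : enorm (x - y) <= enorm (x - y1) -> ~ Omega y -> K y.
  move=> h Oy; split => //=; rewrite -[y](subKr x); apply: le_trans (ler_normB _ _) _.
  by rewrite lerD2l; apply: le_trans (norm_le_enorm _) h.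
have cx : continuous (fun y : E => enorm (x - y)).
  under eq_fun do rewrite enormB -[X in X - _]mulmx1.
  move=> y; apply: (@continuous_comp _ _ _ (fun y => y *m 1%:M - x)); last exact: continuous_enorm.
  exact: continuous_mulmxD.
have K0 : K !=set0 by exists y1; exact: Kin.
have [y /set_mem[Oy _] hy] := EVT_min_rV K0 cK (continuous_subspaceT cx).
exists y => //; apply/eqP; rewrite eq_le dist_compl_le//=.
apply: lb_le_inf; first by exists (enorm (x - y)), y.
move=> _ [z Oz <-]; have [h|/ltW h] := leP (enorm (x - z)) (enorm (x - y1)).
  by apply: hy; rewrite inE; exact: Kin.
by apply: le_trans h; apply: hy; rewrite inE; exact: Kin.
Qed.

Lemma dist_compl_gt0 Omega x : open Omega -> Omega <> setT -> Omega x ->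
  0 < dist_compl Omega x.
Proof.
move=> oO OT Ox; have [y Oy ->] := dist_compl_attained x oO OT.
by rewrite enorm_gt0 subr_eq0; apply: contra_notN Oy => /eqP <-.
Qed.

Lemma ball_dist_compl Omega x y : enorm (y - x) < dist_compl Omega x -> Omega y.
Proof.
move=> h; apply: contrapT => Oy; have := dist_compl_le x Oy.
by rewrite enormB leNgt h.
Qed.

Lemma dist_compl_punctured x : dist_compl (~` [set (0 : E)]) x = enorm x.
Proof.
rewrite /dist_compl setCK.
by rewrite (_ : [set _ | _ in _] = [set enorm x]) ?inf1// image_set1 subr0.
Qed.

Lemma half_spaceE j : j.+1 = n -> @half_space R n = [set x | 0 < x ord0 j].
Proof.
move=> jn; apply/seteqP; split => [x h|x h i ni]; first exact: h.
by rewrite (_ : i = j)//; apply: val_inj; apply: succn_inj; rewrite jn.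
Qed.

Lemma enorm_delta j : enorm (delta_mx ord0 j : E) = 1.
Proof.
rewrite /enorm (bigD1 j)//= big1 => [|i ij]; rewrite !mxE !eqxx/= ?expr1n ?addr0 ?sqrtr1//.
by rewrite (negbTE ij) expr0n.
Qed.

Lemma dist_compl_half j x : j.+1 = n -> 0 < x ord0 j ->
  dist_compl (@half_space R n) x = x ord0 j.
Proof.
move=> jn x0; rewrite (half_spaceE jn); set z := x - x ord0 j *: delta_mx ord0 j.
have zj : z ord0 j = 0 by rewrite !mxE !eqxx mulr1 subrr.
have Oz : ~ (0 < z ord0 j) by rewrite zj ltxx.
apply/eqP; rewrite eq_le; apply/andP; split.
  apply: le_trans (dist_compl_le x (Omega := [set x | 0 < x ord0 j]) Oz) _.
  by rewrite /z subKr enormZ enorm_delta mulr1 gtr0_norm.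
apply: lb_le_inf; first by exists (enorm (x - z)), z.
move=> _ [y /= /negP Oy <-]; apply: le_trans (coord_le_enorm _ j); rewrite !mxE.
apply: le_trans (ler_norm _); rewrite lerBrDr gerDl leNgt; exact/negP/negP.
Qed.

Lemma open_half j : open [set x : E | 0 < x ord0 j].
Proof.
have -> : [set x : E | 0 < x ord0 j] = (fun x : E => x ord0 j) @^-1` [set t | 0 < t] by [].
by apply: open_comp; [move=> x _; exact: coord_continuous|exact: open_gt].
Qed.

Lemma half_neqT j : [set x : E | 0 < x ord0 j] <> setT.
Proof. by move/seteqP => [_ /(_ 0 I)] /=; rewrite mxE ltxx. Qed.

Lemma open_punctured : open (~` [set (0 : E)]).
Proof. by apply: closed_openC; apply: accessible_closed_set1; apply: hausdorff_accessible; exact: norm_hausdorff. Qed.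

Lemma punctured_neqT : ~` [set (0 : E)] <> setT.
Proof. by move/seteqP => [_ /(_ 0 I)]; exact. Qed.

End geometry.

(** * Morrey and Hardy bounds *)

Section powR_limits.
Context {R : realType}.
Implicit Types a q : R.

Lemma powR_cvg (a_ : nat -> R) a q : 0 < a -> a_ @ \oo --> a ->
  a_ k `^ q @[k --> \oo] --> a `^ q.
Proof.
move=> a0 h; apply: (cvg_comp a_ (fun t => t `^ q) h).
have [d _] := is_derive1_powR q a0.
have : {for a, continuous (fun t => t `^ q)} by apply/differentiable_continuous/derivable1_diffP.
exact.
Qed.

Lemma invS_powR_cvg0 q : 0 < q -> (k.+1%:R^-1 : R) `^ q @[k --> \oo] --> (0 : R).
Proof.
move=> q0; apply: cvg_comp (powR_cvg0 q0) => A [e /= e0 eA].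
near=> k; apply: eA => /=; last by rewrite invr_gt0.
rewrite /ball_/= sub0r normrN gtr0_norm ?invr_gt0//.
by near: k; exact: (@near_infty_natSinv_lt _ (PosNum e0)).
Unshelve. all: by end_near. Qed.

End powR_limits.

Section bounds.
Context {R : realType} {n : nat}.
Local Notation E := 'rV[R]_n.
Local Notation mu := (rV_lebesgue R n).
Implicit Types (u v w h : E -> R) (G : E -> E) (x y z : E) (Omega : set E) (p K : R).

(** The inequality raised to the power p and cleared of denominators: p (1 - n / p) = p - n, and the
    case x = y is harmless for K >= 0. *)
Definition morrey_bound p K := forall u, D1p p u -> forall x y,
  `|u x - u y| `^ p <= K * enorm (x - y) `^ (p - n%:R) * energy p u.

Definition hardy_bound p Omega K := forall u, D1p0 p Omega u -> forall x, Omega x ->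
  `|u x| `^ p <= K * dist_compl Omega x `^ (p - n%:R) * energy p u.

Variables (p : R) (j : 'I_n).
Hypotheses (np : n%:R < p) (jn : j.+1 = n).

Let n1 : 1 <= n%:R :> R. Proof. by rewrite ler1n -jn. Qed.
Let p1 : 1 <= p. Proof. exact/ltW/(le_lt_trans n1). Qed.
Let p0 : 0 < p. Proof. exact: lt_le_trans p1. Qed.
Let q0 : 0 < p - n%:R. Proof. by rewrite subr_gt0. Qed.
Local Notation ej := (delta_mx ord0 j : E).
Local Notation rho := (similarity 1 (reflection ej) 0).

Lemma rhoE x : rho x = x - (2 * x ord0 j) *: ej.
Proof.
rewrite /similarity scale1r addr0 reflectionE; congr (_ - (2 * _) *: _).
by rewrite mxE (bigD1 j)//= big1 ?addr0 => [|i ij]; rewrite !mxE !eqxx/= ?mulr1// (negbTE ij) mulr0.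
Qed.

Lemma rho_j x : (rho x) ord0 j = - x ord0 j.
Proof. by rewrite rhoE !mxE !eqxx/= mulr1; ring. Qed.

Lemma rho_fix x : x ord0 j = 0 -> rho x = x.
Proof. by move=> x0; rewrite rhoE x0 mulr0 scale0r subr0. Qed.

Let rho_orth : reflection ej *m (reflection ej)^T = 1%:M.
Proof. by apply: reflection_orthogonal; exact: enorm_delta. Qed.

Lemma bound_ge0 K (c : R) u : 0 <= K -> 0 <= K * c `^ (p - n%:R) * energy p u.
Proof. by move=> K0; rewrite !mulr_ge0 ?powR_ge0// energy_ge0. Qed.

(** Origin of the constant: passing to the odd function doubles the difference of values (2^p), the
    distance (2^(p - n)) and the energy (2). What remains is 2^(n - 1). *)
Lemma two_powR : 2 ^+ n.-1 * 2 `^ (p - n%:R) * 2 = 2 `^ p :> R.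
Proof.
have nE : n.-1%:R + 1 = n%:R :> R by rewrite natr1 prednK// -jn.
have -> : (2 : R) `^ p = 2 `^ (n.-1%:R + (p - n%:R) + 1).
  by congr (_ `^ _); rewrite addrAC nE addrC subrK.
by rewrite !powRD ?pnatr_eq0 ?implybT// powR_mulrn// powRr1.
Qed.

Lemma morrey_hardy Omega K : open Omega -> Omega <> setT ->
  morrey_bound p K -> hardy_bound p Omega K.
Proof.
move=> oO OT MK u [Du u0] x Ox; have [y Oy ->] := dist_compl_attained x oO OT.
by have := MK u Du x y; rewrite (u0 y Oy) subr0.
Qed.

Lemma hardy_punctured_morrey K : 0 <= K ->
  hardy_bound p (~` [set (0 : E)]) K -> morrey_bound p K.
Proof.
move=> K0 HK u Du x y; have [->|xy] := eqVneq x y.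
  by rewrite !subrr normr0 powR0 ?(gt_eqF p0)//; exact: bound_ge0.
have [D1 E1] := D1p_similarity p1 y ltr01 orthogonal1 Du.
have [D2 E2] := D1p_addc p1 (- u y) D1.
have := HK (fun z => (u \o similarity 1 1%:M y) z + - u y).
rewrite E2 E1 powR1 mul1r => /(_ _ (x - y)).
rewrite dist_compl_punctured /= similarity1E subrK; apply; last by apply/eqP; rewrite subr_eq0.
split; first exact: D2.
by move=> z /contrapT ->; rewrite similarity1E add0r subrr.
Qed.

(** The Morrey bound is applied at x and its mirror image, where the odd reflection of u differs by
    2 u(x) over the distance 2 x_j. *)
Lemma morrey_half K : morrey_bound p (2 ^+ n.-1 * K) ->
  hardy_bound p (@half_space R n) K.
Proof.
move=> MK u [Du u0] x hx.
have xj : 0 < x ord0 j by move: hx; rewrite (half_spaceE jn).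
rewrite (dist_compl_half jn xj).
have un y : y ord0 j <= 0 -> u y = 0.
  by move=> yj; apply: u0; rewrite (half_spaceE jn) /=; apply/negP; rewrite -leNgt.
have [DR ER] := D1p_similarity p1 0 ltr01 rho_orth Du.
have [DN EN] := D1pZ p1 (-1) DR.
have [y|Dv Ev] := D1pD_disjoint p1 Du DN.
  have [y0|/ltW y0] := leP (y ord0 j) 0; first by left; exact: un.
  by right; rewrite /= un ?mulr0// rho_j oppr_le0.
move: Ev; rewrite EN ER normrN normr1 !powR1 !mul1r => Ev.
have := MK _ Dv x (rho x); rewrite Ev {DR ER DN EN Dv Ev}.
rewrite [X in `|X|](_ : _ = 2 * u x); last first.
  have rr : rho (rho x) = x.
    by rewrite {1}rhoE rho_j rhoE mulrN scaleNr opprK subrK.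
  by rewrite /= rr (un (rho x)) ?rho_j ?oppr_le0 ?ltW//; ring.
have -> : x - rho x = (2 * x ord0 j) *: ej by rewrite rhoE subKr.
rewrite enormZ enorm_delta mulr1 normrM (ger0_norm (ler0n R 2)).
have x2 : 0 < 2 * x ord0 j by exact: mulr_gt0.
rewrite (gtr0_norm x2) !powRM ?(ltW xj)//.
have -> : 2 ^+ n.-1 * K * (2 `^ (p - n%:R) * x ord0 j `^ (p - n%:R)) * (energy p u + energy p u) =
    2 `^ p * (K * x ord0 j `^ (p - n%:R) * energy p u) by rewrite -two_powR; ring.
by rewrite ler_pM2l// powR_gt0.
Qed.

Lemma measurable_coord_gt0 (c : R) : measurable_fun setT (fun x : E => (0 < c * x ord0 j)%R%:R : R).
Proof.
have -> : (fun x : E => (0 < c * x ord0 j)%R%:R : R) = \1_[set x : E | 0 < c * x ord0 j].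
  by apply/funext => x; rewrite indicE; congr (_%:R); rewrite (mem_setE (fun x : E => 0 < c * x ord0 j)).
apply: measurable_indic; apply: open_measurable_rV.
have -> : [set x : E | 0 < c * x ord0 j] = (fun x : E => c * x ord0 j) @^-1` [set t | 0 < t] by [].
apply: open_comp; last exact: open_gt.
by move=> x _; apply: (continuous_scalef (u := fun x : E => x ord0 j)); exact: coord_continuous.
Qed.

(** Folds the integral over the space onto one side of the hyperplane. It is an inequality because
    the left integrand omits the points with x_j = 0. *)
Lemma fold_integral h : mu.-integrable setT (EFin \o h) -> (forall x, 0 <= h x) ->
  mu.-integrable setT (EFin \o (fun x => (0 < x ord0 j)%R%:R * (h x + h (rho x)))) /\
  \int[mu]_x ((0 < x ord0 j)%R%:R * (h x + h (rho x))) <= \int[mu]_x h x.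
Proof.
move=> Ih h0; pose k (c : R) x : R := (0 < c * x ord0 j)%R%:R * h x.
have b01 (b : bool) : 0 <= (b%:R : R) <= 1 by case: b; rewrite /= ?ler01 lexx.
have mh : measurable_fun setT h by apply/measurable_EFinP; case/integrableP: Ih.
have Ik c : mu.-integrable setT (EFin \o k c).
  apply: le_integrable Ih => //.
    by apply/measurable_EFinP; apply: measurable_funM => //; exact: measurable_coord_gt0.
  move=> x _ /=; rewrite lee_fin normrM ler_piMl//.
  by have /andP[b0 b1] := b01 (0 < c * x ord0 j)%R; rewrite ger0_norm.
have IkR := integrable_similarity 0 ltr01 rho_orth (Ik (-1)).
have e : (fun x => (0 < x ord0 j)%R%:R * (h x + h (rho x))) = (fun x => k 1 x + k (-1) (rho x)).
  by apply/funext => x; rewrite /k rho_j mul1r mulrNN mul1r mulrDr.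
rewrite e; split; first exact: (integrableD measurableT (Ik 1) IkR).
rewrite (RintegralD measurableT (Ik 1) IkR).
rewrite (Rintegral_similarity 0 ltr01 rho_orth (Ik (-1))) expr1n invr1 mul1r.
rewrite -(RintegralD measurableT (Ik 1) (Ik (-1))).
apply: le_Rintegral => //; first exact: (integrableD measurableT (Ik 1) (Ik (-1))).
move=> x _; rewrite /k -mulrDl mul1r mulN1r oppr_gt0 ler_piMl// -natrD.
by case: (ltgtP (x ord0 j) 0); rewrite ?ler01.
Qed.

Lemma is_weak_grad_half_trunc (d : R) v G : 0 < d -> continuous v ->
  (forall x, x ord0 j = 0 -> v x = 0) -> is_weak_grad v G ->
  is_weak_grad (half_trunc j d v) (fun x => ((0 < x ord0 j)%R%:R * dtrunc d (v x)) *: G x).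
Proof.
move=> d0 cv v0 vG i; under [X in is_weak_partial _ _ X]eq_fun do rewrite mxE -mulrA.
exact: weak_partial_half_trunc.
Qed.

Let half_gt0 : 0 < 2^-1 :> R. Proof. by rewrite invr_gt0. Qed.

Lemma powR_midpoint (a b : R) : 0 <= a -> 0 <= b ->
  (2^-1 * (a + b)) `^ p <= 2^-1 * (a `^ p + b `^ p).
Proof.
move=> a0 b0; have h01 : 0 < (2^-1 : R) < 1 by apply/andP; split; lra.
have h0 : 0 <= 2^-1 :> R by exact: ltW.
have := powRD_le p1 (mulr_ge0 h0 a0) (mulr_ge0 h0 b0) h01.
rewrite -mulrDr => /le_trans; apply.
have -> : 1 - 2^-1 = 2^-1 :> R by field.
rewrite -mulrDr !(powRM _ h0)// -mulrDr mulrA -powRD ?subrK ?powRr1//.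
by rewrite invr_neq0 ?implybT.
Qed.

(** Here b is the indicator of the half-space, t a value of [dtrunc], and X, Y are the gradients of
    u at a point and at its mirror image. Convexity at the midpoint produces the factor 1/2. *)
Lemma half_trunc_grad_le (b : bool) (t : R) (X Y : E) (Q : 'M[R]_n) :
  Q *m Q^T = 1%:M -> 0 <= t <= 1 ->
  enorm ((b%:R * t) *: (2^-1 *: (X + -1 *: (1 *: (Y *m Q))))) `^ p <=
  2^-1 * (b%:R * (enorm X `^ p + enorm Y `^ p)).
Proof.
move=> QQ /andP[t0 t1]; case: b; last first.
  by rewrite !mul0r scale0r enorm0 powR0 ?(gt_eqF p0)// mulr0.
rewrite !mul1r enormZ (ger0_norm t0) enormZ (gtr0_norm half_gt0).
apply: le_trans (powR_midpoint (enorm_ge0 X) (enorm_ge0 Y)).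
apply: powR_mono; rewrite ?(ltW p0)//.
  by rewrite !mulr_ge0 ?enorm_ge0 ?(ltW half_gt0).
apply: le_trans (_ : 2^-1 * enorm (X + -1 *: (1 *: (Y *m Q))) <= _).
  by rewrite ler_piMl// mulr_ge0 ?enorm_ge0 ?(ltW half_gt0).
rewrite ler_pM2l//; apply: le_trans (enormD _ _) _.
by rewrite lerD2l scaleN1r enormN scale1r enorm_mulmx.
Qed.

Definition odd_part u x : R := 2^-1 * (u x + -1 * (u \o rho) x).

(** The pointwise bound is half the sum of |Du|^p at x and at its mirror image, on one side only; by
    [fold_integral] this integrates to at most half of the energy. *)
Lemma D1p_odd_part (d : R) u : 0 < d -> D1p p u ->
  D1p p (half_trunc j d (odd_part u)) /\
  energy p (half_trunc j d (odd_part u)) <= 2^-1 * energy p u.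
Proof.
move=> d0 Du; have [G [cu uG fG ->]] := D1p_grad p1 Du.
have wR := is_weak_grad_similarity 0 ltr01 rho_orth (continuous_locally_integrable cu) uG.
have cR : continuous (u \o rho).
  by move=> x; apply: continuous_comp; [exact: continuous_similarity|exact: cu].
have cNR := continuous_scalef (c := -1) cR.
have wv := is_weak_gradZ 2^-1 (continuous_addf cu cNR)
  (is_weak_gradD cu cNR uG (is_weak_gradZ (-1) cR wR)).
have cv := continuous_scalef (c := 2^-1) (continuous_addf cu cNR).
have v0 x : x ord0 j = 0 -> odd_part u x = 0.
  by move=> x0; rewrite /odd_part /= (rho_fix x0) mulN1r subrr mulr0.
have ww := is_weak_grad_half_trunc d0 cv v0 wv.
have [If le] := fold_integral fG (fun x => powR_ge0 _ _).
have If2 := integrableZl measurableT 2^-1 If.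
have le2 := ler_wpM2l (ltW half_gt0) le.
have [|D le3] := D1p_intro p1 (continuous_half_trunc d0 cv v0) ww If2.
  move=> x; apply: half_trunc_grad_le; first by rewrite trmxK; exact: trQQ.
  by rewrite dtrunc_ge0// dtrunc_le1.
split; first exact: D.
by apply: le_trans le3 _; rewrite (RintegralZl _ measurableT If).
Qed.

Lemma half_trunc_D1p0 (d : R) v : 0 < d -> D1p p (half_trunc j d v) ->
  D1p0 p (@half_space R n) (half_trunc j d v).
Proof.
move=> d0 Dv; split; first exact: Dv.
by move=> x; rewrite (half_spaceE jn) /half_trunc => /negP /negbTE ->; rewrite mul0r.
Qed.

(** At t e_j the odd part takes the value c, half the difference of u at the two mirror points. The
    bound for its truncations passes to the limit d -> 0. *)
Lemma half_odd_bound K u (t : R) : 0 <= K -> hardy_bound p (@half_space R n) K ->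
  D1p p u -> 0 < t -> u (- (t *: ej)) < u (t *: ej) ->
  (2^-1 * (u (t *: ej) - u (- (t *: ej)))) `^ p <=
  K * t `^ (p - n%:R) * (2^-1 * energy p u).
Proof.
move=> K0 HK Du t0 lt; set c := 2^-1 * _.
have c0 : 0 < c by rewrite mulr_gt0// subr_gt0.
have tj : (t *: ej) ord0 j = t by rewrite !mxE !eqxx mulr1.
have oE : odd_part u (t *: ej) = c.
  rewrite /odd_part /= rhoE tj mulN1r; congr (_ * (_ - u _)).
  by rewrite -scalerBl; have -> : t - 2 * t = - t by [ring]; rewrite scaleNr.
have b d : 0 < d -> trunc d c `^ p <= K * t `^ (p - n%:R) * (2^-1 * energy p u).
  move=> d0; have [Dw Ew] := D1p_odd_part d0 Du.
  have tjp : 0 < (t *: ej) ord0 j by rewrite tj.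
  have hx : @half_space R n (t *: ej) by rewrite (half_spaceE jn).
  have := HK _ (half_trunc_D1p0 d0 Dw) _ hx.
  rewrite (dist_compl_half jn tjp) {1}/half_trunc oE tj t0 mul1r.
  rewrite (ger0_norm (trunc_ge0 _ d0)) => /le_trans; apply.
  by rewrite ler_wpM2l// mulr_ge0 ?powR_ge0.
have cv : trunc k.+1%:R^-1 c @[k --> \oo] --> c.
  by have := @trunc_cvg R c; rewrite (max_idPl (ltW c0)).
apply: (ler_cvg_to (powR_cvg (q := p) c0 cv) (cvg_cst _)).
by apply: nearW => k; apply: b; rewrite invr_gt0.
Qed.

Lemma half_morrey K : 0 <= K -> hardy_bound p (@half_space R n) K ->
  morrey_bound p (2 ^+ n.-1 * K).
Proof.
move=> K0 HK u Du.
have H x y : u y < u x ->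
    (u x - u y) `^ p <= 2 ^+ n.-1 * K * enorm (x - y) `^ (p - n%:R) * energy p u.
  move=> yx; have xy : x - y != 0.
    by rewrite subr_eq0; apply: contraTN yx => /eqP ->; rewrite ltxx.
  have s0 : 0 < enorm (x - y) by rewrite enorm_gt0.
  set s := enorm (x - y) in s0 *.
  have s1 : enorm (s^-1 *: (x - y)) = 1.
    by rewrite enormZ gtr0_norm ?invr_gt0// mulVf ?gt_eqF.
  (* Q turns e_j into the direction of x - y, and b below is the midpoint: the points (s / 2) e_j
     and -(s / 2) e_j go to x and y, and the hyperplane x_j = 0 goes to their bisector. *)
  have [Q QQ eQ] := orthogonal_transitive (enorm_delta j) s1.
  pose b := 2^-1 *: (x + y).
  have [D1 E1] := D1p_similarity p1 b ltr01 QQ Du.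
  have e1 : (s / 2) *: ej *m Q = 2^-1 *: (x - y).
    by rewrite -scalemxAl eQ scalerA; congr (_ *: _); field; rewrite gt_eqF.
  have Sx : similarity 1 Q b ((s / 2) *: ej) = x.
    by rewrite /similarity scale1r e1; apply/rowP => i; rewrite !mxE; field.
  have Sy : similarity 1 Q b (- ((s / 2) *: ej)) = y.
    by rewrite /similarity scale1r mulNmx e1; apply/rowP => i; rewrite !mxE; field.
  have st : 0 < s / 2 by rewrite mulr_gt0// invr_gt0.
  have lt : (u \o similarity 1 Q b) (- ((s / 2) *: ej)) <
      (u \o similarity 1 Q b) ((s / 2) *: ej) by rewrite /= Sx Sy.
  have := half_odd_bound K0 HK D1 st lt; rewrite /= Sx Sy E1 powR1 mul1r.
  have d0 : 0 <= u x - u y by rewrite subr_ge0 ltW.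
  have t0 : 0 <= 2^-1 :> R by exact: ltW.
  rewrite !powRM ?(ltW s0)// => h.
  have n0 : 0 < (2 `^ p : R) by rewrite powR_gt0.
  have n1' : (2 `^ p : R) * 2^-1 `^ p = 1 by rewrite -powRM// divff// powR1.
  have n2 : (2 `^ (p - n%:R) : R) * 2^-1 `^ (p - n%:R) = 1 by rewrite -powRM// divff// powR1.
  have := ler_wpM2l (ltW n0) h; rewrite [X in X <= _ -> _]mulrA n1' mul1r => /le_trans; apply.
  rewrite -two_powR le_eqVlt; apply/orP; left; apply/eqP.
  have -> : 2 ^+ n.-1 * K * s `^ (p - n%:R) * energy p u = 2 ^+ n.-1 * K * s `^ (p - n%:R) *
      (2 `^ (p - n%:R) * 2^-1 `^ (p - n%:R)) * energy p u by rewrite n2 mulr1.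
  by field.
move=> x y; have [|yx|e] := ltgtP (u x) (u y).
- move=> xy; rewrite ltr0_norm ?subr_lt0// opprB enormB; exact: H.
- by rewrite gtr0_norm ?subr_gt0//; exact: H.
- rewrite e subrr normr0 powR0 ?(gt_eqF p0)//; apply: bound_ge0.
  by rewrite mulr_ge0// exprn_ge0.
Qed.

End bounds.

(** * From an open set to the half-space *)

Section transplant.
Context {R : realType} {n : nat}.
Local Notation E := 'rV[R]_n.
Local Notation mu := (rV_lebesgue R n).
Implicit Types (u v w : E -> R) (x y z : E) (Omega : set E) (K : R).
Variables (p : R) (j : 'I_n).
Hypotheses (np : n%:R < p) (jn : j.+1 = n).
Local Notation ej := (delta_mx ord0 j : E).

Let n1 : 1 <= n%:R :> R. Proof. by rewrite ler1n -jn. Qed.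
Let p1 : 1 <= p. Proof. exact/ltW/(le_lt_trans n1). Qed.
Let p0 : 0 < p. Proof. exact: lt_le_trans p1. Qed.
Let q0 : 0 < p - n%:R. Proof. by rewrite subr_gt0. Qed.

Lemma enorm_subdelta x (L : R) :
  enorm (x - L *: ej) ^+ 2 = enorm x ^+ 2 - 2 * L * x ord0 j + L ^+ 2.
Proof.
rewrite !enorm_sqr (bigD1 j)//= [in RHS](bigD1 j)//= !mxE !eqxx/= mulr1.
rewrite (eq_bigr (fun i => x ord0 i ^+ 2)); first by ring.
by move=> i ij; rewrite !mxE eqxx (negbTE ij) mulr0 subr0.
Qed.

(** Since |x - z - L e_j|^2 = |x - z|^2 - 2 L x_j + L^2, a point with |x - z| <= B and x_j >= c lies
    in the ball as soon as B^2 < 2 L c. *)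
Lemma tangent_ball (N c : R) z : 0 < c -> z ord0 j = 0 ->
  exists2 L : R, 0 < L & forall x, `|x| <= N -> c <= x ord0 j ->
    enorm (x - z - L *: ej) < L.
Proof.
move=> c0 z0; pose B := n%:R * `|N| + enorm z.
have B0 : 0 <= B by rewrite addr_ge0 ?enorm_ge0// mulr_ge0.
(* This gives 2 L c = B^2 + 2 c. *)
exists (B ^+ 2 / (2 * c) + 1).
  by rewrite ltr_wpDl// divr_ge0 ?sqr_ge0// mulr_ge0// ltW.
set L := _ + 1 => x xN xc; have L0 : 0 < L.
  by rewrite ltr_wpDl// divr_ge0 ?sqr_ge0// mulr_ge0// ltW.
have xB : enorm (x - z) <= B.
  apply: le_trans (enormD _ _) _; rewrite enormN lerD2r.
  apply: le_trans (enorm_le_norm _) _; rewrite ler_wpM2l//.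
  exact: le_trans xN (ler_norm _).
rewrite -ltr_sqr ?nnegrE ?enorm_ge0 ?ltW// enorm_subdelta [(x - z) _ _]mxE [(- z) _ _]mxE z0 subr0.
have xB2 : enorm (x - z) ^+ 2 <= B ^+ 2 by rewrite ler_sqr ?nnegrE ?enorm_ge0.
have : B ^+ 2 < 2 * L * x ord0 j.
  apply: (@lt_le_trans _ _ (2 * L * c)); last by rewrite ler_pM2l// mulr_gt0.
  have -> : 2 * L * c = B ^+ 2 + 2 * c by rewrite /L; field; rewrite gt_eqF.
  by rewrite ltrDl mulr_gt0.
lra.
Qed.

(** S maps the ball about x0 that touches the complement at y0 onto a ball tangent to the hyperplane
    at the foot z0 of z and containing the support of w. So w o S is a competitor for Omega. The
    energy gains (L / r)^(p - n) and the distance (r / L)^(p - n), which cancel. *)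
Lemma hardy_transplant Omega K w (N c : R) z : open Omega -> Omega <> setT ->
  Omega !=set0 -> 0 <= K -> hardy_bound p Omega K -> D1p p w -> 0 < c ->
  (forall x, w x != 0 -> `|x| <= N /\ c <= x ord0 j) -> 0 < z ord0 j ->
  `|w z| `^ p <= K * z ord0 j `^ (p - n%:R) * energy p w.
Proof.
move=> oO OT [x0 Ox0] K0 HK Dw c0 sw zj.
have [y0 Oy0 dE] := dist_compl_attained x0 oO OT.
have r0 : 0 < enorm (x0 - y0) by rewrite -dE dist_compl_gt0.
set r := enorm (x0 - y0) in dE r0.
pose z0 := z - z ord0 j *: ej.
have z0j : z0 ord0 j = 0 by rewrite !mxE !eqxx mulr1 subrr.
have [L L0 hL] := tangent_ball N c0 z0j.
pose a := r^-1 *: (x0 - y0).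
have a1 : enorm a = 1 by rewrite enormZ gtr0_norm ?invr_gt0// mulVf ?gt_eqF.
have [Q QQ aQ] := orthogonal_transitive a1 (enorm_delta j).
pose b := z0 - (L / r) *: (y0 *m Q); pose S := similarity (L / r) Q b.
have Lr0 : 0 < L / r by rewrite divr_gt0.
have SE y : S y = (L / r) *: ((y - y0) *m Q) + z0.
  by rewrite /S /similarity /b mulmxBl scalerBr addrCA addrC.
have Sx0 : S x0 = L *: ej + z0.
  rewrite SE; have -> : x0 - y0 = r *: a by rewrite scalerA mulfV ?gt_eqF// scale1r.
  by rewrite -scalemxAl aQ scalerA divfK ?gt_eqF.
have [DS ES] := D1p_similarity p1 b Lr0 QQ Dw.
have supp y : w (S y) != 0 -> Omega y.
  move=> /sw[yN yc]; apply: (@ball_dist_compl _ _ Omega x0); rewrite dE.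
  have := hL _ yN yc; rewrite -addrA -opprD [z0 + _]addrC -Sx0 !SE.
  rewrite opprD addrACA subrr addr0 -scalerBr -mulmxBl opprB addrA subrK.
  rewrite enormZ (gtr0_norm Lr0) (enorm_mulmx _ QQ) -ltr_pdivlMl// => /lt_le_trans; apply.
  by rewrite le_eqVlt; apply/orP; left; apply/eqP; field; rewrite !gt_eqF.
(* The preimage of z under S, on the ray from y0 through x0. It may lie outside Omega, but then w z
   = 0; otherwise its distance to the complement is at most |ys - y0| = (r / L) z_j. *)
pose ys := y0 + (r / L * z ord0 j) *: a.
have ysE : ys - y0 = (r / L * z ord0 j) *: a by rewrite /ys addrC addKr.
have Sys : S ys = z.
  rewrite SE ysE -scalemxAl aQ scalerA /z0.
  have -> : L / r * (r / L * z ord0 j) = z ord0 j by field; rewrite !gt_eqF.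
  by rewrite addrC subrK.
have [Oys|nOys] := pselect (Omega ys); last first.
  have -> : w z = 0 by rewrite -Sys; apply/eqP; apply: contra_notT nOys => /supp.
  by rewrite normr0 powR0 ?(gt_eqF p0)// bound_ge0.
have D0 : D1p0 p Omega (w \o S).
  split; first exact: DS.
  by move=> y nOy; apply/eqP; apply: contra_notT nOy => /supp.
have := HK _ D0 _ Oys; rewrite /= Sys ES => /le_trans; apply.
have dy : dist_compl Omega ys <= r / L * z ord0 j.
  apply: le_trans (dist_compl_le ys Oy0) _.
  rewrite ysE enormZ a1 mulr1 gtr0_norm// mulr_gt0// divr_gt0//.
have := powR_mono (ltW q0) (dist_compl_ge0 _ _) dy.
have rL0 : 0 <= r / L by rewrite divr_ge0// ltW.
rewrite (powRM _ rL0 (ltW zj)) => hd.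
have e1 : (r / L) `^ (p - n%:R) * (L / r) `^ (p - n%:R) = 1.
  rewrite -powRM ?(ltW Lr0)//.
  have -> : r / L * (L / r) = 1 by field; rewrite !gt_eqF.
  by rewrite powR1.
have -> : K * z ord0 j `^ (p - n%:R) * energy p w =
    K * ((r / L) `^ (p - n%:R) * z ord0 j `^ (p - n%:R)) *
      ((L / r) `^ (p - n%:R) * energy p w).
  move: e1; move: (_ `^ _) (_ `^ _) => A B AB.
  by transitivity (K * z ord0 j `^ (p - n%:R) * energy p w * (B * A)); [rewrite AB mulr1|ring].
by rewrite ler_wpM2r ?ler_wpM2l// mulr_ge0 ?powR_ge0 ?energy_ge0.
Qed.

Lemma truncated_support u (N d : R) : continuous u ->
  (forall x, x ord0 j <= 0 -> u x = 0) -> 0 < d ->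
  exists2 c : R, 0 < c & forall x, `|x| <= N -> d <= u x -> c <= x ord0 j.
Proof.
move=> cu u0 d0; have u0' x : x ord0 j = 0 -> u x = 0 by move=> x0; rewrite u0// x0.
have [c c0 hc] := level_set_coord N d0 cu u0'; exists c => // x xN ux.
have [x0|x0] := leP (x ord0 j) 0; first by move: ux; rewrite u0// leNgt d0.
by have := hc _ xN ux; rewrite (gtr0_norm x0).
Qed.

(** The index k dilates the support and m sharpens the profile. Two indices are needed because for
    fixed m the limit in k is the value of the bump at 0, which is below 1 and tends to 1 only with
    m. *)
Definition cutoff (m k : nat) x : R :=
  box_bump m.+1%:R (const_mx (-1)) (const_mx 1) (similarity k.+1%:R^-1 1%:M 0 x).

Lemma cutoff_test m k : test_function (cutoff m k).
Proof.
apply: test_function_similarity; first by rewrite invr_gt0.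
  exact: orthogonal1.
exact: box_bump_test.
Qed.

Lemma cutoff_ge0 m k x : 0 <= cutoff m k x.
Proof. exact: box_bump_ge0. Qed.

Lemma cutoff_le1 m k x : cutoff m k x <= 1.
Proof. exact: box_bump_le1. Qed.

(** By scaling; p > n makes this tend to 0 as k grows. *)
Lemma cutoff_energy m k : energy p (cutoff m k) = k.+1%:R^-1 `^ (p - n%:R) *
  energy p (box_bump m.+1%:R (const_mx (-1)) (const_mx 1) : E -> R).
Proof.
have tb : test_function (box_bump m.+1%:R (const_mx (-1)) (const_mx 1) : E -> R).
  exact: box_bump_test.
have k0 : 0 < k.+1%:R^-1 :> R by rewrite invr_gt0.
by have [_ <-] := D1p_similarity p1 0 k0 orthogonal1 (test_function_D1p p1 tb).
Qed.

Lemma cutoff_cvg m x : cutoff m k x @[k --> \oo] -->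
  (box_bump m.+1%:R (const_mx (-1)) (const_mx 1) (0 : E) : R).
Proof.
have tb : test_function (box_bump m.+1%:R (const_mx (-1)) (const_mx 1) : E -> R).
  exact: box_bump_test.
have c0 : k.+1%:R^-1 *: x @[k --> \oo] --> (0 : E).
  rewrite -[X in _ --> X](scale0r x).
  by apply: cvgZl; exact: cvg_invS.
have cb := test_function_continuous tb (x := 0).
have := cvg_comp _ _ c0 cb; rewrite /cutoff /similarity.
by under [X in _ -> X @ _ --> _]eq_fun do rewrite mulmx1 addr0.
Qed.

Lemma subtrunc_le (d t : R) : 0 < d -> 0 <= t -> `|t - trunc d t| <= 2 * d.
Proof.
move=> d0 t0; have t1 := trunc_ge t d0; have t2 := trunc_le t d0.
rewrite (max_idPl t0) in t2; rewrite ger0_norm; lra.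
Qed.

(* The competitor is u truncated below at height d, which keeps its support away
   from the boundary, and above at height u z, which makes the energy of the
   cutoff negligible as k grows. *)
Lemma half_cutoff_bound Omega K u z (d l : R) (m k : nat) : open Omega -> Omega <> setT ->
  Omega !=set0 -> 0 <= K -> hardy_bound p Omega K ->
  D1p0 p (@half_space R n) u -> 0 < z ord0 j -> 0 < u z -> 0 < d -> 0 < l < 1 ->
  (trunc d (u z) * cutoff m k z) `^ p <= K * z ord0 j `^ (p - n%:R) *
    ((1 - l) `^ (1 - p) * energy p u +
     l `^ (1 - p) * ((2 * u z) `^ p * energy p (cutoff m k))).
Proof.
move=> oO OT O0 K0 HK [Du u0] zj uz d0 l01.
have un x : x ord0 j <= 0 -> u x = 0.
  by move=> xj; apply: u0; rewrite (half_spaceE jn) /=; apply/negP; rewrite -leNgt.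
have [D1 E1] := D1p_trunc p1 d0 Du.
have [D2 E2] := D1p_subtrunc p1 uz D1.
set v := fun x => _ - _ in D2 E2.
have vB x : `|v x| <= 2 * u z.
  exact: (subtrunc_le uz (trunc_ge0 (u x) d0)).
have c1 x : `|cutoff m k x| <= 1 by rewrite ger0_norm ?cutoff_ge0// cutoff_le1.
have [D3 E3] := D1p_cutoff p1 l01 D2 vB (cutoff_test m k) c1.
have cu : continuous u by have [] := Du.
have /test_functionP[_ [N N0 hN]] := cutoff_test m k.
have [c c0 hc] := truncated_support N cu un d0.
have sw x : v x * cutoff m k x != 0 -> `|x| <= N /\ c <= x ord0 j.
  rewrite mulf_eq0 negb_or => /andP[vx /hN xN]; split => //; apply: hc => //.
  rewrite leNgt; apply: contraNN vx => /ltW ud.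
  by rewrite /v /= (trunc_small ud) (trunc_small (ltW uz)) subrr.
have := hardy_transplant oO OT O0 K0 HK D3 c0 sw zj.
(* The truncation from above starts at height u z, and trunc d (u z) <= u z, so the value at z is
   unchanged. *)
have -> : v z = trunc d (u z).
  rewrite /v /= (trunc_small (d := u z)) ?subr0//.
  by have := trunc_le (u z) d0; rewrite (max_idPl (ltW uz)).
rewrite (ger0_norm (mulr_ge0 (trunc_ge0 _ d0) (cutoff_ge0 _ _ _))) => /le_trans; apply.
apply: (ler_wpM2l (mulr_ge0 K0 (powR_ge0 _ _))); apply: (le_trans E3).
apply: lerD; last exact: lexx.
apply: (ler_wpM2l (powR_ge0 _ _)); exact: (le_trans E2 E1).
Qed.

(** First k tends to infinity with d, l and m fixed, which removes the energy of the cutoff. Then d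
    and l tend to 0 and [beta m] to 1, all along the single index m. *)
Lemma half_limit_bound Omega K u z : open Omega -> Omega <> setT ->
  Omega !=set0 -> 0 <= K -> hardy_bound p Omega K ->
  D1p0 p (@half_space R n) u -> 0 < z ord0 j -> 0 < u z ->
  u z `^ p <= K * z ord0 j `^ (p - n%:R) * energy p u.
Proof.
move=> oO OT O0 K0 HK Du zj uz; set A := K * _.
pose beta (m : nat) : R := box_bump m.+1%:R (const_mx (-1)) (const_mx 1) (0 : E).
have A0 : 0 <= A by rewrite mulr_ge0 ?powR_ge0.
have B (d l : R) (m : nat) : 0 < d -> 0 < l < 1 ->
    (trunc d (u z) * beta m) `^ p <= A * ((1 - l) `^ (1 - p) * energy p u).
  (* [powR_cvg] asks for a positive limit; if the left side is 0 the bound is trivial. *)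
  move=> d0 l01; have [t0|t0] := leP (trunc d (u z) * beta m) 0.
    have -> : trunc d (u z) * beta m = 0.
      by apply/eqP; rewrite eq_le t0 (mulr_ge0 (trunc_ge0 _ d0) (box_bump_ge0 _ _ _ _)).
    by rewrite powR0 ?(gt_eqF p0)// !mulr_ge0 ?powR_ge0 ?energy_ge0.
  pose C := l `^ (1 - p) * ((2 * u z) `^ p *
    energy p (box_bump m.+1%:R (const_mx (-1)) (const_mx 1) : E -> R)).
  have lhs : (trunc d (u z) * cutoff m k z) `^ p @[k --> \oo] -->
      (trunc d (u z) * beta m) `^ p.
    by apply: powR_cvg => //; apply: cvgMr; exact: cutoff_cvg.
  have rhs : A * ((1 - l) `^ (1 - p) * energy p u + C * k.+1%:R^-1 `^ (p - n%:R))
      @[k --> \oo] --> A * ((1 - l) `^ (1 - p) * energy p u + C * 0).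
    apply: cvgMr; apply: cvgD; first exact: cvg_cst.
    by apply: cvgMr; exact: invS_powR_cvg0.
  rewrite mulr0 addr0 in rhs; apply: (ler_cvg_to lhs rhs); apply: nearW => k.
  have := half_cutoff_bound m k oO OT O0 K0 HK Du zj uz d0 l01.
  rewrite cutoff_energy /C -/A.
  by rewrite -[X in _ -> _ <= _ * (_ + X)]mulrA -[(2 * u z) `^ p * _ * _]mulrA
    [energy p _ * _ `^ _]mulrC.
(* The shift by 2 keeps l strictly below 1 at m = 0. *)
have l01 (m : nat) : 0 < (m.+2%:R^-1 : R) < 1.
  by rewrite invr_gt0 ltr0n/= invf_lt1// ltr1n.
have beta1 : beta m @[m --> \oo] --> (1 : R).
  have := @box_bump_cvg R n (const_mx (-1)) (const_mx 1) 0.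
  rewrite indicE mem_set//= => i; rewrite !mxE; lra.
have tr : trunc m.+1%:R^-1 (u z) @[m --> \oo] --> u z.
  by have := @trunc_cvg R (u z); rewrite (max_idPl (ltW uz)).
have lhs : (trunc m.+1%:R^-1 (u z) * beta m) `^ p @[m --> \oo] --> u z `^ p.
  by apply: powR_cvg => //; rewrite -[X in _ --> X]mulr1; apply: cvgM.
have rhs : A * ((1 - m.+2%:R^-1) `^ (1 - p) * energy p u) @[m --> \oo] -->
    A * (1 * energy p u).
  have c : 1 - m.+2%:R^-1 @[m --> \oo] --> (1 - 0 : R).
    apply: cvgB; first exact: cvg_cst.
    by have := @cvg_invS R; rewrite -(cvg_shiftS (fun k : nat => k.+1%:R^-1 : R)).
  rewrite subr0 in c; have := powR_cvg (q := 1 - p) ltr01 c; rewrite powR1 => c'.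
  by apply: cvgMr; apply: cvgMl; exact: c'.
rewrite mul1r in rhs; apply: (ler_cvg_to lhs rhs); apply: nearW => m.
by apply: B; [rewrite invr_gt0|exact: l01].
Qed.

Lemma hardy_half Omega K : open Omega -> Omega <> setT -> Omega !=set0 -> 0 <= K ->
  hardy_bound p Omega K -> hardy_bound p (@half_space R n) K.
Proof.
move=> oO OT O0 K0 HK u Du z hz.
have zj : 0 < z ord0 j by move: hz; rewrite (half_spaceE jn).
rewrite (dist_compl_half jn zj); have [uz|uz|uz] := ltgtP (u z) 0.
- have [Du1 u0] := Du; have [D1 E1] := D1pZ p1 (-1) Du1.
  have D0 : D1p0 p (@half_space R n) (fun x => -1 * u x).
    by split; [exact: D1|move=> x /u0 ->; rewrite mulr0].
  have := half_limit_bound oO OT O0 K0 HK D0 zj.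
  rewrite E1 normrN normr1 powR1 mul1r mulN1r oppr_gt0 (ltr0_norm uz).
  exact.
- by rewrite (gtr0_norm uz); exact: (half_limit_bound oO OT O0 K0 HK Du zj uz).
- by rewrite uz normr0 powR0 ?(gt_eqF p0)// bound_ge0.
Qed.

End transplant.

(** * The sharp constants *)

Section constants.
Context {R : realType} {n : nat}.
Local Notation E := 'rV[R]_n.
Local Notation mu := (rV_lebesgue R n).
Implicit Types (u v : E -> R) (x y z : E) (Omega : set E) (K r : R).
Variables (p : R) (j : 'I_n).
Hypotheses (np : n%:R < p) (jn : j.+1 = n).

Let n1 : 1 <= n%:R :> R. Proof. by rewrite ler1n -jn. Qed.
Let p1 : 1 <= p. Proof. exact/ltW/(le_lt_trans n1). Qed.
Let p0 : 0 < p. Proof. exact: lt_le_trans p1. Qed.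
Let pn0 : p != 0. Proof. by rewrite gt_eqF. Qed.
Local Notation alpha := (1 - n%:R / p).

Lemma ler_powR_iff (a b : R) : 0 <= a -> 0 <= b -> (a `^ p <= b `^ p) = (a <= b).
Proof.
move=> a0 b0; apply/idP/idP => [|ab]; last exact: powR_mono (ltW p0) a0 ab.
by apply: contraTT; rewrite -!ltNge => ba; apply: gt0_ltr_powR => //; rewrite nnegrE.
Qed.

Lemma powR_root (e : R) : 0 <= e -> (e `^ p^-1) `^ p = e.
Proof. by move=> e0; rewrite -powRrM mulVf// powRr1. Qed.

Lemma powR_alpha (d : R) : (d `^ alpha) `^ p = d `^ (p - n%:R).
Proof. by rewrite -powRrM mulrBl mul1r divfK. Qed.

Lemma root_bound (a d c e : R) : 0 <= a -> 0 < d -> 0 <= c -> 0 <= e ->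
  (a / d `^ alpha <= c * e `^ p^-1) = (a `^ p <= c `^ p * d `^ (p - n%:R) * e).
Proof.
move=> a0 d0 c0 e0; have da : 0 < d `^ alpha by rewrite powR_gt0.
rewrite ler_pdivrMr// -ler_powR_iff//; last by rewrite !mulr_ge0 ?powR_ge0.
rewrite !powRM ?powR_ge0 ?mulr_ge0 ?powR_ge0// powR_root// powR_alpha.
by rewrite -!mulrA [e * _]mulrC.
Qed.

(** Off Omega the function is 0, hence so is its gradient almost everywhere, and the integral over
    Omega is the full energy. *)
Lemma grad_LnormE Omega u : measurable Omega -> D1p p u ->
  (forall x, ~ Omega x -> u x = 0) -> grad_Lnorm p Omega u = (energy p u `^ p^-1)%:E.
Proof.
move=> mO Du u0; have [G [cu uG fG _]] := D1p_grad p1 Du.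
have wG := weak_grad_is uG; have fW := finite_energy_weak_grad uG fG.
have mW := measurable_weak_grad wG.
rewrite /grad_Lnorm -poweR_EFin; congr (_ `^ _)%E.
rewrite /energy /Rintegral fineK; last exact: integrable_fin_num.
rewrite [LHS]integral_mkcond; apply: ae_eq_integral.
- exact: measurableT.
- apply/(measurable_restrictT _ mO)/measurable_funTS/measurable_EFinP.
  exact: measurable_enorm_powR.
- by apply/measurable_EFinP; exact: measurable_enorm_powR.
- have := weak_grad_eq0 cu wG; apply: filterS => x h _.
  rewrite patchE; case: ifPn => // /negP xO.
  by rewrite h ?enorm0 ?powR0// u0// => Ox; apply: xO; rewrite inE.
Qed.

Lemma grad_LnormT u : D1p p u -> grad_Lnorm p setT u = (energy p u `^ p^-1)%:E.
Proof. by move=> Du; apply: (grad_LnormE measurableT Du) => x; case. Qed.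

Let morrey_set := [set C | 0 < C /\ forall u : E -> R, D1p p u ->
  (holder_seminorm p u <= C%:E * grad_Lnorm p setT u)%E].

Lemma morrey_setP (C : R) : morrey_set C <-> 0 < C /\ forall u, D1p p u -> forall x y, x != y ->
  `|u x - u y| / enorm (x - y) `^ alpha <= C * energy p u `^ p^-1.
Proof.
split=> -[C0 h]; split => // u Du.
  move=> x y xy; have := h u Du; rewrite (grad_LnormT Du) => hu.
  rewrite -lee_fin EFinM; apply: le_trans hu; apply: ereal_sup_ubound.
  by exists (x, y).
rewrite (grad_LnormT Du); apply: ge_ereal_sup => _ [[x y] /= xy <-].
by rewrite -EFinM lee_fin; exact: h.
Qed.

Lemma morrey_bound_set K : 0 < K -> morrey_bound (n := n) p K <-> morrey_set (K `^ p^-1).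
Proof.
move=> K0; have k0 : 0 < K `^ p^-1 by rewrite powR_gt0.
rewrite morrey_setP; split=> [MK|[_ h] u Du x y].
  split => // u Du x y xy; rewrite root_bound ?energy_ge0 ?(ltW k0) ?enorm_gt0 ?subr_eq0//.
  by rewrite (powR_root (ltW K0)); exact: MK.
have [->|xy] := eqVneq x y.
  by rewrite !subrr normr0 powR0//; apply: bound_ge0; exact: ltW.
have := h u Du x y xy; rewrite root_bound ?energy_ge0 ?(ltW k0) ?enorm_gt0 ?subr_eq0//.
by rewrite (powR_root (ltW K0)).
Qed.

(** A bump is not constant; this makes the infimum in [morrey_const] positive. *)
Lemma exists_D1p_neq : exists u, D1p p u /\ exists x y, u x != u y.
Proof.
pose a : E := const_mx (-1); pose b : E := const_mx 1.
exists (box_bump 1 a b); split; first by apply: test_function_D1p => //; exact: box_bump_test.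
exists 0, b; rewrite (@box_bump_out _ _ 1 a b b)//; last by move/(_ j); rewrite ltxx andbF.
rewrite gt_eqF//; apply: prodr_gt0 => i _; rewrite !mxE.
by rewrite mulr_gt0// eta_gt0// mul1r; lra.
Qed.

(** The inequalities on C are closed conditions, so the infimum satisfies them too ([cst_le]). It is
    positive because the space contains a nonconstant function. *)
Lemma morrey_set_inf (C : R) : morrey_set !=set0 ->
  0 < morrey_const n p /\ (0 < C -> morrey_set C <-> morrey_const n p <= C).
Proof.
move=> M0; have lb : has_lbound morrey_set by exists 0 => D [D0 _]; exact: ltW.
have cst_le u x y (e := energy p u `^ p^-1) : D1p p u -> x != y ->
    `|u x - u y| / enorm (x - y) `^ alpha <= morrey_const n p * e.
  move=> Du xy; have e0 : 0 <= e by exact: powR_ge0.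
  have h D : morrey_set D -> `|u x - u y| / enorm (x - y) `^ alpha <= D * e.
    by move=> /morrey_setP[_]; exact.
  (* If u has zero energy, any admissible D bounds the quotient by 0; otherwise divide by e and pass
     to the infimum. *)
  have [e1|e1] := eqVneq e 0.
    by have [D /h] := M0; rewrite e1 !mulr0.
  have e2 : 0 < e by rewrite lt0r e1.
  rewrite -ler_pdivrMr//; apply: lb_le_inf => // D /h.
  by rewrite -(ler_pdivrMr _ _ e2).
have c0 : 0 < morrey_const n p.
  have [u [Du [x [y uxy]]]] := exists_D1p_neq.
  have xy : x != y by apply: contraNneq uxy => ->.
  have := cst_le u x y Du xy.
  have a0 : 0 < `|u x - u y| / enorm (x - y) `^ alpha.
    by rewrite divr_gt0// ?normr_gt0 ?subr_eq0// powR_gt0// enorm_gt0 subr_eq0.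
  move=> /(lt_le_trans a0); apply: contraTT; rewrite -!leNgt => c.
  by rewrite mulr_le0_ge0// powR_ge0.
split => // C0; split => [MC|le]; first exact: ge_inf.
apply/morrey_setP; split => // u Du x y xy; apply: le_trans (cst_le u x y Du xy) _.
by rewrite ler_wpM2r// powR_ge0.
Qed.

Lemma morrey_boundP K : 0 < K -> morrey_bound (n := n) p K <-> K^-1 <= morrey_const n p `^ (- p).
Proof.
move=> K0; rewrite (morrey_bound_set K0); have k0 : 0 < K `^ p^-1 by rewrite powR_gt0.
(* If no constant were admissible, the infimum would be 0 and so would
   [0 `^ (- p)]; hence Morrey's inequality itself is not needed. *)
have [M0|M0] := pselect (morrey_set !=set0); last first.
  have -> : morrey_const n p = 0.
    by rewrite /morrey_const -/morrey_set; move/nonemptyPn : M0 => ->; exact: inf0.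
  rewrite powR0 ?oppr_eq0//; split => [h|]; first by case: M0; exists (K `^ p^-1).
  by rewrite leNgt invr_gt0 K0.
have [C0 /(_ k0) ->] := morrey_set_inf (K `^ p^-1) M0.
rewrite powRN lef_pV2 ?posrE ?powR_gt0// -(ler_powR_iff (ltW C0) (ltW k0)).
by rewrite (powR_root (ltW K0)).
Qed.

Lemma hardy_quotient_ge K Omega u : open Omega -> Omega <> setT -> 0 < K ->
  (D1p0 p Omega `\ cst 0) u ->
  (K^-1%:E <= hardy_quotient p Omega u)%E <->
  forall x, Omega x -> `|u x| `^ p <= K * dist_compl Omega x `^ (p - n%:R) * energy p u.
Proof.
move=> oO OT K0 [[Du u0] un0]; have k0 : 0 < K `^ p^-1 by rewrite powR_gt0.
have [x1 ux1] : exists x, u x != 0.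
  apply/not_existsP => h; apply: un0; apply/funext => x /=; apply/eqP.
  by apply: contrapT => /negP; exact: h.
have Ox1 : Omega x1 by apply: contrapT => /u0 e; move: ux1; rewrite e eqxx.
have O0 : Omega !=set0 by exists x1.
have S1 x : Omega x -> ((`|u x| / dist_compl Omega x `^ alpha)%:E <= hardy_supnorm p Omega u)%E.
  by move=> Ox; apply: ereal_sup_ubound; exists x.
have dg x : Omega x -> 0 < dist_compl Omega x by exact: dist_compl_gt0.
have v0 : 0 < `|u x1| / dist_compl Omega x1 `^ alpha.
  by rewrite divr_gt0 ?normr_gt0// powR_gt0// dg.
have e0 := energy_ge0 p u.
have rb x : Omega x -> (`|u x| / dist_compl Omega x `^ alpha <= K `^ p^-1 * energy p u `^ p^-1) =
    (`|u x| `^ p <= K * dist_compl Omega x `^ (p - n%:R) * energy p u).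
  by move=> Ox; rewrite root_bound ?(powR_root (ltW K0))// ?(ltW k0)// dg.
have SE : (forall x, Omega x -> `|u x| `^ p <= K * dist_compl Omega x `^ (p - n%:R) * energy p u) <->
    (hardy_supnorm p Omega u <= (K `^ p^-1 * energy p u `^ p^-1)%:E)%E.
  split=> [h|h x Ox]; last by rewrite -rb// -lee_fin; exact: le_trans (S1 _ Ox) h.
  by apply: ge_ereal_sup => _ [x Ox <-]; rewrite lee_fin rb//; exact: h.
rewrite SE /hardy_quotient (grad_LnormE (open_measurable_rV oO) Du u0).
(* The value at x1 makes the supremum positive and excludes -oo. If it is +oo, its inverse and the
   quotient are 0, so both sides of the equivalence fail. *)
have := S1 x1 Ox1; case: (hardy_supnorm p Omega u) => [s|_|//]; last first.
  by rewrite poweRyr// invey mul0e lee_fin leNgt invr_gt0 K0.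
rewrite lee_fin => /(lt_le_trans v0) s0; rewrite !poweR_EFin powR_root// inver.
rewrite gt_eqF ?powR_gt0// -EFinM !lee_fin -(ler_powR_iff (ltW s0)); last first.
  by rewrite mulr_ge0 ?powR_ge0.
rewrite powRM ?powR_ge0// (powR_root e0) (powR_root (ltW K0)).
by rewrite mulrC ler_pdivlMr ?powR_gt0// ler_pdivrMl.
Qed.

Lemma hardy_lambdaP K Omega : open Omega -> Omega <> setT -> 0 < K ->
  (K^-1%:E <= hardy_lambda p Omega)%E <-> hardy_bound p Omega K.
Proof.
move=> oO OT K0; split=> [h u Du x Ox|h].
  have [u0|/eqP u0] := pselect (u = cst 0).
    by rewrite u0 /= normr0 powR0// bound_ge0// ltW.
  have uD : (D1p0 p Omega `\ cst 0) u by split => //; apply/eqP.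
  apply: (hardy_quotient_ge oO OT K0 uD).1 => //; apply: le_trans h _.
  by apply: ereal_inf_lbound; exists u.
apply: le_ereal_inf_tmp => _ [u uD <-]; apply/(hardy_quotient_ge oO OT K0 uD) => x Ox.
by apply: h => //; case: uD.
Qed.

Lemma hardy_lambda_ge0 Omega : (0 <= hardy_lambda p Omega)%E.
Proof.
apply: le_ereal_inf_tmp => _ [u _ <-].
by rewrite /hardy_quotient mule_ge0// ?inve_ge0 poweR_ge0.
Qed.

Lemma hardy_boundP r Omega : open Omega -> Omega <> setT -> 0 < r ->
  (r%:E <= hardy_lambda p Omega)%E <-> hardy_bound p Omega r^-1.
Proof.
move=> oO OT r0; rewrite -{1}[r]invrK; apply: hardy_lambdaP => //.
by rewrite invr_gt0.
Qed.

End constants.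

(** Positive reals below a determine the comparison also when a or b is 0 or +oo. *)
Lemma le_ereal_pos (R : realType) (a b : \bar R) : (0 <= b)%E ->
  (forall r : R, 0 < r -> (r%:E <= a)%E -> (r%:E <= b)%E) -> (a <= b)%E.
Proof.
case: a b => [a| |] [b| |]// b0 h; rewrite ?leey ?leNye//.
- by have [a0|a0] := ltP 0 a; [exact: h|rewrite lee_fin (le_trans a0)].
- have b1 : 0 < b + 1 by rewrite ltr_wpDl.
  by have := h _ b1; rewrite leey lee_fin gerDl ler10 => /(_ isT).
Qed.

Lemma eq_ereal_pos (R : realType) (a : \bar R) (L : R) : (0 <= a)%E -> 0 <= L ->
  (forall r : R, 0 < r -> (r%:E <= a)%E <-> r <= L) -> a = L%:E.
Proof.
move=> a0 L0 h; apply/eqP; rewrite eq_le; apply/andP; split; apply: le_ereal_pos => //.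
- by move=> r r0 /(h r r0); rewrite lee_fin.
- by move=> r r0; rewrite lee_fin => /(h r r0).
Qed.

Theorem theoremA (R : realType) (n : nat) (p : R) (Omega : set 'rV[R]_n) :
  (1 <= n)%N -> n%:R < p ->
  open Omega -> Omega !=set0 -> Omega <> setT ->
  [/\ (morrey_const n p `^ (- p))%:E = hardy_lambda p (~` [set 0%R : 'rV[R]_n]),
      (hardy_lambda p (~` [set 0%R : 'rV[R]_n]) <= hardy_lambda p Omega)%E,
      (hardy_lambda p Omega <= hardy_lambda p (@half_space R n))%E
    & hardy_lambda p (@half_space R n) =
        (2 ^+ (n - 1) * morrey_const n p `^ (- p))%:E].
Proof.
move=> n1 np oO O0 OT.
have [j jn] : exists j : 'I_n, j.+1 = n.
  by case: n n1 {p np Omega oO O0 OT} => // m _; exists ord_max.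
have oP := @open_punctured R n; have PT := @punctured_neqT R n.
have oH : open (@half_space R n) by rewrite (half_spaceE jn); exact: open_half.
have HT : @half_space R n <> setT by rewrite (half_spaceE jn); exact: half_neqT.
have rV (r : R) : 0 < r -> 0 < r^-1 by rewrite invr_gt0.
have lP r : 0 < r -> (r%:E <= hardy_lambda p (~` [set 0%R : 'rV[R]_n]))%E <->
    morrey_bound (n := n) p r^-1.
  move=> r0; rewrite (hardy_boundP np jn oP PT r0); split.
    by apply: (hardy_punctured_morrey np jn); exact/ltW/rV.
  exact: morrey_hardy.
have lH r : 0 < r -> (r%:E <= hardy_lambda p (@half_space R n))%E <->
    morrey_bound (n := n) p (2 ^+ n.-1 * r^-1).
  move=> r0; rewrite (hardy_boundP np jn oH HT r0); split.
    by apply: (half_morrey np jn); exact/ltW/rV.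
  exact: (morrey_half np jn).
split.
- apply/esym/eq_ereal_pos; [exact: hardy_lambda_ge0|exact: powR_ge0|move=> r r0].
  by rewrite (lP r r0) (morrey_boundP np jn (rV _ r0)) invrK.
- apply: le_ereal_pos => [|r r0 /(lP r r0) h]; first exact: hardy_lambda_ge0.
  by apply/(hardy_boundP np jn oO OT r0); exact: morrey_hardy.
- apply: le_ereal_pos => [|r r0 /(hardy_boundP np jn oO OT r0) h].
    exact: hardy_lambda_ge0.
  apply/(hardy_boundP np jn oH HT r0).
  by apply: (hardy_half np jn oO OT O0 _ h); exact/ltW/rV.
- apply: eq_ereal_pos; first exact: hardy_lambda_ge0.
    by rewrite mulr_ge0 ?powR_ge0// exprn_ge0.
  have t0 : 0 < (2 ^+ n.-1 : R) by rewrite exprn_gt0.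
  move=> r r0; rewrite (lH r r0) (morrey_boundP np jn); last by rewrite mulr_gt0// rV.
  by rewrite invfM invrK subn1 ler_pdivrMl.
Qed.
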